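(* Let $(P,\pi)$ be a simply connected and compact regular Poisson manifold whose symplectic foliation $\mathcal F$ is transversally oriented of codimension $1$. Then the modular class of $P$ is nonzero: $mod(P)\neq 0$ in $H^1_\pi(P)$.
   Context: Manifolds are smooth and without boundary. A Poisson manifold $(P,\pi)$ is a smooth manifold with a Poisson bivector $\pi$; the bundle map $\pi:T^*P\to TP$ is defined by $\beta(\pi(\alpha))=\pi(\alpha,\beta)$. It is regular if this bundle map has constant rank; its symplectic foliation $\mathcal F$ is then the regular foliation with tangent bundle $T\mathcal F=\pi(T^*P)$. $\mathcal F$, of codimension $q$, is transversally oriented if there is a nowhere vanishing $q$-form $\nu$ on $P$ with $i_X\nu=0$ for all $X$ tangent to $\mathcal F$ (this makes $P$ orientable, since the leaves are symplectic). Modular class: $H^1_\pi(P)$ denotes the first Poisson cohomology space, i.e. vector fields $\xi$ with $L_\xi\pi=0$ modulo Hamiltonian vector fields $\pi(df)$, $f\in C^\infty(P)$. For a volume form $\mu$ on $P$, the map $f\mapsto \mathrm{div}_\mu\,\pi(df)$, where $L_X\mu=(\mathrm{div}_\mu X)\mu$, is a derivation of $C^\infty(P)$, i.e. a vector field $\phi_\mu$ (the modular vector field). It satisfies $L_{\phi_\mu}\pi=0$ and its class in $H^1_\pi(P)$ does not depend on $\mu$; this class is the modular class $mod(P)$. *)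

(* Defs.v *)
From HB Require Import structures.
From mathcomp Require Import all_boot all_order all_algebra.
From mathcomp Require Import all_classical all_reals all_analysis.

Set Implicit Arguments.
Unset Strict Implicit.
Unset Printing Implicit Defensive.

Import Order.TTheory GRing.Theory Num.Theory.
Import numFieldNormedType.Exports.

Local Open Scope classical_set_scope.
Local Open Scope ring_scope.

Definition partial (R : realType) (n : nat) (i : 'I_n) (f : 'rV[R]_n -> R)
  : 'rV[R]_n -> R := fun x => 'D_(delta_mx 0 i) f x.

(* [D] is meant to be open, so values of [f] outside [D] are irrelevant. *)
Fixpoint Ck_on (R : realType) (n k : nat) (D : set 'rV[R]_n)
    (f : 'rV[R]_n -> R) : Prop :=
  match k with
  | 0 => forall x, D x -> {for x, continuous f}
  | k'.+1 => (forall x, D x -> differentiable f x) /\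
             (forall i : 'I_n, Ck_on k' D (partial i f))
  end.

Definition smooth_on (R : realType) (n : nat) (D : set 'rV[R]_n)
  (f : 'rV[R]_n -> R) : Prop := forall k, Ck_on k D f.

Definition mx_smooth_on (R : realType) (n a b : nat) (D : set 'rV[R]_n)
  (F : 'rV[R]_n -> 'M[R]_(a, b)) : Prop :=
  forall i j, smooth_on D (fun x => F x i j).

(* A chart [c] is a homeomorphism [coord c] from the open set [cdom c] of the
   manifold onto the open set [cimg c] of R^n, with inverse [param c]. The atlas
   need not be maximal. *)
Record manifold (R : realType) (n : nat) : Type := Manifold {
  points :> topologicalType;
  hausdorff_points : hausdorff_space points;
  second_countable_points : @second_countable points;
  chart : Type;
  cdom : chart -> set points;
  cimg : chart -> set 'rV[R]_n;
  coord : chart -> points -> 'rV[R]_n;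
  param : chart -> 'rV[R]_n -> points;
  cdom_cover : forall p, exists c, cdom c p;
  cdom_open : forall c, open (cdom c);
  cimg_open : forall c, open (cimg c);
  coord_img : forall c p, cdom c p -> cimg c (coord c p);
  param_dom : forall c x, cimg c x -> cdom c (param c x);
  coordK : forall c p, cdom c p -> param c (coord c p) = p;
  paramK : forall c x, cimg c x -> coord c (param c x) = x;
  coord_continuous : forall c p, cdom c p -> {for p, continuous (coord c)};
  param_continuous : forall c x, cimg c x -> {for x, continuous (param c)};
  transition_smooth : forall c c',
    mx_smooth_on [set x | cimg c x /\ cdom c' (param c x)]
      (fun x => coord c' (param c x)) }.

Arguments chart {R n} P : rename.
Arguments cdom {R n P} c : rename.
Arguments cimg {R n P} c : rename.
Arguments coord {R n P} c p : rename.
Arguments param {R n P} c x : rename.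

Definition path_connected (R : realType) (T : topologicalType) : Prop :=
  (exists p : T, True) /\
  forall p q : T, exists g : R -> T,
    [/\ {within `[0, 1], continuous g}, g 0 = p & g 1 = q].

(* Path connected (hence nonempty), and every loop is null-homotopic relative
   to its base point. *)
Definition simply_connected (R : realType) (T : topologicalType) : Prop :=
  path_connected R T /\
  forall g : R -> T, {within `[0, 1], continuous g} -> g 0 = g 1 ->
    exists H : R * R -> T,
      [/\ {within `[0, 1] `*` `[0, 1], continuous H},
          forall t, t \in `[0, 1] -> H (0, t) = g t,
          forall t, t \in `[0, 1] -> H (1, t) = g 0 &
          forall s, s \in `[0, 1] -> H (s, 0) = g 0 /\ H (s, 1) = g 0].

Section Tensors.
Variables (R : realType) (n : nat) (P : manifold R n).

Definition overlap (c c' : chart P) : set 'rV[R]_n :=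
  [set x | cimg c x /\ cdom c' (param c x)].

Definition transition (c c' : chart P) : 'rV[R]_n -> 'rV[R]_n :=
  fun x => coord c' (param c x).

(* ['J f x] has entry [partial i f^j] at (i, j): it acts on row vectors by
   multiplication on the right. *)
Definition tjac (c c' : chart P) (x : 'rV[R]_n) : 'M[R]_n :=
  'J (transition c c') x.

(* A tensor field is given by its components [t c x] in each chart [c] at each
  [x] in [cimg c], with the usual change of coordinates; components outside
  [cimg c] are meaningless and every property below ignores them. *)

Definition local_rep (f : P -> R) (c : chart P) : 'rV[R]_n -> R :=
  fun x => f (param c x).

Definition smooth_fun (f : P -> R) : Prop :=
  forall c : chart P, smooth_on (cimg c) (local_rep f c).

Definition components (a b : nat) : Type := chart P -> 'rV[R]_n -> 'M[R]_(a, b).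

Definition smooth_components a b (t : components a b) : Prop :=
  forall c, mx_smooth_on (cimg c) (t c).

(* X = sum_i X^i d/dx_i, with (X^i) a row. *)
Definition is_vector_field (X : components 1 n) : Prop :=
  smooth_components X /\
  forall c c' x, overlap c c' x ->
    X c' (transition c c' x) = X c x *m tjac c c' x.

(* nu = sum_i nu_i dx_i, with (nu_i) a column. *)
Definition is_one_form (nu : components n 1) : Prop :=
  smooth_components nu /\
  forall c c' x, overlap c c' x ->
    nu c x = tjac c c' x *m nu c' (transition c c' x).

(* pi c x i j = pi(dx_i, dx_j). *)
Definition is_bivector_field (pi : components n n) : Prop :=
  [/\ smooth_components pi,
      forall c x, cimg c x -> (pi c x)^T = - pi c x &
      forall c c' x, overlap c c' x ->
        pi c' (transition c c' x) = (tjac c c' x)^T *m pi c x *m tjac c c' x].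

(* The n-form mu is (mu c) dx_1 /\ ... /\ dx_n in the chart c. *)
Definition is_volume_form (mu : chart P -> 'rV[R]_n -> R) : Prop :=
  [/\ forall c, smooth_on (cimg c) (mu c),
      forall c x, cimg c x -> mu c x != 0 &
      forall c c' x, overlap c c' x ->
        mu c x = \det (tjac c c' x) * mu c' (transition c c' x)].

Definition differential (f : P -> R) : components n 1 :=
  fun c x => \col_i partial i (local_rep f c) x.

Definition vf_apply (X : components 1 n) (f : P -> R)
    (c : chart P) (x : 'rV[R]_n) : R :=
  (X c x *m differential f c x) 0 0.

(* The coordinate expression of L_X (mu dx_1 /\ ... /\ dx_n). *)
Definition lie_volume (X : components 1 n) (mu : chart P -> 'rV[R]_n -> R)
    (c : chart P) (x : 'rV[R]_n) : R :=
  \sum_i X c x 0 i * partial i (mu c) x +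
  mu c x * \sum_i partial i (fun y => X c y 0 i) x.

Definition lie_bivector (X : components 1 n) (pi : components n n)
  : components n n := fun c x => \matrix_(i, j) \sum_k
    (X c x 0 k * partial k (fun y => pi c y i j) x
     - pi c x k j * partial k (fun y => X c y 0 i) x
     - pi c x i k * partial k (fun y => X c y 0 j) x).

(* The vanishing of the (i, j, k) component of [pi, pi]. *)
Definition is_poisson (pi : components n n) : Prop :=
  is_bivector_field pi /\
  forall c x, cimg c x -> forall i j k : 'I_n,
    \sum_l (pi c x i l * partial l (fun y => pi c y j k) x
          + pi c x j l * partial l (fun y => pi c y k i) x
          + pi c x k l * partial l (fun y => pi c y i j) x) = 0.

(* beta (sharp pi alpha) = pi(alpha, beta). *)
Definition sharp (pi : components n n) (alpha : components n 1)
  : components 1 n := fun c x => (alpha c x)^T *m pi c x.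

(* The linear map T*P -> TP at a point is right multiplication by [pi c x] on
   row vectors: its rank is [\rank (pi c x)], and its image, the tangent space
   of the symplectic foliation, is the row space of [pi c x]. *)
Definition is_regular (pi : components n n) : Prop :=
  exists r : nat, forall c x, cimg c x -> \rank (pi c x) = r.

Definition foliation_codim (pi : components n n) (q : nat) : Prop :=
  forall c x, cimg c x -> (\rank (pi c x) + q = n)%N.

(* Transverse orientability of a foliation of codimension 1, for which the
   transverse volume form is a 1-form. *)
Definition transversally_oriented1 (pi : components n n) : Prop :=
  exists nu : components n 1,
    [/\ is_one_form nu,
        forall c x, cimg c x -> nu c x != 0 &
        forall c x, cimg c x ->
          forall v : 'rV[R]_n, (v <= pi c x)%MS -> v *m nu c x = 0].

Definition hamiltonian (pi : components n n) (X : components 1 n) : Prop :=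
  exists2 f : P -> R, smooth_fun f &
    forall c x, cimg c x -> X c x = sharp pi (differential f) c x.

Definition poisson_field (pi : components n n) (X : components 1 n) : Prop :=
  is_vector_field X /\ forall c x, cimg c x -> lie_bivector X pi c x = 0.

(* The class of X in H^1_pi(P), as a coset. *)
Definition H1_class (pi : components n n) (X : components 1 n)
  : set (components 1 n) :=
  [set Y | poisson_field pi Y /\ hamiltonian pi (fun c x => Y c x - X c x)].

Definition H1_zero (pi : components n n) : set (components 1 n) :=
  H1_class pi (fun _ _ => 0).

(* phi is the derivation f |-> div_mu (pi(df)); the divergence is eliminated
   through L_X mu = (div_mu X) mu. *)
Definition is_modular_field (pi : components n n)
    (mu : chart P -> 'rV[R]_n -> R) (phi : components 1 n) : Prop :=
  is_vector_field phi /\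
  forall f : P -> R, smooth_fun f -> forall c x, cimg c x ->
    lie_volume (sharp pi (differential f)) mu c x =
    vf_apply phi f c x * mu c x.

(* The class does not depend on the choice of mu, so at most one m satisfies
   this. *)
Definition is_modular_class (pi : components n n)
    (m : set (components 1 n)) : Prop :=
  exists mu phi, [/\ is_volume_form mu, is_modular_field pi mu phi &
                     m = H1_class pi phi].

End Tensors.

Arguments components {R n} P a b.

(* Main.v *)
Require Import Defs.
From HB Require Import structures.
From mathcomp Require Import all_boot all_order all_algebra.
From mathcomp Require Import all_classical all_reals all_analysis.
From mathcomp Require Import perm ring lra.
Import Order.TTheory GRing.Theory Num.Theory.
Import numFieldNormedType.Exports.
Local Open Scope classical_set_scope.
Local Open Scope ring_scope.

(** Existence. On a chart, [pi] and a transverse form [nu] determine a positive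
density through [det (pi + Z Z^T) = t (nu^T Z)^2], namely [|t|^(-1/2)]. The signs
of the Jacobians of the transition maps form a locally constant cocycle with
values in Z/2, which is trivial on a simply connected manifold, so that the
density can be turned into a volume form. Its modular vector field is given in
coordinates by [phi^i = mu^-1 sum_j d_j (mu pi^ij)]; Piola's identity makes it a
vector field.

Nonvanishing. If [phi = - pi(df)] then [rho = e^(-f) mu] is invariant under all
Hamiltonian fields. The multiple [W] of [nu] normalised by
[(W^T Z)^4 = rho^4 det (pi + Z Z^T)^2] is then invariant as well, so that
[i_X dW = 0] for [X] tangent to the foliation, and [dW = 0] since the codimension
is one. By simple connectedness [W = dh], and at a maximum of [h], which exists
by compactness, [W] vanishes: a contradiction. *)

Set Implicit Arguments.
Unset Strict Implicit.
Unset Printing Implicit Defensive.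

(** * Smooth calculus on open subsets of R^n *)

(** The natural volume form is nu /\ omega^k / k!, with omega the leafwise symplectic form and n =
    2k+1. Rank-one updates of the matrix of [pi] stand in for exterior powers and Pfaffians: det (pi
    + Z Z^T) = Z^T adj(pi) Z, and adj(pi), symmetric of rank one, is a multiple of nu nu^T. The
    price is that only squares are visible. Hence a density instead of a form, and the detour
    through the sign cocycle; hence also the exponents, since (W^T Z)^2 = rho^2 |det (pi + Z Z^T)|
    becomes polynomial after one more squaring. As [W] kills the tangent vectors, i_X dW = L_X W;
    the Hamiltonian fields of the coordinates span the tangent spaces of the leaves, and a 2-form
    annihilated by a hyperplane vanishes. One statement on locally constant cocycles in an abelian
    group serves twice: for the signs, in Z/2, and for the differences of local primitives of [W],
    in R. It is proved by transport along paths and homotopies. A modular field is specified by its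
    action on global functions only; bump functions recover its coordinates from that. *)

Lemma near_eq_continuous (T U : topologicalType) (f g : T -> U) x :
  {near x, f =1 g} -> {for x, continuous f} -> {for x, continuous g}.
Proof.
move=> fg cf; rewrite /prop_for /continuous_at -(nbhs_singleton fg).
exact: cvg_trans (near_eq_cvg fg) cf.
Qed.

Section Differentiability.
Context {R : realType} {V : normedModType R}.

Lemma is_diff_eps (f : V -> R) (L : {linear V -> R}) x :
  continuous L ->
  (forall e, 0 < e -> \forall h \near (0 : V), `|f (h + x) - f x - L h| <= e * `|h|) ->
  is_diff x f L.
Proof.
move=> cL H.
have E : f \o shift x = cst (f x) + L +o_ 0 id.
  apply/eqaddoP => e e0.
  have := H e e0; apply: filterS => h /=.
  by rewrite !fctE opprD addrA.
have U := diff_unique cL E.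
apply: DiffDef => //.
by apply/diff_locallyP; rewrite U.
Qed.

Lemma near_eq_differentiable (f g : V -> R) x :
  {near x, f =1 g} -> differentiable f x -> differentiable g x.
Proof.
move=> fg df; suff H : is_diff x g ('d f x) by [].
apply: is_diff_eps; first exact: diff_continuous.
move=> e e0; rewrite -(nbhs_singleton fg).
have /diff_locally/eqaddoP/(_ e e0) df' := df.
have {}fg : \forall h \near (0:V), f (h + x) = g (h + x).
  have {}fg : \forall y \near x, f y = g y := fg.
  rewrite (near_shift 0) in fg; apply: filterS fg => h /=.
  by rewrite subr0.
apply: filterS2 fg df' => h /= <-.
by rewrite !fctE opprD addrA.
Qed.

End Differentiability.

Section SmoothCalculus.
Context {R : realType} {n : nat}.
Implicit Types (D : set 'rV[R]_n) (f g : 'rV[R]_n -> R).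

Lemma near_eq_partial (i : 'I_n) f g x :
  {near x, f =1 g} -> partial i f x = partial i g x.
Proof. by move=> fg; apply: near_eq_derive. Qed.

Lemma eq_on_near D f g x : open D -> (forall y, D y -> f y = g y) -> D x ->
  {near x, f =1 g}.
Proof.
by move=> oD fg Dx; have := open_nbhs_nbhs (conj oD Dx); apply: filterS.
Qed.

(** Openness of [D] makes the derivatives at a point of [D] depend only on values on [D]; this
    licenses rewriting [f] under iterated partial derivatives. *)
Lemma Ck_on_ext k D f g : open D -> (forall x, D x -> f x = g x) ->
  Ck_on k D f -> Ck_on k D g.
Proof.
move=> oD; elim: k f g => [|k IH] f g fg /=.
  move=> cf x Dx; have nfg := eq_on_near oD fg Dx.
  exact: near_eq_continuous nfg (cf x Dx).
move=> [df pf]; split=> [x Dx|i].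
  by apply: near_eq_differentiable (df x Dx); exact: eq_on_near fg Dx.
by apply: IH (pf i) => x Dx; apply: near_eq_partial; exact: eq_on_near fg Dx.
Qed.

Lemma Ck_onW k D f : Ck_on k.+1 D f -> Ck_on k D f.
Proof.
elim: k f => [|k IH] f /= [df pf].
  by move=> x Dx; apply: differentiable_continuous; exact: df.
by split=> // i; apply: IH; exact: pf.
Qed.

Lemma Ck_on_local k D f :
  (forall x, D x -> exists2 E : set _, E x & Ck_on k E f) -> Ck_on k D f.
Proof.
elim: k f => [|k IH] f H /=.
  by move=> x /H [E Ex]; apply.
split=> [x /H [E Ex [+ _]]|i]; first exact.
by apply: IH => x /H [E Ex [_ pf]]; exists E => //; exact: pf.
Qed.

Lemma Ck_on_sub k D E f : D `<=` E -> Ck_on k E f -> Ck_on k D f.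
Proof. by move=> DE cf; apply: Ck_on_local => x Dx; exists E => //; exact: DE. Qed.

Lemma Ck_on_cst k D (a : R) : open D -> Ck_on k D (fun=> a).
Proof.
move=> oD; elim: k a => [|k IH] a /=; first by move=> x _; apply: (@cst_continuous _ _ a).
split=> [x _|i]; first exact: differentiable_cst.
by apply: (Ck_on_ext oD _ (IH 0)) => x _; rewrite /partial derive_cst.
Qed.

Lemma partialD i f g x : differentiable f x -> differentiable g x ->
  partial i (fun y => f y + g y) x = partial i f x + partial i g x.
Proof. by move=> df dg; rewrite /partial deriveD//; apply: diff_derivable. Qed.

Lemma partialM i f g x : differentiable f x -> differentiable g x ->
  partial i (fun y => f y * g y) x = f x * partial i g x + g x * partial i f x.
Proof. by move=> df dg; rewrite /partial deriveM//; apply: diff_derivable. Qed.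

Lemma partialN i f x : differentiable f x ->
  partial i (fun y => - f y) x = - partial i f x.
Proof. by move=> df; rewrite /partial deriveN//; apply: diff_derivable. Qed.

Lemma partial_cst (i : 'I_n) (a : R) (x : 'rV[R]_n) : partial i (fun=> a) x = 0.
Proof. exact: derive_cst. Qed.

Lemma Ck_onD k D f g : open D -> Ck_on k D f -> Ck_on k D g ->
  Ck_on k D (fun x => f x + g x).
Proof.
move=> oD; elim: k f g => [|k IH] f g /=.
  by move=> cf cg x Dx; exact: (continuousD (cf x Dx) (cg x Dx)).
move=> [df pf] [dg pg]; split=> [x Dx|i].
  by apply: differentiableD; [exact: df|exact: dg].
apply: (Ck_on_ext oD _ (IH _ _ (pf i) (pg i))) => x Dx.
by rewrite partialD//; [exact: df|exact: dg].
Qed.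

Lemma Ck_onM k D f g : open D -> Ck_on k D f -> Ck_on k D g ->
  Ck_on k D (fun x => f x * g x).
Proof.
move=> oD; elim: k f g => [|k IH] f g.
  by move=> /= cf cg x Dx; exact: (continuousM (cf x Dx) (cg x Dx)).
move=> cf cg; have [df pf] := cf; have [dg pg] := cg; split=> [x Dx|i].
  by apply: differentiableM; [exact: df|exact: dg].
apply: (Ck_on_ext oD (f := fun x => f x * partial i g x + g x * partial i f x)).
  by move=> x Dx; rewrite partialM//; [exact: df|exact: dg].
by apply: Ck_onD => //; apply: IH => //; exact: Ck_onW || (exact: pf || exact: pg).
Qed.

Lemma partial_comp1 (u : R -> R) f du i x : differentiable f x ->
  is_derive (f x) 1 u du -> partial i (u \o f) x = du * partial i f x.
Proof.
move=> df [du1 du2]; have dux := (derivable1_diffP _ _).1 du1.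
rewrite /partial (deriveE _ (differentiable_comp df dux)) diff_comp//=.
by rewrite deriv1E// derive1E du2 -deriveE// /= mulrC.
Qed.

(** The induction on [k] replaces [u] by its derivative, so it has to run over a class [C] stable
    under differentiation. The classes used below are the exponential, the functions c y^(-m), the
    functions c sqrt(y) y^(-m), and the bump profiles. *)
Lemma Ck_on_comp1 (C : (R -> R) -> Prop) (E : set R) :
  (forall u, C u -> exists2 u', C u' & forall y, E y -> is_derive y 1 u (u' y)) ->
  forall k D f u, open D -> C u -> (forall x, D x -> E (f x)) -> Ck_on k D f ->
  Ck_on k D (u \o f).
Proof.
move=> HC k D f + oD + DE; elim: k => [|k IH] u Cu; have [u' Cu' du] := HC _ Cu.
  move=> /= cf x Dx; apply: continuous_comp; first exact: cf.
  by apply/differentiable_continuous/derivable1_diffP; have [] := du _ (DE _ Dx).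
move=> cf; have [df pf] := cf; split=> [x Dx|i].
  apply: differentiable_comp; first exact: df.
  by apply/derivable1_diffP; have [] := du _ (DE _ Dx).
apply: (Ck_on_ext oD (f := fun x => (u' \o f) x * partial i f x)); last first.
  by apply: Ck_onM; [|apply: IH => //; exact: Ck_onW|exact: pf].
by move=> x Dx; rewrite (partial_comp1 i (df x Dx) (du _ (DE _ Dx))).
Qed.

Lemma smooth_on_partial D f i : smooth_on D f -> smooth_on D (partial i f).
Proof. by move=> sf k; have [_] := sf k.+1; apply. Qed.

Lemma smooth_on_diff D f x : smooth_on D f -> D x -> differentiable f x.
Proof. by move=> sf Dx; have [+ _] := sf 1; apply. Qed.

Lemma smooth_on_cts D f x : smooth_on D f -> D x -> {for x, continuous f}.
Proof. by move=> sf Dx; apply: (sf 0). Qed.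

Lemma smooth_on_ext D f g : open D -> (forall x, D x -> f x = g x) ->
  smooth_on D f -> smooth_on D g.
Proof. by move=> oD fg sf k; apply: Ck_on_ext fg (sf k). Qed.

Lemma smooth_on_sub D E f : D `<=` E -> smooth_on E f -> smooth_on D f.
Proof. by move=> DE sf k; apply: Ck_on_sub DE (sf k). Qed.

Lemma smooth_on_cst D (a : R) : open D -> smooth_on D (fun=> a).
Proof. by move=> oD k; apply: Ck_on_cst. Qed.

Lemma smooth_onD D f g : open D -> smooth_on D f -> smooth_on D g ->
  smooth_on D (fun x => f x + g x).
Proof. by move=> oD sf sg k; apply: Ck_onD. Qed.

Lemma smooth_onM D f g : open D -> smooth_on D f -> smooth_on D g ->
  smooth_on D (fun x => f x * g x).
Proof. by move=> oD sf sg k; apply: Ck_onM. Qed.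

Lemma smooth_onN D f : open D -> smooth_on D f -> smooth_on D (fun x => - f x).
Proof.
move=> oD sf; apply: (smooth_on_ext oD (f := fun x => (-1) * f x)).
  by move=> x _; rewrite mulN1r.
by apply: smooth_onM => //; exact: smooth_on_cst.
Qed.

Lemma smooth_onX D f m : open D -> smooth_on D f -> smooth_on D (fun x => f x ^+ m).
Proof.
move=> oD sf; elim: m => [|m IH].
  by apply: (smooth_on_ext oD _ (smooth_on_cst 1 oD)) => x _; rewrite expr0.
apply: (smooth_on_ext oD (f := fun x => f x * f x ^+ m)).
  by move=> x _; rewrite exprS.
exact: smooth_onM.
Qed.

Lemma Ck_on_sum k D I (r : seq I) (P : pred I) (F : I -> 'rV[R]_n -> R) :
  open D -> (forall i, Ck_on k D (F i)) ->
  Ck_on k D (fun x => \sum_(i <- r | P i) F i x).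
Proof.
move=> oD sF; elim: r => [|i r IH].
  by apply: (Ck_on_ext oD _ (Ck_on_cst k 0 oD)) => x _; rewrite big_nil.
have [Pi|Pi] := boolP (P i).
  apply: (Ck_on_ext oD (f := fun x => F i x + \sum_(j <- r | P j) F j x)).
    by move=> x _; rewrite big_cons Pi.
  exact: Ck_onD.
by apply: (Ck_on_ext oD _ IH) => x _; rewrite big_cons (negbTE Pi).
Qed.

Lemma smooth_on_sum D I (r : seq I) (P : pred I) (F : I -> 'rV[R]_n -> R) :
  open D -> (forall i, smooth_on D (F i)) ->
  smooth_on D (fun x => \sum_(i <- r | P i) F i x).
Proof. by move=> oD sF k; apply: Ck_on_sum => // i; exact: sF. Qed.

Lemma smooth_on_prod D I (r : seq I) (F : I -> 'rV[R]_n -> R) :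
  open D -> (forall i, smooth_on D (F i)) ->
  smooth_on D (fun x => \prod_(i <- r) F i x).
Proof.
move=> oD sF; elim: r => [|i r IH].
  by apply: (smooth_on_ext oD _ (smooth_on_cst 1 oD)) => x _; rewrite big_nil.
apply: (smooth_on_ext oD (f := fun x => F i x * \prod_(j <- r) F j x)).
  by move=> x _; rewrite big_cons.
exact: smooth_onM.
Qed.

Lemma smooth_on_det D m (A : 'rV[R]_n -> 'M[R]_m) :
  open D -> mx_smooth_on D A -> smooth_on D (fun x => \det (A x)).
Proof.
move=> oD sA; apply: smooth_on_sum => // s.
apply: smooth_onM => //; first exact: smooth_on_cst.
by apply: smooth_on_prod.
Qed.

Lemma partial_coord (i j : 'I_n) (x : 'rV[R]_n) :
  partial i (fun y : 'rV[R]_n => y 0 j) x = (i == j)%:R.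
Proof.
have @f : {linear 'rV[R]_n -> R}.
  by exists (fun N : 'rV[R]_n => N 0 j); do 2![eexists]; do ?[constructor];
     rewrite ?mxE// => ? *; rewrite ?mxE//; move=> ?; rewrite !mxE.
rewrite /partial deriveE; last exact: differentiable_coord.
rewrite (_ : (fun _ => _) = f)// diff_lin; last exact: coord_continuous.
by rewrite /f/= mxE eqxx eq_sym.
Qed.

Lemma smooth_on_coord D (j : 'I_n) : open D ->
  smooth_on D (fun y : 'rV[R]_n => y 0 j).
Proof.
move=> oD [|k] /=; first by move=> x _; exact: coord_continuous.
split=> [x _|i]; first exact: differentiable_coord.
apply: (Ck_on_ext oD _ (Ck_on_cst k (i == j)%:R oD)) => x _.
by rewrite partial_coord.
Qed.

End SmoothCalculus.

(** * Mean value theorem, chain rule and symmetry of second derivatives *)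

Section ChainRule.
Context {R : realType} {n : nat}.
Implicit Types (D : set 'rV[R]_n) (f g : 'rV[R]_n -> R).

Lemma derive_line {V : normedModType R} (f : V -> R) (x v : V) s :
  differentiable f (x + s *: v) ->
  is_derive s 1 (fun t => f (x + t *: v)) ('D_v f (x + s *: v)).
Proof.
move=> df; have dv : derivable f (x + s *: v) v by exact: diff_derivable.
have E : (fun h : R => h^-1 *: (((fun t => f (x + t *: v)) \o shift s) (h *: 1)
           - f (x + s *: v))) =
         (fun h : R => h^-1 *: ((f \o shift (x + s *: v)) (h *: v) - f (x + s *: v))).
  apply/funext => h /=; congr (_ *: (f _ - _)).
  by rewrite [h *: 1]mulr1 scalerDl addrCA addrA.
by split; [rewrite /derivable E|rewrite /derive E].
Qed.

Lemma MVT_line {V : normedModType R} (f : V -> R) (x v : V) (h : R) : 0 < h ->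
  (forall s, 0 <= s <= h -> differentiable f (x + s *: v)) ->
  exists2 s, 0 <= s <= h & f (x + h *: v) - f x = h * 'D_v f (x + s *: v).
Proof.
move=> h0 df.
have D s : s \in `[0, h]%R ->
    is_derive s 1 (fun t => f (x + t *: v)) ('D_v f (x + s *: v)).
  by rewrite in_itv /= => sh; apply: derive_line; exact: df.
pose F t := f (x + t *: v); pose dF t := 'D_v f (x + t *: v).
have dFF t : t \in `]0, h[%R -> is_derive t 1 F (dF t).
  by move=> th; apply: D; apply: subset_itv_oo_cc th.
have cF : {within `[0, h], continuous F}.
  by apply: derivable_within_continuous => t /D[].
have [s sh E] := MVT h0 dFF cF.
exists s; first by have := subset_itv_oo_cc sh; rewrite in_itv.
by move: E; rewrite /F scale0r addr0 subr0 mulrC.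
Qed.

Lemma diff_partial m (f : 'rV[R]_m -> R) x v : differentiable f x ->
  'd f x v = \sum_i v 0 i * partial i f x.
Proof.
move=> df; rewrite [in LHS](row_sum_delta v) linear_sum.
by apply: eq_bigr => i _; rewrite linearZ /partial deriveE.
Qed.

Lemma derive_partial m (f : 'rV[R]_m -> R) x v : differentiable f x ->
  'D_v f x = \sum_i v 0 i * partial i f x.
Proof. by move=> df; rewrite deriveE// diff_partial. Qed.

Lemma differentiable_row m (F : 'rV[R]_n -> 'rV[R]_m) x :
  (forall j, differentiable (fun y => F y 0 j) x) -> differentiable F x.
Proof.
move=> dF.
have -> : F = \sum_j (fun y => F y 0 j *: (delta_mx 0 j : 'rV[R]_m)).
  by apply/funext => y; rewrite fct_sumE -row_sum_delta.
by apply: differentiable_sum => j; exact: differentiableZl.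
Qed.

Lemma jacobianE m (F : 'rV[R]_n -> 'rV[R]_m) x i j :
  differentiable F x -> 'J F x i j = partial i (fun y => F y 0 j) x.
Proof.
move=> dF; rewrite /jacobian mxE -deriveE// derive_mx ?mxE//.
exact: diff_derivable.
Qed.

Lemma partial_comp m (F : 'rV[R]_n -> 'rV[R]_m) (f : 'rV[R]_m -> R) x i :
  differentiable F x -> differentiable f (F x) ->
  partial i (f \o F) x = \sum_j 'J F x i j * partial j f (F x).
Proof.
move=> dF df; rewrite /partial deriveE; last exact: differentiable_comp.
transitivity ('d f (F x) ('d F x (delta_mx 0 i))); first by rewrite diff_comp.
rewrite diff_partial//; apply: eq_bigr => j _.
by rewrite /jacobian mxE.
Qed.

Lemma mx_smooth_on_diff m D (F : 'rV[R]_n -> 'rV[R]_m) x :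
  mx_smooth_on D F -> D x -> differentiable F x.
Proof.
by move=> sF Dx; apply: differentiable_row => j; apply: smooth_on_diff Dx.
Qed.

Lemma smooth_on_comp m D E (F : 'rV[R]_n -> 'rV[R]_m) (f : 'rV[R]_m -> R) :
  open D -> mx_smooth_on D F -> (forall x, D x -> E (F x)) ->
  smooth_on E f -> smooth_on D (f \o F).
Proof.
move=> oD sF DE sf k; elim: k f sf => [|k IH] f sf.
  move=> x Dx; apply: continuous_comp.
    exact/differentiable_continuous/(mx_smooth_on_diff sF).
  exact/(smooth_on_cts sf)/DE.
split=> [x Dx|i].
  apply: differentiable_comp; first exact: mx_smooth_on_diff Dx.
  exact/(smooth_on_diff sf)/DE.
apply: (Ck_on_ext oD (f := fun x => \sum_j partial i (fun y => F y 0 j) x *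
                                   (partial j f \o F) x)).
  move=> x Dx; rewrite partial_comp; first last.
  - exact/(smooth_on_diff sf)/DE.
  - exact: mx_smooth_on_diff Dx.
  apply: eq_bigr => j _; rewrite jacobianE//; exact: mx_smooth_on_diff Dx.
apply: Ck_on_sum => // j; apply: Ck_onM => //; first exact: smooth_on_partial.
exact/IH/smooth_on_partial.
Qed.

Lemma near_ball_sub D x : open D -> D x ->
  exists2 r, 0 < r & forall y, `|y - x| < r -> D y.
Proof.
move=> oD Dx; have /nbhs_ballP[r r0 rD] := open_nbhs_nbhs (conj oD Dx).
by exists r => // y yx; apply: rD; rewrite -ball_normE /= distrC.
Qed.

(** The alternating sum is the second difference of [f] over the parallelogram with sides h e_i and
    h e_j. The mean value theorem is applied along e_i to y |-> f (y + h e_j) - f y, then along e_j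
    to the i-th partial derivative. *)
Lemma partial_swap_aux D f x i j r : open D -> smooth_on D f ->
  (forall y, `|y - x| < r -> D y) -> forall h, 0 < h ->
  h * (`|delta_mx 0 i : 'rV[R]_n| + `|delta_mx 0 j : 'rV[R]_n|) < r ->
  exists2 y, `|y - x| <= h * (`|delta_mx 0 i : 'rV[R]_n| + `|delta_mx 0 j : 'rV[R]_n|)
    & f (x + h *: delta_mx 0 i + h *: delta_mx 0 j) - f (x + h *: delta_mx 0 i)
      - f (x + h *: delta_mx 0 j) + f x = h * (h * partial j (partial i f) y).
Proof.
move=> oD sf rD h h0 hr.
set u := delta_mx 0 i : 'rV[R]_n; set w := delta_mx 0 j : 'rV[R]_n.
have nb s t : 0 <= s <= h -> 0 <= t <= h ->
    `|x + s *: u + t *: w - x| <= h * (`|u| + `|w|).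
  move=> /andP[s0 sh] /andP[t0 th]; rewrite -[x + _ + _]addrA [x + (_ + _)]addrC addrK.
  rewrite (le_trans (ler_normD _ _))// mulrDr !normrZ !ger0_norm//.
  by rewrite lerD// ler_wpM2r.
have nD s t : 0 <= s <= h -> 0 <= t <= h -> D (x + s *: u + t *: w).
  by move=> hs ht; apply: rD; apply: le_lt_trans hr; exact: nb.
have h00 : 0 <= (0 : R) <= h by rewrite lexx ltW.
have hhh : 0 <= h <= h by rewrite lexx ltW.
pose G y := f (y + h *: w) - f y.
have d0 s : 0 <= s <= h -> differentiable f (x + s *: u).
  by move=> hs; apply: smooth_on_diff sf _; rewrite -[x + _]addr0 -(scale0r w); exact: nD.
have d1 s : 0 <= s <= h -> differentiable f (x + s *: u + h *: w).
  by move=> hs; apply: smooth_on_diff sf _; exact: nD.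
have dG s : 0 <= s <= h -> is_diff (x + s *: u) G
    (fun v => 'd f (x + s *: u + h *: w) v - 'd f (x + s *: u) v).
  move=> hs; have {}d1 := d1 s hs; have {}d0 := d0 s hs.
  rewrite /G; apply: is_diffB; last exact: differentiableP.
  have ds : is_diff (x + s *: u) (fun y => y + h *: w) id.
    rewrite -[X in is_diff _ _ X]addr0.
    exact: (is_diffD (is_diff_id _) (is_diff_cst (h *: w) _)).
  by have := is_diff_comp ds (differentiableP d1).
have [s hs E] := @MVT_line _ G x u h h0 (fun s hs => @ex_diff _ _ _ _ _ _ _ (dG s hs)).
have [|t ht E2] := @MVT_line _ (partial i f) (x + s *: u) w h h0.
  by move=> t ht; apply: (smooth_on_diff (smooth_on_partial i sf)); exact: nD.
exists (x + s *: u + t *: w); first exact: nb.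
rewrite -[partial j _ _]/('D_w (partial i f) (x + s *: u + t *: w)) -E2.
transitivity (G (x + h *: u) - G x); first by rewrite /G; ring.
have [dGs vGs] := dG s hs.
by rewrite E (deriveE _ dGs) vGs /partial (deriveE _ (d1 s hs)) (deriveE _ (d0 s hs)).
Qed.

(** The second difference is symmetric in [i] and [j], so the two mixed derivatives agree at two
    points [y] and [z] arbitrarily close to [x]; their continuity at [x] does the rest. *)
Lemma partial_swap D f x i j : open D -> smooth_on D f -> D x ->
  partial i (partial j f) x = partial j (partial i f) x.
Proof.
move=> oD sf Dx; have [r r0 rD] := near_ball_sub oD Dx.
apply/eqP; rewrite -subr_eq0 -normr_le0; apply/ler_addgt0Pr => e e0; rewrite add0r.
set M := `|delta_mx 0 i : 'rV[R]_n| + `|delta_mx 0 j : 'rV[R]_n| + 1.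
have M0 : 0 < M by rewrite /M ltr_wpDl// addr_ge0.
have cp a b : \forall y \near x, `|partial a (partial b f) x - partial a (partial b f) y| < e / 2.
  have := smooth_on_cts (smooth_on_partial a (smooth_on_partial b sf)) Dx.
  by move/cvgrPdist_lt; apply; rewrite divr_gt0.
have [d d0 Hd] : exists2 d, 0 < d & forall y, `|y - x| < d ->
   `|partial i (partial j f) x - partial i (partial j f) y| < e / 2 /\
   `|partial j (partial i f) x - partial j (partial i f) y| < e / 2.
  have /nbhs_ballP[d d0 H] : nbhs x [set y |
      `|partial i (partial j f) x - partial i (partial j f) y| < e / 2 /\
      `|partial j (partial i f) x - partial j (partial i f) y| < e / 2].
    by apply: filterI; exact: cp.
  by exists d => // y yx; apply: H; rewrite -ball_normE /= distrC.
(* With this step both parallelograms stay in [D] and in the ball where the mixed derivatives vary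
   by less than e/2. The summand 1 in [M] makes the denominator positive and the bounds strict. *)
pose h := Num.min r d / (2 * M).
have h0 : 0 < h by rewrite divr_gt0 ?mulr_gt0// lt_min r0.
have hM : h * (M - 1) < Num.min r d.
  rewrite (@lt_trans _ _ (h * M))// ?ltr_pM2l ?gtrBl//.
  rewrite /h invfM mulrA divfK ?gt_eqF// gtr_pMr ?lt_min ?r0//.
  by rewrite invf_lt1 ?ltr1n.
rewrite /M addrK in hM.
have [hr hd] : h * (M - 1) < r /\ h * (M - 1) < d.
  by rewrite /M addrK; move: hM; rewrite lt_min => /andP[].
rewrite /M addrK in hr hd.
have [y yx Ey] := partial_swap_aux (i := i) (j := j) oD sf rD h0 hr.
have hr' := hr; rewrite addrC in hr'.
have [z zx Ez] := partial_swap_aux (i := j) (j := i) oD sf rD h0 hr'.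
rewrite [X in _ <= h * X]addrC in zx.
have EE : partial j (partial i f) y = partial i (partial j f) z.
  apply: (mulfI (lt0r_neq0 h0)); apply: (mulfI (lt0r_neq0 h0)).
  apply: etrans (esym Ey) _; apply: etrans _ Ez.
  rewrite [in RHS](addrAC x).
  by move: (f _) (f _) (f _) (f _) => a b c d'; rewrite -!addrA (addrCA (- b)).
have [_ H1] := Hd _ (le_lt_trans yx hd).
have [H2 _] := Hd _ (le_lt_trans zx hd).
rewrite EE in H1.
move: H1 H2; move: (partial i _ z) (partial i _ x) (partial j _ x) => a b c H1 H2.
apply: le_trans (ler_distD a b c) _.
rewrite (splitr e); apply: lerD; apply: ltW; first exact: H2.
by rewrite distrC; exact: H1.
Qed.

End ChainRule.

(** * Exponential, inverse, square root and flat functions *)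

Section SpecialFunctions.
Context {R : realType} {n : nat}.
Implicit Types (D : set 'rV[R]_n) (f : 'rV[R]_n -> R).

Lemma smooth_on_expR D f : open D -> smooth_on D f -> smooth_on D (fun x => expR (f x)).
Proof.
move=> oD sf k; apply: (Ck_on_comp1 (C := [set expR]) (E := setT) _ oD _ _ (sf k)) => //.
by move=> _ ->; exists expR => // y _; exact: is_derive_expR.
Qed.

Lemma smooth_on_inv D f : open D -> (forall x, D x -> f x != 0) ->
  smooth_on D f -> smooth_on D (fun x => (f x)^-1).
Proof.
move=> oD f0 sf k.
pose C := [set u : R -> R | exists c m, u = fun y => c * (y^-1) ^+ m].
apply: (Ck_on_comp1 (C := C) (E := [set y | y != 0]) (u := fun y => y^-1) _ oD _ _ (sf k)) => //.
  move=> _ [c [m ->]]; exists (fun y => (- (c * m%:R)) * y^-1 ^+ m.+1).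
    by exists (- (c * m%:R)), m.+1.
  move=> y /= y0.
  have dV : is_derive y 1 (fun y : R => y^-1) (- (y ^- 2)).
    by apply: is_derive_eq (is_deriveV (f := id) y0 (is_derive_id y 1)) _; rewrite scaler1.
  have dX := is_deriveX m dV.
  have -> : (fun y => c * y^-1 ^+ m) = (cst c) * ((fun y : R => y^-1) ^+ m).
    by apply/funext => z; rewrite !fctE.
  apply: is_derive_eq (is_deriveM (is_derive_cst c y 1) dX) _.
  rewrite /GRing.scale /= mulr0 addr0.
  case: m {dX} => [|m]; first by rewrite !mulr0 oppr0 !mul0r mulr0.
  by rewrite -exprVn !exprS expr0 /=; ring.
by exists 1, 1%N; apply/funext => y; rewrite mul1r.
Qed.

Lemma smooth_on_sqrt D f : open D -> (forall x, D x -> 0 < f x) ->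
  smooth_on D f -> smooth_on D (fun x => Num.sqrt (f x)).
Proof.
move=> oD f0 sf k.
pose C := [set u : R -> R | exists c m, u = fun y => c * Num.sqrt y * (y^-1) ^+ m].
apply: (Ck_on_comp1 (C := C) (E := [set y | 0 < y]) (u := Num.sqrt) _ oD _ _ (sf k)) => //.
  move=> _ [c [m ->]]; exists (fun y => (c * (2^-1 - m%:R)) * Num.sqrt y * y^-1 ^+ m.+1).
    by exists (c * (2^-1 - m%:R)), m.+1.
  move=> y /= y0.
  have dV : is_derive y 1 (fun y : R => y^-1) (- (y ^- 2)).
    by apply: is_derive_eq (is_deriveV (f := id) (lt0r_neq0 y0) (is_derive_id y 1)) _; rewrite scaler1.
  have dX := is_deriveX m dV.
  have dS := is_deriveM (is_derive_cst c y 1) (is_derive1_sqrt y0).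
  have -> : (fun y => c * Num.sqrt y * y^-1 ^+ m) =
            (cst c * Num.sqrt) * ((fun y : R => y^-1) ^+ m).
    by apply/funext => z; rewrite !fctE.
  apply: is_derive_eq (is_deriveM dS dX) _.
  rewrite /GRing.scale /= mulr0 addr0.
  have -> : (2 * Num.sqrt y)^-1 = 2^-1 * Num.sqrt y * y^-1.
    have s0 : Num.sqrt y != 0 by rewrite gt_eqF// sqrtr_gt0.
    rewrite -[in y^-1](sqr_sqrtr (ltW y0)); field.
    by rewrite s0.
  rewrite !fctE; case: m {dX} => [|m] /=.
    by rewrite !expr0 !(mul0r, mulr0n, oppr0) expr1; ring.
  by rewrite -exprVn !exprS expr0 /=; ring.
by exists 1, 0%N; apply/funext => y; rewrite mul1r mulr1.
Qed.

(** Allowing every polynomial [p] in 1/y makes the family stable under differentiation; the flat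
    function e^(-1/y) alone is not. *)
Definition bump_profile (p : {poly R}) (y : R) : R :=
  if 0 < y then p.[y^-1] * expR (- y^-1) else 0.

(** Each monomial is dominated through e^u >= u^(i+2) / (i+2)! at u = 1/y. The exponent 2 is what
    differentiability at 0 requires. *)
Lemma bump_profile_bound (p : {poly R}) :
  exists2 C, 0 <= C & forall y, `|bump_profile p y| <= C * y ^+ 2.
Proof.
exists (\sum_(i < size p) `|p`_i| * (i.+2)`!%:R).
  by apply: sumr_ge0 => i _; rewrite mulr_ge0.
move=> y; rewrite /bump_profile; case: ifPn => [y0|_]; last first.
  rewrite normr0 mulr_ge0 ?sqr_ge0//.
  by apply: sumr_ge0 => i _; rewrite mulr_ge0.
rewrite horner_coef mulr_suml mulr_suml (le_trans (ler_norm_sum _ _ _))//.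
apply: ler_sum => i _; rewrite !normrM -!mulrA ler_wpM2l//.
have yi0 : 0 < y^-1 by rewrite invr_gt0.
rewrite ger0_norm; last by rewrite exprn_ge0// ltW.
rewrite ger0_norm ?expR_ge0// expRN ler_pdivrMr ?expR_gt0//.
have := @expR_ge1Dxn _ y^-1 i.+1 (ltW yi0) => H.
have -> : y^-1 ^+ i = y^-1 ^+ i.+2 * y ^+ 2.
  by rewrite -addn2 exprD -mulrA -exprMn mulVf ?gt_eqF// expr1n mulr1.
rewrite [leRHS]mulrAC ler_pM2r ?exprn_gt0//.
have f0 : 0 < (i.+2)`!%:R :> R by rewrite ltr0n fact_gt0.
by rewrite mulrC -ler_pdivrMr//; apply: le_trans H; rewrite lerDr.
Qed.

(** For y > 0 the factor 1/y^2 coming from the derivative of 1/y becomes ['X^2], and the two terms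
    of the product rule give p - p'. At 0 the quadratic bound sends the difference quotient to 0. *)
Lemma is_derive_bump_profile (p : {poly R}) (y : R) :
  is_derive y 1 (bump_profile p) (bump_profile ('X^2 * (p - p^`())) y).
Proof.
have [y0|y0|->] := ltgtP y 0.
- have E : \forall z \near y, 0 = bump_profile p z.
    near=> z; rewrite /bump_profile ltNge ltW//.
    by near: z; exact: lt_nbhsl.
  apply: near_eq_is_derive E _; rewrite /bump_profile ltNge ltW//=.
  exact: is_derive_cst.
- have E : \forall z \near y, p.[z^-1] * expR (- z^-1) = bump_profile p z.
    near=> z; rewrite /bump_profile ifT//.
    by near: z; exact: lt_nbhsr.
  apply: near_eq_is_derive E _; rewrite /bump_profile y0.
  have dV : is_derive y 1 (fun y : R => y^-1) (- (y ^- 2)).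
    by apply: is_derive_eq (is_deriveV (f := id) (lt0r_neq0 y0) (is_derive_id y 1)) _; rewrite scaler1.
  have dp : is_derive (y^-1) 1 (horner p) (p^`()).[y^-1].
    apply: DeriveDef; first exact: derivable_horner.
    by rewrite -derive1E derivE.
  have d1 := is_derive1_comp dp dV.
  have dN : is_derive y 1 (fun z : R => - z^-1) (- - (y ^- 2)) by exact: is_deriveN.
  have d2 := is_derive1_comp (g := fun z => - z^-1) (is_derive_expR (- y^-1)) dN.
  apply: is_derive_eq (is_deriveM d1 d2) _.
  rewrite !hornerE -!exprVn /GRing.scale /=.
  by move: p.[_] p^`().[_] (expR _) => a b c; rewrite -![GRing.GRing_mul__canonical__SemiGroup_Law R _ _]/(_ * _); ring.
have [C C0 HC] := bump_profile_bound p.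
have u0 q : bump_profile q 0 = 0 by rewrite /bump_profile ltxx.
rewrite u0.
have H : h^-1 *: ((bump_profile p \o shift 0) (h *: 1) - bump_profile p 0)
    @[h --> 0^'] --> (0 : R).
  apply/cvgr0Pnorm_le => e e0.
  near=> h.
  have h0 : h != 0 by near: h; exact: nbhs_dnbhs_neq.
  rewrite u0 subr0 /= addr0 [h *: 1]mulr1 normrZ normfV.
  rewrite ler_pdivrMl ?normr_gt0// (le_trans (HC h))//.
  rewrite -(real_normK (num_real h)) expr2 mulrCA ler_wpM2l//.
  have : `|h| <= e / (C + 1).
    near: h; apply: dnbhs0_le; rewrite divr_gt0// ltr_wpDl//.
  rewrite ler_pdivlMr ?ltr_wpDl// => /(le_trans _); apply.
  by rewrite mulrC ler_wpM2l// lerDl.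
by apply: DeriveDef; [apply/cvg_ex; exists 0|exact/cvg_lim].
Unshelve. all: by end_near. Qed.

Lemma smooth_on_bump_profile D f p : open D -> smooth_on D f ->
  smooth_on D (fun x => bump_profile p (f x)).
Proof.
move=> oD sf k.
apply: (Ck_on_comp1 (C := [set u | exists p, u = bump_profile p]) (E := setT) _ oD _ _ (sf k)) => //.
  move=> _ [q ->]; exists (bump_profile ('X^2 * (q - q^`()))); first by eexists.
  by move=> y _; exact: is_derive_bump_profile.
by exists p.
Qed.
End SpecialFunctions.

(** * Rank-one updates and derivatives of determinants *)

Section RankOneUpdates.
Context {F : fieldType} {n : nat}.
Implicit Types (A : 'M[F]_n) (z y u : 'cV[F]_n).

(** The same bordered matrix is factored into block triangular matrices in two ways, eliminating
    either diagonal block. *)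
Lemma det_1D_rank1 (y : 'cV[F]_n) (z : 'rV[F]_n) :
  \det (1%:M + y *m z) = 1 + (z *m y) 0 0.
Proof.
pose B : 'M[F]_(n + 1) := block_mx 1%:M (- y) z 1%:M.
have E1 : B = block_mx 1%:M 0 z 1%:M *m block_mx 1%:M (- y) 0 (1%:M + z *m y).
  rewrite mulmx_block !(mul1mx, mulmx1, mul0mx, mulmx0, addr0, mulmxN).
  by rewrite addrCA addNr addr0.
have E2 : B = block_mx 1%:M (- y) 0 1%:M *m block_mx (1%:M + y *m z) 0 z 1%:M.
  by rewrite mulmx_block !(mul1mx, mulmx1, mul0mx, mulmx0, add0r, mulNmx) addrK.
have := congr1 determinant (etrans (esym E2) E1).
rewrite !det_mulmx !det_lblock !det_ublock !det1 !mul1r !mulr1 => ->.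
by rewrite det_mx11 !mxE eqxx.
Qed.

Lemma trmx_antisym A u : A^T = - A -> A *m u = 0 -> u^T *m A = 0.
Proof.
move=> At Au; apply: trmx_inj; rewrite trmx_mul trmxK At mulNmx Au oppr0.
by rewrite trmx0.
Qed.

(** The matrix E = 1 + c^-1 (y - z) u^T, with c = u^T z, fixes [A] on both sides because u^T A = 0,
    and sends [z] to [y]. Hence E (A + z z^T) E^T = A + y y^T, while det E = (u^T y) / c. *)
Lemma det_rank1_update A u z y : A^T = - A -> A *m u = 0 ->
  (u^T *m z) 0 0 != 0 ->
  \det (A + y *m y^T) * (u^T *m z) 0 0 ^+ 2 =
  \det (A + z *m z^T) * (u^T *m y) 0 0 ^+ 2.
Proof.
move=> At Au c0.
have uA := trmx_antisym At Au.
pose c := (u^T *m z) 0 0; pose E := 1%:M + (c^-1 *: (y - z)) *m u^T.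
have EA : E *m A = A by rewrite mulmxDl mul1mx -mulmxA uA mulmx0 addr0.
have AE : A *m E^T = A.
  by apply: trmx_inj; rewrite trmx_mul trmxK At mulmxN EA.
have cE : u^T *m z = c%:M by rewrite [LHS]mx11_scalar.
have Ez : E *m z = y.
  rewrite mulmxDl mul1mx -mulmxA cE mul_mx_scalar scalerA mulfV// scale1r.
  by rewrite addrC subrK.
have EM : E *m (A + z *m z^T) *m E^T = A + y *m y^T.
  by rewrite mulmxDr mulmxDl EA AE mulmxA Ez -mulmxA -trmx_mul Ez.
rewrite -EM !det_mulmx det_tr det_1D_rank1.
have -> : (u^T *m (c^-1 *: (y - z))) 0 0 = c^-1 * ((u^T *m y) 0 0 - c).
  by rewrite /c -scalemxAr mulmxBr !mxE.
rewrite -/c; move: (determinant _) ((u^T *m y) 0 0) => d b.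
by field.
Qed.

Lemma row_sub_rank1 A u (x : 'rV[F]_n) : A^T = - A -> A *m u = 0 ->
  (\rank A + 1)%N = n -> u != 0 -> x *m A = 0 -> exists a, x = a *: u^T.
Proof.
move=> At Au rA u0 xA.
have uA := trmx_antisym At Au.
have ku : (u^T <= kermx A)%MS by apply/sub_kermxP.
have kx : (x <= kermx A)%MS by apply/sub_kermxP.
have ru : \rank u^T = 1%N by rewrite rank_rV trmx_eq0 u0.
have rk : \rank (kermx A) = 1%N by rewrite mxrank_ker; move: (\rank A) rA => r <-; rewrite addKn.
have := mxrank_leqif_eq ku; rewrite ru rk => -[_ /esym]; rewrite eqxx => /eqmxP E.
by move: kx; rewrite -E => /sub_rVP.
Qed.

(** If x (A + z z^T) = 0, multiplying by [u] leaves (x z)(z^T u) = 0, so x z = 0 and x A = 0. Then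
    [x] is a multiple of u^T that pairs to 0 with [z], hence 0. *)
Lemma unitmx_rank1_update A u z : A^T = - A -> A *m u = 0 ->
  (\rank A + 1)%N = n -> (u^T *m z) 0 0 != 0 -> A + z *m z^T \in unitmx.
Proof.
move=> At Au rA c0.
have u0 : u != 0 by apply: contraNneq c0 => ->; rewrite trmx0 mul0mx mxE.
rewrite -row_free_unit; apply: inj_row_free => x xM.
have xz : x *m z = 0.
  have := congr1 (mulmx^~ u) xM; rewrite mul0mx mulmxDr mulmxDl -mulmxA Au mulmx0 add0r.
  rewrite !mulmxA -mulmxA [z^T *m u]mx11_scalar mul_mx_scalar.
  have -> : (z^T *m u) 0 0 = (u^T *m z) 0 0.
    by rewrite -[z^T *m u]trmxK trmx_mul trmxK mxE.
  by move/eqP; rewrite scaler_eq0 (negbTE c0) => /eqP.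
have xA : x *m A = 0 by move: xM; rewrite mulmxDr mulmxA xz mul0mx addr0.
have [a xa] := row_sub_rank1 At Au rA u0 xA.
have : (x *m z) 0 0 = 0 by rewrite xz mxE.
rewrite xa -scalemxAl mxE => /eqP; rewrite mulf_eq0 (negbTE c0) orbF => /eqP ->.
by rewrite scale0r.
Qed.

(** Every column of [W] lies in the kernel line of [A], so W_ij = a_j u_i, and an alternating matrix
    of this shape is 0. The diagonal condition is separate because the field may have characteristic
    2. *)
Lemma antisym_form_eq0 A u (W : 'M[F]_n) : A^T = - A -> A *m u = 0 ->
  (\rank A + 1)%N = n -> u != 0 -> W^T = - W -> (forall i, W i i = 0) ->
  A *m W = 0 -> W = 0.
Proof.
move=> At Au rA u0 Wt W0 AW.
have [i0 ui0] : exists i, u i 0 != 0.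
  apply/existsP; apply: contraNT u0; rewrite negb_exists => /forallP H.
  by apply/eqP/colP => i; rewrite mxE; have := H i; rewrite negbK => /eqP.
have Wa j : exists a, forall i, W i j = a * u i 0.
  have Aj : A *m col j W = 0 by rewrite colE mulmxA AW mul0mx.
  have [a E] := row_sub_rank1 At Au rA u0 (trmx_antisym At Aj).
  by exists a => i; have := congr1 (fun M : 'rV[F]_n => M 0 i) E; rewrite !mxE.
have Wij i j : W i j = - W j i.
  by have := congr1 (fun M : 'M[F]_n => M j i) Wt; rewrite !mxE.
have a0 i : W i i0 = 0.
  have [a aE] := Wa i0; have := W0 i0; rewrite aE => /eqP.
  by rewrite mulf_eq0 (negbTE ui0) orbF aE => /eqP ->; rewrite mul0r.
apply/matrixP => i j; rewrite mxE; have [a aE] := Wa j.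
have := a0 j; rewrite Wij aE => /eqP; rewrite oppr_eq0 mulf_eq0 (negbTE ui0) orbF.
by rewrite aE => /eqP ->; rewrite mul0r.
Qed.
Lemma sum_cofactor (X M : 'M[F]_n) :
  \sum_i \sum_j X i j * cofactor M i j = \tr (X *m \adj M).
Proof.
by apply: eq_bigr => i _; rewrite !mxE; apply: eq_bigr => j _; rewrite mxE.
Qed.

(** By Jacobi's formula the double sum is the derivative of the determinant at M = A + z z^T in the
    direction A B + B^T A, which is how a bivector that a field with Jacobian [B] preserves varies
    along that field. Since M u = (u^T z) z, the product of adj(M) with [z] is a multiple of [u],
    which evaluates the traces; the factor u^T z clears denominators. *)
Lemma rank1_update_flow A (B : 'M[F]_n) u z :
  A^T = - A -> A *m u = 0 ->
  (u^T *m z) 0 0 * \sum_i \sum_j (A *m B + B^T *m A) i j * cofactor (A + z *m z^T) i j =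
  \det (A + z *m z^T) * (2 * (u^T *m z) 0 0 * \tr B - 2 * (z^T *m B *m u) 0 0).
Proof.
move=> At Au; rewrite sum_cofactor; set M := A + z *m z^T; set d := (u^T *m z) 0 0.
have uA := trmx_antisym At Au.
have uz : u^T *m z = d%:M by rewrite [LHS]mx11_scalar.
have zu : z^T *m u = d%:M by apply: trmx_inj; rewrite trmx_mul trmxK uz tr_scalar_mx.
have Mu : M *m u = d *: z by rewrite mulmxDl Au add0r -mulmxA zu mul_mx_scalar.
have uM : u^T *m M = d *: z^T by rewrite mulmxDr uA add0r mulmxA uz mul_scalar_mx.
have Jz : d *: (\adj M *m z) = \det M *: u.
  by rewrite scalemxAr -Mu mulmxA mul_adj_mx mul_scalar_mx.
have zJ : d *: (z^T *m \adj M) = \det M *: u^T.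
  by rewrite scalemxAl -uM -mulmxA mul_mx_adj mul_mx_scalar.
have AM : A = M - z *m z^T by rewrite addrK.
have e1 : \tr (M *m B *m \adj M) = \det M * \tr B.
  by rewrite -mulmxA mxtrace_mulC -mulmxA mul_adj_mx mul_mx_scalar linearZ.
have e2 : d * \tr (z *m z^T *m B *m \adj M) = \det M * (z^T *m B *m u) 0 0.
  have -> : \tr (z *m z^T *m B *m \adj M) = \tr (z^T *m B *m (\adj M *m z)).
    by rewrite -!mulmxA mxtrace_mulC -!mulmxA.
  by rewrite -mxtraceZ scalemxAr Jz -scalemxAr mxtraceZ trace_mx11.
have f1 : \tr (B^T *m M *m \adj M) = \det M * \tr B.
  by rewrite -mulmxA mul_mx_adj mul_mx_scalar mxtraceZ mxtrace_tr.
have f2 : d * \tr (B^T *m (z *m z^T) *m \adj M) = \det M * (z^T *m B *m u) 0 0.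
  have -> : \tr (B^T *m (z *m z^T) *m \adj M) = \tr ((z^T *m \adj M) *m (B^T *m z)).
    by rewrite [B^T *m (z *m z^T)]mulmxA -[X in \tr X = _]mulmxA mxtrace_mulC.
  rewrite -mxtraceZ scalemxAl zJ -scalemxAl mxtraceZ trace_mx11; congr (_ * _).
  by rewrite -[z^T *m B *m u]trmxK [in RHS]mxE !trmx_mul trmxK.
have T1 : d * \tr (A *m B *m \adj M) = \det M * (d * \tr B - (z^T *m B *m u) 0 0).
  by rewrite AM !mulmxBl raddfB /= mulrBr e1 e2; ring.
have T2 : d * \tr (B^T *m A *m \adj M) = \det M * (d * \tr B - (z^T *m B *m u) 0 0).
  by rewrite AM mulmxBr mulmxBl raddfB /= mulrBr f1 f2; ring.
rewrite mulmxDl linearD /= mulrDr T1 T2; ring.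
Qed.
End RankOneUpdates.

(** * Jacobi's formula for the derivative of a determinant *)

Section DeterminantDerivative.
Context {R : realType} {V : normedModType R}.

Lemma is_derive_lincomb (I : Type) (r : seq I) (c : I -> R) (f : I -> V -> R) df x v :
  (forall i, is_derive x v (f i) (df i)) ->
  is_derive x v (fun y => \sum_(i <- r) c i * f i y) (\sum_(i <- r) c i * df i).
Proof.
move=> Df; elim: r => [|i r IH].
  rewrite big_nil; have -> : (fun y => \sum_(i <- [::]) c i * f i y) = cst 0.
    by apply/funext => y; rewrite big_nil.
  exact: is_derive_cst.
have -> : (fun y => \sum_(j <- i :: r) c j * f j y) =
    (c i \*: f i) + (fun y => \sum_(j <- r) c j * f j y).
  by apply/funext => y; rewrite big_cons.
by rewrite big_cons; apply: is_deriveD; apply: is_deriveZ.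
Qed.

Lemma derive_lincomb (I : Type) (r : seq I) (c : I -> R) (f : I -> V -> R) x v :
  (forall i, differentiable (f i) x) ->
  'D_v (fun y => \sum_(i <- r) c i * f i y) x = \sum_(i <- r) c i * 'D_v (f i) x.
Proof.
move=> df; suff [_ ->] : is_derive x v (fun y => \sum_(i <- r) c i * f i y)
  (\sum_(i <- r) c i * 'D_v (f i) x) by [].
by apply: is_derive_lincomb => i; apply: derivableP; exact: diff_derivable.
Qed.

Lemma derive_prod (I : eqType) (r : seq I) (f : I -> V -> R) x v : uniq r ->
  (forall i, differentiable (f i) x) ->
  'D_v (fun y => \prod_(i <- r) f i y) x =
  \sum_(i <- r) 'D_v (f i) x * \prod_(j <- r | j != i) f j x.
Proof.
move=> + df; have dP s : differentiable (fun y => \prod_(i <- s) f i y) x.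
  elim: s => [|i s IH].
    have -> : (fun y => \prod_(i <- [::]) f i y) = cst 1.
      by apply/funext => y; rewrite big_nil.
    exact: differentiable_cst.
  have -> : (fun y => \prod_(j <- i :: s) f j y) = f i * (fun y => \prod_(j <- s) f j y).
    by apply/funext => y; rewrite big_cons.
  exact: differentiableM.
elim: r => [_|i r IH /= /andP[ir ur]].
  rewrite big_nil.
  have -> : (fun y => \prod_(i <- [::]) f i y) = cst 1.
    by apply/funext => y; rewrite big_nil.
  exact: derive_cst.
have -> : (fun y => \prod_(j <- i :: r) f j y) = f i * (fun y => \prod_(j <- r) f j y).
  by apply/funext => y; rewrite big_cons.
rewrite deriveM; [|exact: diff_derivable|exact: diff_derivable].
rewrite IH// big_cons addrC; congr (_ + _).
  rewrite big_cons eqxx /= mulrC; congr (_ * _).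
  rewrite [RHS]big_seq_cond [LHS]big_seq; apply: eq_bigl => j.
  by case: (boolP (j \in r)) => //= jr; apply/esym; apply: contraNneq ir => <-.
rewrite [RHS]big_seq [in LHS]big_seq /GRing.scale /= mulr_sumr; apply: eq_bigr => j jr.
rewrite big_cons ifT; last by apply: contraNneq ir => ->.
by rewrite mulrCA.
Qed.

(** The Leibniz rule in each permutation term, regrouped by the row that is differentiated, gives a
    sum of determinants; each is expanded along that row. *)
Lemma derive_det m (A : V -> 'M[R]_m) x v :
  (forall i j, differentiable (fun y => A y i j) x) ->
  'D_v (fun y => \det (A y)) x =
  \sum_i \sum_j 'D_v (fun y => A y i j) x * cofactor (A x) i j.
Proof.
move=> dA.
have dP (s : 'S_m) : differentiable (fun y => \prod_(i <- index_enum 'I_m) A y i (s i)) x.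
  elim: (index_enum _) => [|i r IH].
    have -> : (fun y => \prod_(i <- [::]) A y i (s i)) = cst 1.
      by apply/funext => y; rewrite big_nil.
    exact: differentiable_cst.
  have -> : (fun y => \prod_(j <- i :: r) A y j (s j)) =
      (fun y => A y i (s i)) * (fun y => \prod_(j <- r) A y j (s j)).
    by apply/funext => y; rewrite big_cons.
  exact: differentiableM.
have -> : 'D_v (fun y => \det (A y)) x = \sum_(s : 'S_m) (-1) ^+ s * 'D_v (fun y => \prod_(i <- index_enum 'I_m) A y i (s i)) x.
  apply: etrans (derive_lincomb (index_enum _) (fun s : 'S_m => (-1) ^+ s) v dP).
  apply: (congr1 (fun g => 'D_v g x)).
  by apply/funext => y; rewrite /determinant; apply: eq_bigr => s _.
transitivity (\sum_k \det (\matrix_(i, j) if i == k then 'D_v (fun y => A y i j) x else A x i j)).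
  rewrite exchange_big /=; apply: eq_bigr => s _; rewrite -mulr_sumr; congr (_ * _).
  rewrite derive_prod//; last exact: index_enum_uniq.
  apply: eq_bigr => k _; rewrite [RHS](bigD1 k)//= mxE eqxx; congr (_ * _).
  by apply: eq_bigr => i ik; rewrite mxE (negbTE ik).
apply: eq_bigr => k _; rewrite (expand_det_row _ k); apply: eq_bigr => l _.
rewrite mxE eqxx; congr (_ * _); rewrite /cofactor; congr (_ * \det _).
by apply/matrixP => i j; rewrite !mxE eq_sym (negbTE (neq_lift _ _)).
Qed.
End DeterminantDerivative.

(** * The Poincaré lemma *)

Section Poincare.
Context {R : realType}.

(** Continuity beyond [0, 1] leaves room to integrate from -1/2 to 3/2, so that the derivatives at
    the endpoints 0 and 1 are two-sided. *)
Lemma antiderivative01 (f : R -> R) :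
  (forall s : R, -1 < s < 2 -> {for s, continuous f}) ->
  exists2 F : R -> R, F 0 = 0 & forall s : R, 0 <= s <= 1 -> is_derive s 1 F (f s).
Proof.
move=> cf.
pose a : R := - 2^-1; pose b : R := 1 + 2^-1.
have intf : (@lebesgue_measure R).-integrable [set` `[a, b]] (EFin \o f).
  apply: continuous_compact_integrable; first exact: segment_compact.
  apply: continuous_in_subspaceT => s; rewrite inE /= in_itv /= => sab.
  by apply: cf; rewrite /a /b in sab; lra.
pose F0 t := (\int[lebesgue_measure]_(u in [set` `[a, t]]) (f u))%R.
exists (fun t => F0 t - F0 0); first by rewrite subrr.
move=> s s01.
have sb : s < b by rewrite /b; lra.
have sa : a < s by rewrite /a; lra.
have [|d1 d2] := continuous_FTC1_closed sb intf sa; first by apply: cf; lra.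
have dF0 : is_derive s 1 F0 (f s) by apply: (DeriveDef d1); rewrite -derive1E.
by rewrite -[f s]subr0; apply: is_deriveB.
Qed.

Context {n : nat}.

(** Unlike in Heine's theorem only [p] is confined to [K]; the estimate is meant for a segment and
    small perturbations of it. *)
Lemma uniform_continuity_compact (D K : set 'rV[R]_n) (g : 'rV[R]_n -> R) e :
  compact K -> K `<=` D -> (forall x, D x -> {for x, continuous g}) -> 0 < e ->
  \forall d \near (0 : R)^'+, forall p q, K p -> `|q - p| < d -> `|g q - g p| <= e.
Proof.
move=> /compact_near_coveringP cK KD cg e0.
pose P (d : R) p := forall q, `|q - p| < d -> `|g q - g p| <= e.
have e20 : 0 < e / 2 by rewrite divr_gt0.
suff : \forall d \near 0^'+, K `<=` P d.
  by apply: filterS => d H p q Kp; exact: H.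
apply: cK => x Kx.
  have /cvgrPdist_lt/(_ _ e20)/nbhs_ballP[r r0 Hr] := cg x (KD x Kx).
  have {}Hr q : `|q - x| < r -> `|g x - g q| < e / 2.
    by move=> qx; apply: Hr; rewrite -ball_normE /= distrC.
  have r20 : 0 < r / 2 by rewrite divr_gt0.
  exists ([set y | `|y - x| < r / 2], [set d | d < r / 2]) => /=.
    split; last exact: nbhs_right_lt.
    by apply/nbhs_ballP; exists (r / 2) => // y; rewrite -ball_normE /= distrC.
  move=> [p d] /= [px dr] q qp.
  have H1 : `|g x - g q| < e / 2.
    apply: Hr; apply: le_lt_trans (ler_distD p q x) _.
    by rewrite (splitr r); apply: ltrD => //; exact: lt_trans dr.
  have H2 : `|g x - g p| < e / 2.
    by apply: Hr; apply: lt_trans px _; rewrite gtr_pMr// invf_lt1// ltr1n.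
  apply: le_trans (ler_distD (g x) _ _) _.
  by rewrite (splitr e) distrC; apply: lerD; exact: ltW.
Qed.

Lemma normr_coord (v : 'rV[R]_n) i : `|v 0 i| <= `|v|.
Proof. by rewrite [leRHS]mx_normrE; exact: (le_bigmax _ _ (ord0, i)). Qed.

Lemma linear_form (c : 'I_n -> R) : exists2 L : {linear 'rV[R]_n -> R},
  continuous L & L = (fun v => \sum_i v 0 i * c i) :> ('rV[R]_n -> R).
Proof.
pose f (v : 'rV[R]_n) := \sum_i v 0 i * c i.
have lf : linear f.
  move=> a u v; rewrite /f scaler_sumr -big_split; apply: eq_bigr => i _.
  by rewrite !mxE mulrDl -mulrA.
pose fM := GRing.isLinear.Build _ _ _ _ f lf.
pose L : {linear 'rV[R]_n -> R} := HB.pack f fM.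
exists L => // v; apply/differentiable_continuous.
suff sL : smooth_on setT (fun v : 'rV[R]_n => \sum_i v 0 i * c i) by exact: smooth_on_diff sL _.
apply: smooth_on_sum => [|i]; first exact: openT.
by apply: smooth_onM; [exact: openT|apply: smooth_on_coord; exact: openT|apply: smooth_on_cst; exact: openT].
Qed.

(* The primitive is the line integral of [w] along the segment from [x0]. *)
Lemma closed_form_locally_exact (D : set 'rV[R]_n) (w : 'I_n -> 'rV[R]_n -> R) x0 :
  open D -> D x0 -> (forall i, smooth_on D (w i)) ->
  (forall x i j, D x -> partial i (w j) x = partial j (w i) x) ->
  exists2 r, 0 < r & exists h : 'rV[R]_n -> R, forall x, `|x - x0| < r ->
    D x /\ is_diff x h (fun v => \sum_i v 0 i * w i x).
Proof.
move=> oD Dx0 sw cw.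
have [r2 r20 rD] := near_ball_sub oD Dx0.
(* Half the radius keeps x0 + s (x - x0) in [D] for -1 < s < 2, as the antiderivative on [0, 1]
   demands. *)
pose r := r2 / 2; have r0 : 0 < r by rewrite divr_gt0.
exists r => //.
have inD x (s : R) : `|x - x0| < r -> -1 < s < 2 -> D (x0 + s *: (x - x0)).
  move=> xr s12; apply: rD; rewrite addrC addKr normrZ.
  have s2 : `|s| <= 2 by rewrite ler_norml; apply/andP; split; lra.
  rewrite (le_lt_trans (ler_wpM2r (normr_ge0 _) s2))//.
  by move: xr; rewrite /r ltr_pdivlMr// mulrC.
pose k x s := \sum_i (x - x0) 0 i * w i (x0 + s *: (x - x0)).
have dline i x (s : R) : `|x - x0| < r -> -1 < s < 2 ->
    is_derive s 1 (fun t : R => w i (x0 + t *: (x - x0)))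
      ('D_(x - x0) (w i) (x0 + s *: (x - x0))).
  by move=> xr s12; apply: derive_line; apply: smooth_on_diff (sw i) (inD _ _ xr s12).
have antik x : exists F : R -> R, `|x - x0| < r -> F 0 = 0 /\
    forall s : R, 0 <= s <= 1 -> is_derive s 1 F (k x s).
  have [xr|xr] := boolP (`|x - x0| < r); last by exists 0.
  have [|F F0 dF] := @antiderivative01 (k x); last by exists F.
  move=> s s12; apply/differentiable_continuous/derivable1_diffP.
  have [+ _] := is_derive_lincomb (index_enum 'I_n) (fun i => (x - x0) 0 i)
    (fun i => dline i x s xr s12).
  by [].
have [H HP] := choice antik.
exists (fun x => H x 1) => x xr; split.
  by have := inD x 1 xr; rewrite scale1r addrC subrK; apply; lra.
have [L cL LE] := linear_form (fun i => w i x); rewrite -LE.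
apply: is_diff_eps => // e e0.
(* [C] collects the two error terms at the end, n |v| e' and n |y| (n |v| e'). *)
pose y := x - x0; pose C : R := n%:R * (1 + n%:R * `|y|).
have C0 : 0 <= C by rewrite mulr_ge0// addr_ge0// mulr_ge0.
pose e' := e / (C + 1); have e'0 : 0 < e' by rewrite divr_gt0// ltr_wpDl.
pose K : set 'rV[R]_n := (fun s : R => x0 + s *: y) @` `[0, 1].
have cK : compact K.
  apply: continuous_compact; last exact: segment_compact.
  apply: continuous_subspaceT => s; apply: (@cvgD _ _ _ _ _ (cst x0) (fun s => s *: y)); first exact: cvg_cst.
  exact: scalel_continuous.
have Kp (s : R) : 0 <= s <= 1 -> K (x0 + s *: y).
  by move=> s01; exists s => //=; rewrite in_itv.
have KD : K `<=` D.
  by move=> z [s /= s01 <-]; rewrite in_itv /= in s01; apply: inD => //; lra.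
have uw : \forall d \near (0 : R)^'+, forall i p q, K p -> `|q - p| < d -> `|w i q - w i p| <= e'.
  apply: filter_forall => i; apply: (uniform_continuity_compact cK KD) => // z Dz.
  exact: smooth_on_cts (sw i) Dz.
have udw : \forall d \near (0 : R)^'+, forall ij : 'I_n * 'I_n,
    forall p q, K p -> `|q - p| < d -> `|partial ij.1 (w ij.2) q - partial ij.1 (w ij.2) p| <= e'.
  apply: filter_forall => ij; apply: (uniform_continuity_compact cK KD) => // z Dz.
  exact: smooth_on_cts (smooth_on_partial _ (sw _)) Dz.
near (0 : R)^'+ => d.
have d0 : 0 < d by near: d; exact: nbhs_right_gt.
have uwd : forall i p q, K p -> `|q - p| < d -> `|w i q - w i p| <= e' by near: d.
have udwd : forall ij : 'I_n * 'I_n, forall p q, K p -> `|q - p| < d ->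
      `|partial ij.1 (w ij.2) q - partial ij.1 (w ij.2) p| <= e' by near: d.
have ry : 0 < r - `|y| by rewrite subr_gt0.
have nvd := @pseudometric_normed_Zmodule.nbhs0_lt _ 'rV[R]_n d d0.
have nvr := @pseudometric_normed_Zmodule.nbhs0_lt _ 'rV[R]_n _ ry.
apply: filterS2 nvd nvr => v vd vr.
have xvr : `|v + x - x0| < r.
  by rewrite -addrA (le_lt_trans (ler_normD _ _))// -ltrBrDr.
have [Hx0 dHx] := HP x xr; have [Hv0 dHv] := HP _ xvr.
(* [E] vanishes at 0, and [E 1] is the remainder to be estimated. The mean value theorem turns it
   into a value of [E'], so no integral has to be bounded. *)
pose E s := H (v + x) s - H x s - s * \sum_i v 0 i * w i (x0 + s *: y).
pose E' s := k (v + x) s - k x s -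
  (s * \sum_i v 0 i * 'D_y (w i) (x0 + s *: y) + (\sum_i v 0 i * w i (x0 + s *: y)) * 1).
have dE (s : R) : 0 <= s <= 1 -> is_derive s 1 E (E' s).
  move=> s01.
  have dG : is_derive s 1 (fun s : R => \sum_i v 0 i * w i (x0 + s *: y))
      (\sum_i v 0 i * 'D_y (w i) (x0 + s *: y)).
    by apply: is_derive_lincomb => i; apply: dline => //; lra.
  apply: is_deriveB; last exact: (is_deriveM (is_derive_id s 1) dG).
  by apply: is_deriveB; [exact: dHv|exact: dHx].
have dE1 (s : R) : s \in `]0, 1[%R -> is_derive s 1 E (E' s).
  by rewrite in_itv /= => s01; apply: dE; lra.
have cE : {within `[0, 1], continuous E}.
  apply: derivable_within_continuous => s; rewrite in_itv /= => s01.
  by have [] := dE s s01.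
have [s s01] := MVT ltr01 dE1 cE.
rewrite in_itv /= in s01; move/andP: s01 => [s0 s1].
rewrite subr0 mulr1 /E mul0r mul1r Hx0 Hv0 !subr0 scale1r.
rewrite [x0 + y]addrC [y + x0]subrK. 
rewrite LE => ->.
pose p := x0 + s *: y.
have Kps : K p by apply: Kp; rewrite !ltW.
have q_eq : x0 + s *: (v + x - x0) = p + s *: v.
  have -> : v + x - x0 = y + v by rewrite /y -addrA addrC.
  by rewrite scalerDr addrA.
have sv t : 0 <= t <= s -> `|p + t *: v - p| < d.
  move=> /andP[t0 ts]; rewrite addrC addKr normrZ ger0_norm//.
  by apply: le_lt_trans vd; rewrite ler_piMl// (le_trans ts)// ltW.
have Dline t : 0 <= t <= s -> D (p + t *: v).
  move=> /andP[t0 ts]; apply: rD; rewrite /p -[x0 + _ + _]addrA addrAC subrr add0r.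
  have r2r : r <= r2 by rewrite ler_pdivrMr// ler_peMr ?ler1n// ltW.
  apply: lt_le_trans r2r; rewrite (le_lt_trans (ler_normD _ _))//.
  apply: (@le_lt_trans _ _ (`|y| + `|v|)); last by rewrite -ltrBrDl.
  rewrite !normrZ !ger0_norm ?(ltW s0)//; apply: lerD; apply: ler_piMl => //.
    exact: ltW.
  by rewrite (le_trans ts)// ltW.
pose Q i := w i (p + s *: v) - w i p.
have Dw i t : 0 <= t <= s -> 'D_v (w i) (p + t *: v) =
    \sum_j v 0 j * partial j (w i) (p + t *: v).
  by move=> ts; apply: derive_partial; exact: smooth_on_diff (sw i) (Dline t ts).
have Dv i : 'D_v (w i) p = \sum_j v 0 j * partial j (w i) p.
  by apply: derive_partial; exact: smooth_on_diff (sw i) (KD _ Kps).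
have Dy i : 'D_y (w i) p = \sum_j y 0 j * partial j (w i) p.
  by apply: derive_partial; exact: smooth_on_diff (sw i) (KD _ Kps).
have HQ i : exists2 B, `|B| <= n%:R * `|v| * e' & Q i = s * 'D_v (w i) p + s * B.
  have [t ts Et] := MVT_line s0 (fun t ts => smooth_on_diff (sw i) (Dline t ts)).
  exists ('D_v (w i) (p + t *: v) - 'D_v (w i) p); last by rewrite /Q Et mulrBr [RHS]addrC subrK.
  rewrite (Dw i t ts) (Dv i) -sumrB; apply: le_trans (ler_norm_sum _ _ _) _.
  have -> : n%:R * `|v| * e' = \sum_(j < n) `|v| * e'.
    by rewrite sumr_const card_ord -[RHS]mulr_natl mulrA.
  apply: ler_sum => j _; rewrite -mulrBr normrM.
  by apply: ler_pM => //; [exact: normr_coord|exact: (udwd (j, i) _ _ Kps (sv _ ts))].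
have [B HB] := choice (fun i => let: ex_intro2 b Hb1 Hb2 := HQ i in ex_intro _ b (conj Hb1 Hb2)).
(* Closedness enters here: it exchanges [v] and [y], so that the first-order terms of [E'] cancel
   and only the continuity defects [Q] and [B] remain. *)
have sym : \sum_i v 0 i * 'D_y (w i) p = \sum_i y 0 i * 'D_v (w i) p.
  under eq_bigr do rewrite Dy mulr_sumr.
  under [RHS]eq_bigr do rewrite Dv mulr_sumr.
  rewrite exchange_big; apply: eq_bigr => i _; apply: eq_bigr => j _.
  by rewrite mulrCA (cw _ _ _ (KD _ Kps)).
have -> : E' s = \sum_i v 0 i * Q i + \sum_i y 0 i * (s * B i).
  rewrite /E' /k q_eq -/p mulr1 sym mulr_sumr.
  rewrite -sumrB -big_split -sumrB -big_split.
  apply: eq_bigr => i _ /=; rewrite /y.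
  have [_] := HB i; rewrite /Q -/p => QE.
  have -> : w i (p + s *: v) = w i p + (s * 'D_v (w i) p + s * B i) by rewrite -QE [RHS]addrC subrK.
  rewrite !mxE -/y -/p; ring.
have n1 : `|\sum_i v 0 i * Q i| <= n%:R * (`|v| * e').
  apply: le_trans (ler_norm_sum _ _ _) _.
  have -> : n%:R * (`|v| * e') = \sum_(i < n) `|v| * e'.
    by rewrite sumr_const card_ord -[RHS]mulr_natl.
  apply: ler_sum => i _.
  rewrite normrM; apply: ler_pM => //; first exact: normr_coord.
  by apply: (uwd i _ _ Kps); apply: sv; rewrite lexx ltW.
have n2 : `|\sum_i y 0 i * (s * B i)| <= n%:R * (`|y| * (n%:R * `|v| * e')).
  apply: le_trans (ler_norm_sum _ _ _) _.
  have -> : n%:R * (`|y| * (n%:R * `|v| * e')) = \sum_(i < n) `|y| * (n%:R * `|v| * e').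
    by rewrite sumr_const card_ord -[RHS]mulr_natl.
  apply: ler_sum => i _.
  rewrite normrM; apply: ler_pM => //; first exact: normr_coord.
  have [HBi _] := HB i.
  rewrite normrM (gtr0_norm s0); apply: le_trans HBi.
  by rewrite ler_piMl// ltW.
apply: le_trans (ler_normD _ _) _; apply: le_trans (lerD n1 n2) _.
have -> : n%:R * (`|v| * e') + n%:R * (`|y| * (n%:R * `|v| * e')) = C * e' * `|v|.
  by rewrite /C; ring.
rewrite ler_wpM2r// /e' mulrCA ler_piMr ?(ltW e0)//.
by rewrite ler_pdivrMr ?ltr_wpDl// mul1r lerDl.
Unshelve. all: by end_near. Qed.

End Poincare.

(** * Triviality of locally constant cocycles on simply connected spaces *)

Lemma continuous_pair {S A B : topologicalType} (f : S -> A) (g : S -> B) :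
  continuous f -> continuous g -> continuous (fun x => (f x, g x)).
Proof. by move=> cf cg x; exact: (cvg_pair (cf x) (cg x)). Qed.

Section IntervalInduction.
Context {R : realType}.

(** Let s be the supremum of the t with [Q 0 t]. The local hypothesis at s shows that s itself
    qualifies, and would carry [Q 0] past s if s were less than 1. This replaces subdivision by a
    Lebesgue number. *)
Lemma interval_induction (Q : R -> R -> Prop) :
  (forall a b c, a <= b -> b <= c -> Q a b -> Q b c -> Q a c) ->
  (forall x, 0 <= x <= 1 -> exists2 e, 0 < e & forall a b,
     x - e <= a -> a <= x -> x <= b -> b <= x + e -> 0 <= a -> b <= 1 -> Q a b) ->
  Q 0 1.
Proof.
move=> Qadd Qloc.
pose S := [set t | 0 <= t <= 1 /\ Q 0 t].
have S0 : S 0.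
  have h0 : 0 <= (0 : R) <= 1 by lra.
  split=> //; have [e e0] := Qloc 0 h0; apply; lra.
have Sub : has_sup S.
  by split; [exists 0|exists 1 => t [/andP[]]].
pose s := sup S.
have s0 : 0 <= s by apply: ub_le_sup => //; case: Sub.
have s1 : s <= 1 by apply: ge_sup; [exists 0|move=> t [/andP[]]].
have [|e e0 He] := Qloc s; first by rewrite s0 s1.
have [t [t01 Qt] ts] := sup_adherent e0 Sub.
have {}ts : s - e < t := ts.
have tles : t <= s by apply: ub_le_sup; [case: Sub|split].
have Qs : Q 0 s.
  have /andP[t0 t1] := t01.
  by apply: (Qadd _ t) => //; apply: He => //; rewrite ?lerDl ltW.
have [->//|s1'] := eqVneq 1 s.
have {}s1 : s < 1 by rewrite lt_neqAle eq_sym s1' s1.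
have [b [sb be b1]] : exists b, [/\ s < b, b <= s + e & b <= 1].
  by exists (Num.min (s + e) 1); rewrite lt_min s1 ltrDl e0 !ge_min !lexx orbT.
have Sb : S b.
  split; first by rewrite b1 (le_trans s0)// ltW.
  apply: (Qadd _ s) => //; first exact: ltW.
  by apply: He => //; [rewrite gerBl ltW|exact: ltW].
by have := ub_le_sup (let: conj _ h := Sub in h) Sb; rewrite leNgt sb.
Qed.

Lemma locally_constant_interval {G : Type} (h : R -> G) :
  (forall x : R, 0 <= x <= 1 -> \forall y \near x, 0 <= y <= 1 -> h y = h x) -> h 0 = h 1.
Proof.
move=> hloc; apply: (interval_induction (Q := fun a b => h a = h b)).
  by move=> a b c _ _ -> ->.
move=> x /hloc /nbhs_ballP[e e0 He]; exists (e / 2); first by rewrite divr_gt0.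
have ee : e / 2 < e by rewrite ltr_pdivrMr// ltr_pMr// ltr1n.
move=> a b ae ax xb be a0 b1.
rewrite (He a) ?(He b)//; rewrite -?ball_normE /= ?ltr_norml; lra.
Qed.

End IntervalInduction.

Lemma continuous_within_comp {S S' S'' : topologicalType} (A : set S) (f : S -> S') (c : S'' -> S) :
  {within A, continuous f} -> continuous c -> (forall x, A (c x)) ->
  continuous (f \o c).
Proof.
move=> /subspace_continuousP cf cc cA x; apply: cvg_comp (cf _ (cA x)).
move=> P /= P1; have N : \forall y \near x, A (c y) -> P (c y) := cc x _ P1.
by apply: filterS N => y /= Hy; exact: (Hy (cA y)).
Qed.

Section Clamp.
Context {R : realType}.

(** Retraction of the line onto [0, 1]. Paths and homotopies are given as continuous only within
    [0, 1] or the unit square; composing with it makes them continuous everywhere. *)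
Definition clamp (t : R) : R := Num.max 0 (Num.min 1 t).

Lemma clamp_cts : continuous clamp.
Proof.
move=> t; apply: continuous_max; first exact: cvg_cst.
by apply: continuous_min; [exact: cvg_cst|exact: cvg_id].
Qed.

Lemma clamp_itv t : 0 <= clamp t <= 1.
Proof. by rewrite /clamp le_max lexx /= ge_max ler01 ge_min lexx. Qed.

Lemma clampE t : 0 <= t <= 1 -> clamp t = t.
Proof. by move=> /andP[t0 t1]; rewrite /clamp min_r// max_r. Qed.

End Clamp.

Section Trivializations.
Context {R : realType} {T : topologicalType} {I : Type} {G : zmodType}.
Variables (U : I -> set T) (g : I -> I -> T -> G).
Hypothesis U_open : forall i, open (U i).
Hypothesis U_cover : forall p, exists i, U i p.
Hypothesis g_cocycle : forall i j k p, U i p -> U j p -> U k p ->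
  g i j p + g j k p = g i k p.
Hypothesis g_const : forall i j p, U i p -> U j p -> \forall q \near p, g i j q = g i j p.

(** Continuity is on the whole line, which spares subspace topologies; only the part over [0, 1] is
    confined to [A]. *)
Definition path_in {S : topologicalType} (A : set S) (x y : S) :=
  exists c : R -> S, [/\ continuous c, c 0 = x, c 1 = y &
                        forall t : R, 0 <= t <= 1 -> A (c t)].

(** A section over [A] of the pullback along [f] of the principal [G]-covering defined by the
    cocycle [g]: a locally constant cochain with coboundary [g]. The value [a i x] is meaningful
    only when [f x] lies in [U i]. *)
Definition trivialization {S : topologicalType} (f : S -> T) (A : set S)
    (a : I -> S -> G) :=
  (forall i j x, A x -> U i (f x) -> U j (f x) -> a i x - a j x = g i j (f x)) /\
  (forall i x, A x -> U i (f x) -> \forall y \near x, A y -> a i y = a i x).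

Section OverSpace.
Context {S : topologicalType}.
Implicit Types (f : S -> T) (A B : set S) (a b : I -> S -> G).

Lemma trivialization_sub f A B a : B `<=` A ->
  trivialization f A a -> trivialization f B a.
Proof.
move=> BA [t1 t2]; split=> [i j x /BA|i x /BA Ax Ui]; first exact: t1.
by apply: filterS (t2 i x Ax Ui) => y + /BA; apply.
Qed.

Lemma trivialization_comp {S' : topologicalType} f A a (c : S' -> S) (A' : set S') (f' : S' -> T) :
  continuous c -> (forall x, A' x -> A (c x)) -> (forall x, A' x -> f' x = f (c x)) ->
  trivialization f A a -> trivialization f' A' (fun i x => a i (c x)).
Proof.
move=> cc AA ff [t1 t2]; split=> [i j x A'x|i x A'x].
  by rewrite ff//; apply: t1; exact: AA.
rewrite ff// => Ui; have N : \forall y \near x, A (c y) -> a i (c y) = a i (c x) := cc x _ (t2 _ _ (AA _ A'x) Ui).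
by apply: filterS N => y /= H A'y; exact/H/AA.
Qed.

Lemma near_U f i x : continuous f -> U i (f x) -> \forall y \near x, U i (f y).
Proof. by move=> cf Ui; exact: (cf x (U i) (open_nbhs_nbhs (conj (U_open i) Ui))). Qed.

(** Both cochains have coboundary [g], so their difference does not depend on the index; it is
    locally constant, hence constant along the path. The index may therefore be picked pointwise
    along the path, without any continuity. *)
Lemma trivialization_diff f A a b x y i j : continuous f ->
  trivialization f A a -> trivialization f A b -> path_in A x y ->
  U i (f x) -> U j (f y) -> a i x - b i x = a j y - b j y.
Proof.
move=> cf [a1 a2] [b1 b2] [c [cc <- <- cA]] Ui Uj.
have indep k l z : A z -> U k (f z) -> U l (f z) -> a k z - b k z = a l z - b l z.
  move=> Az Uk Ul; have E : a k z - a l z = b k z - b l z by rewrite a1// b1.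
  by rewrite -[a k z](subrK (a l z)) E addrC -!addrA addKr addrC.
have [e eP] := choice (fun z => U_cover (f z)).
rewrite (indep i (e (c 0))) //; last by apply: cA; rewrite lexx ler01.
rewrite (indep j (e (c 1))) //; last by apply: cA; rewrite lexx ler01.
apply: (locally_constant_interval (h := fun t => a (e (c t)) (c t) - b (e (c t)) (c t))).
move=> t t01; have At := cA t t01; have Ut := eP (c t).
have N1 : \forall s \near t, U (e (c t)) (f (c s)) := cc t _ (near_U cf Ut).
have N2 : \forall s \near t, A (c s) -> a (e (c t)) (c s) = a (e (c t)) (c t) := cc t _ (a2 _ _ At Ut).
have N3 : \forall s \near t, A (c s) -> b (e (c t)) (c s) = b (e (c t)) (c t) := cc t _ (b2 _ _ At Ut).
near=> s => s01; have As := cA s s01.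
rewrite (indep (e (c s)) (e (c t)))//; last by near: s; exact: N1.
congr (_ - _).
  by move: As; near: s; exact: N2.
by move: As; near: s; exact: N3.
Unshelve. all: by end_near. Qed.

Lemma trivialization_const f A a i x y : trivialization f A a ->
  path_in (A `&` f @^-1` U i) x y -> a i x = a i y.
Proof.
move=> [_ a2] [c [cc <- <- cA]].
apply: (locally_constant_interval (h := fun t => a i (c t))) => t /cA[At Ut].
have N : \forall s \near t, A (c s) -> a i (c s) = a i (c t) := cc t _ (a2 _ _ At Ut).
apply: filterS N => s /= + /cA[As _]; exact.
Qed.

Lemma trivialization_local f A i : continuous f -> (forall x, A x -> U i (f x)) ->
  trivialization f A (fun j x => g j i (f x)).
Proof.
move=> cf AU; split=> [j k x Ax Uj Uk|j x Ax Uj].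
  by rewrite -(@g_cocycle j k i)//; [rewrite addrK|exact: AU].
have N : \forall y \near x, g j i (f y) = g j i (f x) := cf x _ (g_const Uj (AU x Ax)).
by apply: filterS N => y /= + _.
Qed.

(** On the path connected intersection the two sections differ by a constant [d]; adding it to [b]
    makes them agree. Closedness gives local constancy: near a point outside one of the sets, that
    set contributes no points. *)
Lemma trivialization_glue f A B a b : continuous f -> closed A -> closed B ->
  trivialization f A a -> trivialization f B b ->
  (exists z, (A `&` B) z) ->
  (forall x y, (A `&` B) x -> (A `&` B) y -> path_in (A `&` B) x y) ->
  exists c, trivialization f (A `|` B) c.
Proof.
move=> cf cA cB ta tb [z ABz] pAB.
have [i Ui] := U_cover (f z); pose d := a i z - b i z.
have dE j x : A x -> B x -> U j (f x) -> a j x = b j x + d.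
  move=> Ax Bx Uj; apply/eqP; rewrite addrC -subr_eq; apply/eqP.
  have ta' := trivialization_sub (@subIsetl _ A B) ta.
  have tb' := trivialization_sub (@subIsetr _ A B) tb.
  exact: (trivialization_diff cf ta' tb' (pAB _ _ (conj Ax Bx) ABz)).
pose c j x := if pselect (A x) then a j x else b j x + d.
have cEA j x : A x -> c j x = a j x by rewrite /c; case: pselect.
have cEB j x : B x -> U j (f x) -> c j x = b j x + d.
  by move=> Bx Uj; rewrite /c; case: pselect => // Ax; exact: dE.
have nC (C : set S) : closed C -> forall x, \forall y \near x, C y -> C x.
  move=> cC x; have [Cx|Cx] := pselect (C x); first by near=> y.
  have oC : open (~` C) by rewrite openC.
  by have := open_nbhs_nbhs (conj oC (Cx : (~` C) x)); apply: filterS => y nC /nC.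
have [[a1 a2] [b1 b2]] := (ta, tb).
exists c; split=> [j k x ABx Uj Uk|j x ABx Uj].
  have [Ax|Ax] := pselect (A x); first by rewrite !cEA// a1.
  have Bx : B x by case: ABx.
  by rewrite !cEB// opprD addrACA subrr addr0 b1.
have NU := near_U cf Uj; have NA := nC A cA x; have NB := nC B cB x.
have Na : \forall y \near x, A x -> A y -> a j y = a j x.
  have [Ax|Ax] := pselect (A x); last by near=> y.
  by apply: filterS (a2 j x Ax Uj) => y + _.
have Nb : \forall y \near x, B x -> B y -> b j y = b j x.
  have [Bx|Bx] := pselect (B x); last by near=> y.
  by apply: filterS (b2 j x Bx Uj) => y + _.
near=> y => -[Ay|By].
  have Ax : A x by move: Ay; near: y; exact: NA.
  by rewrite !cEA//; move: Ax Ay; near: y; exact: Na.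
have Bx : B x by move: By; near: y; exact: NB.
rewrite !cEB//; last by near: y; exact: NU.
by congr (_ + _); move: Bx By; near: y; exact: Nb.
Unshelve. all: by end_near. Qed.

End OverSpace.

Let rect (s1 s2 t1 t2 : R) : set (R * R) :=
  [set z | s1 <= z.1 <= s2 /\ t1 <= z.2 <= t2].

Lemma closed_rect s1 s2 t1 t2 : closed (rect s1 s2 t1 t2).
Proof.
have -> : rect s1 s2 t1 t2 = (fst @^-1` `[s1, s2]) `&` (snd @^-1` `[t1, t2]).
  by apply/seteqP; split=> z /=; rewrite !in_itv.
apply: closedI.
  apply: (@continuous_closedP _ _ (@fst R R)).1; last exact: interval_closed.
  by move=> z; exact: cvg_fst.
apply: (@continuous_closedP _ _ (@snd R R)).1; last exact: interval_closed.
by move=> z; exact: cvg_snd.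
Qed.

Lemma rect_path s1 s2 t1 t2 (z w : R * R) :
  rect s1 s2 t1 t2 z -> rect s1 s2 t1 t2 w -> path_in (rect s1 s2 t1 t2) z w.
Proof.
case: z w => [a b] [c d] [/= ha hb] [/= hc hd].
exists (fun t : R => (a + t * (c - a), b + t * (d - b))); split.
- have cl (u v : R) : continuous (fun t : R => u + t * (v - u)).
    by move=> t; apply: cvgD; [exact: cvg_cst|apply: cvgM; [exact: cvg_id|exact: cvg_cst]].
  by apply: continuous_pair; exact: cl.
- by rewrite !mul0r !addr0.
- by rewrite !mul1r ![_ + (_ - _)]addrC !subrK.
- by move=> t t01; split=> /=; nra.
Qed.

(** Two nested interval inductions: [Q2] glues vertical strips along segments, and [Q1] builds a
    thin strip around the abscissa [s] by stacking rectangles, the width shrinking at each gluing. A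
    small rectangle maps into a single [U i], where [g] itself provides a section. *)
Lemma trivialization_rect (H : R * R -> T) : continuous H ->
  exists c, trivialization H (rect 0 1 0 1) c.
Proof.
move=> cH.
pose Q2 s1 s2 := s1 <= s2 -> exists c, trivialization H (rect s1 s2 0 1) c.
suff : Q2 0 1 by apply; rewrite ler01.
apply: interval_induction => [a b c ab bc H1 H2 _|s s01].
  have [c1 t1] := H1 ab; have [c2 t2] := H2 bc.
  have E : rect a b 0 1 `&` rect b c 0 1 = rect b b 0 1.
    by apply/seteqP; split=> -[x y] /=; rewrite /rect /=; lra.
  have [| |c3 t3] := trivialization_glue cH (@closed_rect _ _ _ _) (@closed_rect _ _ _ _) t1 t2.
  - by rewrite E; exists (b, 0); rewrite /rect /=; lra.
  - by rewrite E; exact: rect_path.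
  exists c3; apply: trivialization_sub t3 => -[x y]; rewrite /rect /=.
  by case=> xac y01; have [xb|xb] := leP x b; [left|right]; rewrite /=; lra.
pose Q1 t1 t2 := t1 <= t2 -> exists2 e, 0 < e & exists c, trivialization H (rect (s - e) (s + e) t1 t2) c.
have [//|e e0 [c tc]] : Q1 0 1; last first.
  exists e => // a b ea _ _ be _ _ _; exists c; apply: trivialization_sub tc.
  by move=> [x y]; rewrite /rect /=; lra.
apply: interval_induction => [a b c ab bc H1 H2 _|t t01].
  have [e1 e10 [c1 t1]] := H1 ab; have [e2 e20 [c2 t2]] := H2 bc.
  have [e [e0 ee1 ee2]] : exists e, [/\ 0 < e, e <= e1 & e <= e2].
    by exists (Num.min e1 e2); rewrite lt_min e10 e20 !ge_min !lexx orbT.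
  exists e => //.
  have {}t1 : trivialization H (rect (s - e) (s + e) a b) c1.
    by apply: trivialization_sub t1 => -[x y]; rewrite /rect /=; lra.
  have {}t2 : trivialization H (rect (s - e) (s + e) b c) c2.
    by apply: trivialization_sub t2 => -[x y]; rewrite /rect /=; lra.
  have E : rect (s - e) (s + e) a b `&` rect (s - e) (s + e) b c = rect (s - e) (s + e) b b.
    by apply/seteqP; split=> -[x y] /=; rewrite /rect /=; lra.
  have [| |c3 t3] := trivialization_glue cH (@closed_rect _ _ _ _) (@closed_rect _ _ _ _) t1 t2.
  - by rewrite E; exists (s, b); rewrite /rect /=; lra.
  - by rewrite E; exact: rect_path.
  exists c3; apply: trivialization_sub t3 => -[x y]; rewrite /rect /=.
  by case=> xac y01; have [xb|xb] := leP y b; [left|right]; rewrite /=; lra.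
have [i Ui] := U_cover (H (s, t)).
have /nbhs_ballP[e e0 He] := near_U cH Ui.
have ee : e / 2 < e by rewrite ltr_pdivrMr// ltr_pMr// ltr1n.
exists (e / 2); first by rewrite divr_gt0.
move=> a b ea at_ tb be a0 b1 ab; exists (e / 2); first by rewrite divr_gt0.
exists (fun j x => g j i (H x)); apply: trivialization_local => // -[x y] [/= hx hy].
by apply: He; split; rewrite /= -ball_normE /= ltr_norml; lra.
Qed.

Lemma trivialization_path (c : R -> T) : continuous c ->
  exists a, trivialization c [set t : R | 0 <= t <= 1] a.
Proof.
(* A path is treated as a map on the square that ignores the first coordinate. *)
move=> cc; have cH : continuous (fun z : R * R => c z.2).
  by move=> z; apply: continuous_comp; [exact: cvg_snd|exact: cc].
have [a ta] := trivialization_rect cH.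
exists (fun i t => a i (0, t)); apply: (trivialization_comp (c := fun t : R => (0, t))) ta => //.
- by apply: continuous_pair => t; [exact: cvg_cst|exact: cvg_id].
- by move=> t /= t01; rewrite /rect /=; lra.
Qed.



Implicit Types c d : R -> T.

(** The holonomy of [g] along [c], read in the index [i] at the start and [j] at the end. It is a
    relation because a section must be chosen; the result does not depend on that choice when the
    end indices are admissible. *)
Definition transport c i j v :=
  exists2 a, trivialization c [set t : R | 0 <= t <= 1] a & v = a j 1 - a i 0.

Lemma transport_exists c i j : continuous c -> exists v, transport c i j v.
Proof. by move=> /trivialization_path[a ta]; exists (a j 1 - a i 0); exists a. Qed.

Lemma itv01_path (x y : R) : 0 <= x <= 1 -> 0 <= y <= 1 ->
  path_in [set t : R | 0 <= t <= 1] x y.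
Proof.
move=> x01 y01; exists (fun t : R => x + t * (y - x)); split.
- by move=> t; apply: cvgD; [exact: cvg_cst|apply: cvgM; [exact: cvg_id|exact: cvg_cst]].
- by rewrite mul0r addr0.
- by rewrite mul1r addrC subrK.
- by move=> t t01 /=; nra.
Qed.

Lemma trivialization_path_diff c a b i j x y : continuous c ->
  trivialization c [set t : R | 0 <= t <= 1] a -> trivialization c [set t : R | 0 <= t <= 1] b ->
  0 <= x <= 1 -> 0 <= y <= 1 -> U i (c x) -> U j (c y) -> a j y - a i x = b j y - b i x.
Proof.
move=> cc ta tb x01 y01 Ui Uj.
have E := trivialization_diff cc ta tb (itv01_path x01 y01) Ui Uj.
have -> : a j y = a i x - b i x + b j y by rewrite E subrK.
by rewrite addrC -!addrA addKr addrC.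
Qed.

Lemma transport_unique c i j v w : continuous c -> U i (c 0) -> U j (c 1) ->
  transport c i j v -> transport c i j w -> v = w.
Proof.
move=> cc Ui Uj [a ta ->] [b tb ->].
by apply: trivialization_path_diff cc ta tb _ _ Ui Uj; lra.
Qed.

Lemma transport_rev c i j v : continuous c -> transport c i j v ->
  transport (fun t => c (1 - t)) j i (- v).
Proof.
move=> cc [a ta ->]; exists (fun i t => a i (1 - t)); last by rewrite subrr subr0 opprB.
apply: (trivialization_comp (c := fun t : R => 1 - t)) ta => //.
  by move=> t; apply: cvgB; [exact: cvg_cst|exact: cvg_id].
by move=> t /=; lra.
Qed.

Lemma transport_in c i v : continuous c -> (forall t : R, 0 <= t <= 1 -> U i (c t)) ->
  transport c i i v -> v = 0.
Proof.
move=> cc cU [a ta ->]; apply/eqP; rewrite subr_eq0; apply/eqP.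
apply: (trivialization_const ta); have := @itv01_path 1 0.
move=> [||d [d1 d2 d3 d4]]; try lra.
by exists d; split=> // t t01; split; [exact: d4|exact/cU/d4].
Qed.

(** A section along the concatenation restricts to sections along both halves, and the two
    increments telescope at the parameter 1/2, read in the common index [j]. *)
Lemma path_cat c d : continuous c -> continuous d -> c 1 = d 0 ->
  exists e : R -> T, [/\ continuous e, e 0 = c 0, e 1 = d 1 &
    forall i j k v w, U i (c 0) -> U j (d 0) -> U k (d 1) ->
      transport c i j v -> transport d j k w -> transport e i k (v + w)].
Proof.
move=> cc cd cd1.
pose e t := if t <= 2^-1 then c (2 * t) else d (2 * t - 1).
have e1 t : t <= 2^-1 -> e t = c (2 * t) by rewrite /e => ->.
have e2 t : 2^-1 <= t -> e t = d (2 * t - 1).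
  rewrite le_eqVlt => /orP[/eqP <-|ht]; last by rewrite /e leNgt ht.
  by rewrite e1// mulfV ?pnatr_eq0// subrr.
have ce : continuous e.
  apply/continuous_subspace_setT.
  have -> : [set: R] = [set` `]-oo, 2^-1]] `|` [set` `[2^-1, +oo[].
    by apply/seteqP; split=> // x _ /=; rewrite !in_itv /= andbT; apply/orP/le_total.
  apply: withinU_continuous; [exact: interval_closed|exact: interval_closed| |].
    refine (@subspace_eq_continuous R [set` `]-oo, 2^-1]] T (fun t => c (2 * t)) e _ _).
      by move=> t; rewrite inE /= in_itv /= => /e1 ->.
    apply: continuous_subspaceT => t; apply: (continuous_comp (f := fun t : R => 2 * t)).
      by apply: cvgM; [exact: cvg_cst|exact: cvg_id].
    exact: cc.
  refine (@subspace_eq_continuous R [set` `[2^-1, +oo[] T (fun t => d (2 * t - 1)) e _ _).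
    by move=> t; rewrite inE /= in_itv /= andbT => /e2 ->.
  apply: continuous_subspaceT => t; apply: (continuous_comp (f := fun t : R => 2 * t - 1)).
    by apply: cvgB; [apply: cvgM; [exact: cvg_cst|exact: cvg_id]|exact: cvg_cst].
  exact: cd.
have e0 : e 0 = c 0 by rewrite e1 ?mulr0// invr_ge0.
have e11 : e 1 = d 1 by rewrite e2 ?invf_le1 ?ler1n// mulr1 addrK.
exists e; split=> // i j k v w Ui Uj Uk tv tw.
have [a ta] := trivialization_path ce.
exists a => //.
have cont_affine (p q : R) : continuous (fun t : R => p * t + q).
  by move=> t; apply: cvgD; [apply: cvgM; [exact: cvg_cst|exact: cvg_id]|exact: cvg_cst].
have t1 : transport c i j (a j 2^-1 - a i 0).
  exists (fun i t => a i (2^-1 * t + 0)); last by rewrite mulr1 mulr0 !addr0.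
  apply: (trivialization_comp (c := fun t : R => 2^-1 * t + 0)) ta => //.
    by move=> t /=; lra.
  by move=> t /= t01; rewrite e1; [congr c; lra|lra].
have t2 : transport d j k (a k 1 - a j 2^-1).
  exists (fun i t => a i (2^-1 * t + 2^-1)); last first.
    by rewrite mulr1 mulr0 add0r -div1r -splitr.
  apply: (trivialization_comp (c := fun t : R => 2^-1 * t + 2^-1)) ta => //.
    by move=> t /=; lra.
  by move=> t /= t01; rewrite e2; [congr d; lra|lra].
rewrite (transport_unique cc Ui _ tv t1) ?cd1// (transport_unique cd Uj Uk tw t2).
by rewrite addrC addrA subrK.
Qed.

(** A section over the whole square of the null-homotopy computes the transport on the side s = 0.
    On the other three sides the homotopy stays at the base point, so the section is constant there
    in the index [i], and the two ends of the loop get the same value. *)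
Lemma transport_loop (c : R -> T) i v : simply_connected R T -> continuous c ->
  c 0 = c 1 -> U i (c 0) -> transport c i i v -> v = 0.
Proof.
move=> [_ sc] cc c01 Ui tv.
have [H [cH H0 H1 Hs]] := sc c (continuous_subspaceT cc) c01.
pose q (z : R * R) := (clamp z.1, clamp z.2).
have cq : continuous q.
  apply: continuous_pair => z.
    by apply: continuous_comp; [exact: cvg_fst|exact: clamp_cts].
  by apply: continuous_comp; [exact: cvg_snd|exact: clamp_cts].
have cHq : continuous (H \o q).
  apply: continuous_within_comp cH cq _ => z.
  by split; rewrite /=; exact: clamp_itv.
have Hq s t : 0 <= s <= 1 -> 0 <= t <= 1 -> (H \o q) (s, t) = H (s, t).
  by move=> s01 t01; rewrite /q /= !clampE.
have in01 (t : R) : 0 <= t <= 1 -> t \in `[0, 1] by rewrite inE.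
have [a ta] := trivialization_rect cHq.
have z01 : 0 <= (0 : R) <= 1 by lra.
have o01 : 0 <= (1 : R) <= 1 by lra.
have t0 : transport c i i (a i (0, 1) - a i (0, 0)).
  exists (fun i t => a i (0, t)) => //.
  apply: (trivialization_comp (c := fun t : R => (0, t))) ta.
  - by apply: continuous_pair => t; [exact: cvg_cst|exact: cvg_id].
  - by move=> t /= t01; rewrite /rect /=; lra.
  - by move=> t t01; rewrite (Hq 0 t)// H0//; exact: in01.
rewrite (transport_unique cc Ui _ tv t0) -?c01//.
have side x y : rect 0 1 0 1 x -> rect 0 1 0 1 y ->
   (forall t : R, 0 <= t <= 1 -> H (x.1 + t * (y.1 - x.1), x.2 + t * (y.2 - x.2)) = c 0) ->
   a i x = a i y.
  move=> Rx Ry HE; apply: (trivialization_const ta).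
  exists (fun t : R => (x.1 + t * (y.1 - x.1), x.2 + t * (y.2 - x.2))); split.
  - have cl (m l : R) : continuous (fun t : R => m + t * (l - m)).
      by move=> t; apply: cvgD; [exact: cvg_cst|apply: cvgM; [exact: cvg_id|exact: cvg_cst]].
    by apply: continuous_pair; exact: cl.
  - by rewrite !mul0r !addr0; case: (x).
  - by rewrite !mul1r ![_ + (_ - _)]addrC !subrK; case: (y).
  - move=> t t01; move: Rx Ry => [Rx1 Rx2] [Ry1 Ry2].
    have I1 : 0 <= x.1 + t * (y.1 - x.1) <= 1 by nra.
    have I2 : 0 <= x.2 + t * (y.2 - x.2) <= 1 by nra.
    by split; [split|rewrite /preimage /= -/((H \o q) _) Hq// HE].
have S1 : a i (0, 0) = a i (1, 0).
  apply: side => /=; [by split|by split|].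
  by move=> t t01; rewrite subr0 mulr1 subrr mulr0 !add0r; case: (Hs t (in01 _ t01)).
have S2 : a i (1, 0) = a i (1, 1).
  apply: side => /=; [by split|by split|].
  by move=> t t01; rewrite subr0 mulr1 subrr mulr0 addr0 add0r H1//; exact: in01.
have S3 : a i (0, 1) = a i (1, 1).
  apply: side => /=; [by split|by split|].
  by move=> t t01; rewrite subr0 mulr1 subrr mulr0 addr0 add0r; case: (Hs t (in01 _ t01)).
by rewrite S3 S1 S2 subrr.
Qed.

Hypothesis U_paths : forall i p, U i p ->
  \forall q \near p, path_in (U i) p q.

(** The value at [p] is the transport from a base point along a path chosen arbitrarily. No
    continuity in [p] is asked of the choice: nearby points are compared through a loop, whose
    transport is 0. *)
Theorem cocycle_trivial : simply_connected R T -> exists a : I -> T -> G,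
  (forall i j p, U i p -> U j p -> a i p - a j p = g i j p) /\
  (forall i p, U i p -> \forall q \near p, a i q = a i p).
Proof.
move=> sc; have [[[p0 _] pc] _] := sc.
have [i0 Ui0] := U_cover p0.
have path_ p : exists c : R -> T, [/\ continuous c, c 0 = p0 & c 1 = p].
  have [c [cc c0 c1]] := pc p0 p; exists (c \o clamp); split=> /=.
  - by apply: continuous_within_comp cc clamp_cts _ => t; rewrite /= in_itv /= clamp_itv.
  - by rewrite clampE// lexx ler01.
  - by rewrite clampE// lexx ler01.
have [c cP] := choice path_.
have tr p : exists a, trivialization (c p) [set t : R | 0 <= t <= 1] a.
  by apply: trivialization_path; have [] := cP p.
have [b bP] := choice tr.
exists (fun i p => b p i 1 - b p i0 0); split=> [i j p Ui Uj|i p Ui].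
  rewrite opprB addrA subrK; have [b1 _] := bP p.
  have [_ _ c1] := cP p.
  have := b1 i j 1; rewrite c1; apply => //=; lra.
have := U_paths Ui; apply: filterS => q [d [cd d0 d1 dU]].
have [cp cp0 cp1] := cP p; have [cq cq0 cq1] := cP q.
have Uq : U i q by rewrite -d1; apply: dU; lra.
have [e [ce e0 e1 te]] := path_cat cp cd (etrans cp1 (esym d0)).
have cr : continuous (fun t : R => c q (1 - t)).
  move=> t; apply: (continuous_comp (f := fun t : R => 1 - t)); last exact: cq.
  by apply: cvgB; [exact: cvg_cst|exact: cvg_id].
have er : e 1 = (fun t : R => c q (1 - t)) 0 by rewrite e1 d1 subr0 cq1.
have [l [cl l0 l1 tl]] := path_cat ce cr er.
have [v0 tv0] := transport_exists i i cd.
have v00 := transport_in cd dU tv0.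
have tp : transport (c p) i0 i (b p i 1 - b p i0 0) by exists (b p).
have tq : transport (c q) i0 i (b q i 1 - b q i0 0) by exists (b q).
have te' := te i0 i i _ _ _ _ _ tp tv0.
have {}te' : transport e i0 i (b p i 1 - b p i0 0 + v0).
  by apply: te'; rewrite ?cp0 ?d0 ?d1.
(* The loop runs from [p0] to [p], then inside [U i] to [q] with zero transport, and back along the
   path chosen for [q]. *)
have tl' : transport l i0 i0 (b p i 1 - b p i0 0 + v0 - (b q i 1 - b q i0 0)).
  apply: (tl _ i) (transport_rev cq tq) => //.
  - by rewrite e0 cp0.
  - by rewrite subr0 cq1.
  - by rewrite subrr cq0.
have := transport_loop sc cl _ _ tl'.
rewrite l0 l1 e0 cp0 subrr cq0 => /(_ erefl Ui0) /eqP.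
by rewrite v00 addr0 subr_eq0 => /eqP.
Qed.

End Trivializations.

(** * Bivectors and densities in coordinates *)

Section CoordinateComputations.
Context {R : realType} {n : nat}.
Implicit Types (D : set 'rV[R]_n).

Lemma partial_sum D (I : Type) (r : seq I) (f : I -> 'rV[R]_n -> R) (i : 'I_n) x :
  (forall k, smooth_on D (f k)) -> D x ->
  partial i (fun y => \sum_(k <- r) f k y) x = \sum_(k <- r) partial i (f k) x.
Proof.
move=> sf Dx; have df k : differentiable (f k) x by exact: smooth_on_diff (sf k) Dx.
rewrite /partial.
have := derive_lincomb r (fun=> 1) (delta_mx 0 i) df.
under eq_fun do under eq_bigr do rewrite mul1r.
by under [RHS]eq_bigr do rewrite mul1r.
Qed.

Lemma smooth_partialM D (f g : 'rV[R]_n -> R) (i : 'I_n) x :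
  smooth_on D f -> smooth_on D g -> D x ->
  partial i (fun y => f y * g y) x = f x * partial i g x + g x * partial i f x.
Proof. by move=> sf sg Dx; apply: partialM; apply: smooth_on_diff Dx. Qed.

Lemma antisym_sum_eq0 (A B : 'I_n -> 'I_n -> R) :
  (forall i j, A i j = - A j i) -> (forall i j, B i j = B j i) ->
  \sum_i \sum_j A i j * B i j = 0.
Proof.
move=> Aa Bs; set S := \sum_i _.
have : S = - S.
  rewrite {1}/S exchange_big /= /S -sumrN; apply: eq_bigr => i _.
  by rewrite -sumrN; apply: eq_bigr => j _; rewrite Aa Bs mulNr.
by move/eqP; rewrite -addr_eq0 -mulr2n mulrn_eq0 => /eqP.
Qed.

(** The second derivatives of [F] are contracted with the antisymmetric [p] and drop out. This is
    why the divergence of a Hamiltonian field is a derivation in the Hamiltonian. *)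
Lemma divergence_hamiltonian D (F mu : 'rV[R]_n -> R) (p : 'rV[R]_n -> 'M[R]_n) x :
  open D -> D x -> smooth_on D F -> smooth_on D mu -> mx_smooth_on D p ->
  (forall y, D y -> (p y)^T = - p y) ->
  \sum_j (\sum_i partial i F x * p x i j) * partial j mu x +
  mu x * \sum_j partial j (fun y => \sum_i partial i F y * p y i j) x =
  \sum_i partial i F x * \sum_j partial j (fun y => mu y * p y i j) x.
Proof.
move=> oD Dx sF smu sp pa.
have -> : \sum_i partial i F x * \sum_j partial j (fun y => mu y * p y i j) x =
    \sum_j \sum_i partial i F x * (mu x * partial j (fun y => p y i j) x + p x i j * partial j mu x).
  rewrite exchange_big; apply: eq_bigr => i _; rewrite mulr_sumr; apply: eq_bigr => j _.
  by rewrite (smooth_partialM _ smu (sp i j) Dx).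
have Dj j : partial j (fun y => \sum_i partial i F y * p y i j) x =
   \sum_i (partial i F x * partial j (fun y => p y i j) x + p x i j * partial j (partial i F) x).
  rewrite (partial_sum _ _ _ Dx); last first.
    by move=> i; apply: smooth_onM; [|exact: smooth_on_partial|exact: sp].
  apply: eq_bigr => i _.
  by rewrite (smooth_partialM _ (smooth_on_partial i sF) (sp i j) Dx).
have Z : \sum_j \sum_i p x i j * partial j (partial i F) x = 0.
  rewrite exchange_big; apply: antisym_sum_eq0 => i j.
    by have := congr1 (fun M : 'M[R]_n => M j i) (pa x Dx); rewrite !mxE.
  exact: partial_swap oD sF Dx.
have {}Z := congr1 ( *%R (mu x)) Z; rewrite mulr0 in Z.
rewrite -[RHS]addr0 -[X in _ = _ + X]Z 2!mulr_sumr -2!big_split /=.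
apply: eq_bigr => j _; rewrite Dj mulr_suml !mulr_sumr -!big_split /=.
by apply: eq_bigr => i _; ring.
Qed.

(** Differentiate J adj(J) = det J. Since [J] is a Jacobian, d_k J_ij = d_i J_kj, so Jacobi's
    formula for the derivative of det J cancels the terms where [J] is differentiated. The vector of
    divergences is thus killed by the invertible matrix [J x]. *)
Lemma piola D (T : 'rV[R]_n -> 'rV[R]_n) (J : 'rV[R]_n -> 'M[R]_n) x b :
  open D -> D x -> mx_smooth_on D T ->
  (forall y i j, D y -> J y i j = partial i (fun z => T z 0 j) y) ->
  \det (J x) != 0 ->
  \sum_j partial j (fun y => cofactor (J y) j b) x = 0.
Proof.
move=> oD Dx sT JE J0.
have sJ : mx_smooth_on D J.
  move=> i j; apply: (smooth_on_ext oD _ (smooth_on_partial i (sT 0 j))).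
  by move=> y Dy; rewrite JE.
have sC : forall i j, smooth_on D (fun y => cofactor (J y) i j).
  move=> i j; apply: smooth_onM => //; first exact: smooth_on_cst.
  apply: smooth_on_det => // k l.
  by apply: (smooth_on_ext oD _ (sJ (lift i k) (lift j l))) => y _; rewrite !mxE.
pose z := \col_b \sum_j partial j (fun y => cofactor (J y) j b) x.
suff z0 : z = 0 by have := congr1 (fun M : 'cV[R]_n => M b 0) z0; rewrite !mxE.
have Ju : J x \in unitmx by rewrite unitmxE unitfE.
suff Jz : J x *m z = 0 by rewrite -[z](mulKmx Ju) Jz mulmx0.
have dJ i j k : partial k (fun y => J y i j) x = partial i (fun y => J y k j) x.
  have E m l : partial m (fun y => J y l j) x = partial m (partial l (fun z => T z 0 j)) x.
    by apply: near_eq_partial; apply: (eq_on_near oD _ Dx) => y Dy; rewrite JE.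
  by rewrite !E (partial_swap _ _ oD (sT 0 j) Dx).
have ddet k : partial k (fun y => \det (J y)) x =
    \sum_i \sum_j partial k (fun y => J y i j) x * cofactor (J x) i j.
  by apply: derive_det => i j; exact: smooth_on_diff (sJ i j) Dx.
have ident k j : \sum_b' (J x k b' * partial j (fun y => cofactor (J y) j b') x +
     cofactor (J x) j b' * partial j (fun y => J y k b') x) =
   (k == j)%:R * partial j (fun y => \det (J y)) x.
  have -> : (k == j)%:R * partial j (fun y => \det (J y)) x =
     partial j (fun y => (k == j)%:R * \det (J y)) x.
    rewrite (smooth_partialM _ (smooth_on_cst _ oD) (smooth_on_det oD sJ) Dx).
    by rewrite partial_cst mulr0 addr0.
  have -> : (fun y => (k == j)%:R * \det (J y)) =
      (fun y => \sum_b' J y k b' * cofactor (J y) j b').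
    apply/funext => y; have E := congr1 (fun M : 'M[R]_n => M k j) (mul_mx_adj (J y)).
    rewrite mxE [in RHS]mxE in E; rewrite mulr_natl -E.
    by apply: eq_bigr => b' _; rewrite mxE.
  rewrite (partial_sum _ _ _ Dx); last by move=> b'; apply: smooth_onM.
  by apply: eq_bigr => b' _; rewrite (smooth_partialM _ (sJ k b') (sC j b') Dx).
apply/colP => k; rewrite !mxE.
transitivity (\sum_j ((k == j)%:R * partial j (fun y => \det (J y)) x -
    \sum_b' cofactor (J x) j b' * partial j (fun y => J y k b') x)).
  under eq_bigr do rewrite mxE mulr_sumr.
  rewrite exchange_big; apply: eq_bigr => j _.
  by rewrite -ident big_split /= addrK.
rewrite sumrB (bigD1 k)//= eqxx mul1r big1 ?addr0; last first.
  by move=> j jk; rewrite eq_sym (negbTE jk) mul0r.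
rewrite ddet -sumrB big1// => i _; rewrite -sumrB big1// => j _.
by rewrite dJ mulrC subrr.
Qed.

(** The factor J_ia moves under the derivative for free: the extra terms pair the antisymmetric [p]
    with d_j J_ia, symmetric in i and j. The resulting vector [V] is a Piola transform, whose
    divergence at [x] is det J times a divergence at [T x]. *)
Lemma modular_components_transform D E (T : 'rV[R]_n -> 'rV[R]_n) (J : 'rV[R]_n -> 'M[R]_n)
    (mu mu' : 'rV[R]_n -> R) (p p' : 'rV[R]_n -> 'M[R]_n) x a :
  open D -> open E -> D x -> mx_smooth_on D T -> (forall y, D y -> E (T y)) ->
  (forall y i j, D y -> J y i j = partial i (fun z => T z 0 j) y) ->
  \det (J x) != 0 ->
  smooth_on D mu -> smooth_on E mu' -> mx_smooth_on D p -> mx_smooth_on E p' ->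
  (forall y, D y -> (p y)^T = - p y) ->
  (forall y, D y -> mu y = \det (J y) * mu' (T y)) ->
  (forall y, D y -> p' (T y) = (J y)^T *m p y *m J y) ->
  \sum_i (\sum_j partial j (fun y => mu y * p y i j) x) * J x i a =
  \det (J x) * \sum_b partial b (fun y => mu' y * p' y a b) (T x).
Proof.
move=> oD oE Dx sT TE JE J0 smu smu' sp sp' pa muE pE.
have sJ : mx_smooth_on D J.
  move=> i j; apply: (smooth_on_ext oD _ (smooth_on_partial i (sT 0 j))).
  by move=> y Dy; rewrite JE.
have sC : forall i j, smooth_on D (fun y => cofactor (J y) i j).
  move=> i j; apply: smooth_onM => //; first exact: smooth_on_cst.
  apply: smooth_on_det => // k l.
  by apply: (smooth_on_ext oD _ (sJ (lift i k) (lift j l))) => y _; rewrite !mxE.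
have dJ i k : partial k (fun y => J y i a) x = partial i (fun y => J y k a) x.
  have E' m l : partial m (fun y => J y l a) x = partial m (partial l (fun z => T z 0 a)) x.
    by apply: near_eq_partial; apply: (eq_on_near oD _ Dx) => y Dy; rewrite JE.
  by rewrite !E' (partial_swap _ _ oD (sT 0 a) Dx).
have smp i j : smooth_on D (fun y => mu y * p y i j) by apply: smooth_onM.
pose V j y := \sum_i (mu y * p y i j) * J y i a.
have sV : \sum_i (\sum_j partial j (fun y => mu y * p y i j) x) * J x i a =
    \sum_j partial j (V j) x.
  have DV j : partial j (V j) x = \sum_i (J x i a * partial j (fun y => mu y * p y i j) x +
      mu x * p x i j * partial j (fun y => J y i a) x).
    rewrite (partial_sum _ _ _ Dx); last by move=> i; apply: smooth_onM.
    apply: eq_bigr => i _; rewrite (smooth_partialM _ (smp i j) (sJ i a) Dx).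
    by rewrite addrC.
  under [RHS]eq_bigr do rewrite DV big_split /=.
  rewrite big_split /= [X in _ + X](_ : _ = 0) ?addr0.
    rewrite [RHS]exchange_big /=; apply: eq_bigr => i _.
    by rewrite mulr_suml; apply: eq_bigr => j _; rewrite mulrC.
  rewrite exchange_big; apply: (antisym_sum_eq0 (A := fun i j => mu x * p x i j)
      (B := fun i j => partial j (fun y => J y i a) x)) => i j.
    have := congr1 (fun M : 'M[R]_n => M j i) (pa x Dx); rewrite !mxE => ->.
    by rewrite mulrN.
  exact: dJ.
rewrite sV.
pose G b y := mu' (T y) * p' (T y) a b.
have sG b : smooth_on D (G b).
  exact: (smooth_on_comp (f := fun z => mu' z * p' z a b) oD sT TE (smooth_onM oE smu' (sp' a b))).
(* Comes from (J^T p J) adj(J) = det J (J^T p), the left bracket being [p'] at [T y]. *)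
have VG j y : D y -> V j y = \sum_b G b y * cofactor (J y) j b.
  move=> Dy; rewrite /G /V.
  have H := congr1 (fun M : 'M[R]_n => M a j) (mulmxA ((J y)^T *m p y) (J y) (\adj (J y))).
  rewrite mul_mx_adj mul_mx_scalar -pE// [LHS]mxE [RHS]mxE in H.
  transitivity (mu' (T y) * (\det (J y) * \sum_i J y i a * p y i j)).
    rewrite muE// !mulr_sumr; apply: eq_bigr => i _; ring.
  rewrite [X in _ * (_ * X)](_ : _ = ((J y)^T *m p y) a j); last first.
    by rewrite mxE; apply: eq_bigr => i _; rewrite mxE.
  rewrite -[_ * (_ a j)]/(\det (J y) * ((J y)^T *m p y) a j) H mulr_sumr.
  by apply: eq_bigr => b _; rewrite mulrA [\adj _ _ _]mxE.
have DG b j : partial j (G b) x = \sum_k J x j k * partial k (fun z => mu' z * p' z a b) (T x).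
  have dT : differentiable T x := mx_smooth_on_diff sT Dx.
  have df : differentiable (fun z => mu' z * p' z a b) (T x).
    exact: smooth_on_diff (smooth_onM oE smu' (sp' a b)) (TE _ Dx).
  have := partial_comp j dT df; rewrite /comp -/(G b) => ->.
  by apply: eq_bigr => k _; rewrite JE// jacobianE.
transitivity (\sum_j partial j (fun y => \sum_b G b y * cofactor (J y) j b) x).
  apply: eq_bigr => j _; apply: near_eq_partial; apply: (eq_on_near oD _ Dx) => y Dy.
  exact: VG.
transitivity (\sum_j \sum_b (G b x * partial j (fun y => cofactor (J y) j b) x +
    cofactor (J x) j b * partial j (G b) x)).
  apply: eq_bigr => j _; rewrite (partial_sum _ _ _ Dx); last by move=> b; apply: smooth_onM.
  by apply: eq_bigr => b _; rewrite (smooth_partialM _ (sG b) (sC j b) Dx).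
rewrite exchange_big mulr_sumr /=; apply: eq_bigr => b _.
rewrite big_split /= -mulr_sumr (piola b oD Dx sT JE J0) mulr0 add0r.
under eq_bigr do rewrite DG mulr_sumr.
have HJ k : \sum_j J x j k * cofactor (J x) j b = \det (J x) *+ (b == k).
  have H := congr1 (fun M : 'M[R]_n => M b k) (mul_adj_mx (J x)).
  rewrite [LHS]mxE [RHS]mxE in H; rewrite -H.
  by apply: eq_bigr => j _; rewrite mulrC [\adj _ _ _]mxE.
rewrite exchange_big /= (bigD1 b)//= [X in _ + X]big1 ?addr0.
  under eq_bigr do rewrite mulrA.
  rewrite -mulr_suml; under eq_bigr do rewrite mulrC.
  by rewrite HJ eqxx.
move=> k kb; under eq_bigr do rewrite mulrA.
rewrite -mulr_suml; under eq_bigr do rewrite mulrC.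
by rewrite HJ eq_sym (negbTE kb) mul0r.
Qed.

(* The Lie derivative of the form [W] along the Hamiltonian field [X] of a
   coordinate vanishes, because [X] preserves the bivector [p] and the density
   [rho], which determine [W] up to sign. Hence [i_X dW = 0] for all [X] tangent
   to the foliation, and this forces [dW = 0] in codimension 1. *)
Lemma transverse_form_closed D (p : 'rV[R]_n -> 'M[R]_n) (rho : 'rV[R]_n -> R)
    (W : 'rV[R]_n -> 'cV[R]_n) x :
  open D -> D x -> mx_smooth_on D p -> smooth_on D rho -> mx_smooth_on D W ->
  (forall y, D y -> (p y)^T = - p y) ->
  (forall i j k : 'I_n, \sum_l (p x i l * partial l (fun y => p y j k) x
          + p x j l * partial l (fun y => p y k i) x
          + p x k l * partial l (fun y => p y i j) x) = 0) ->
  (forall y, D y -> p y *m W y = 0) ->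
  W x != 0 -> (\rank (p x) + 1)%N = n ->
  (forall a, \sum_j partial j (fun y => rho y * p y a j) x = 0) ->
  (forall (Z : 'cV[R]_n) y, D y -> ((W y)^T *m Z) 0 0 ^+ 4 = rho y ^+ 4 * \det (p y + Z *m Z^T) ^+ 2) ->
  forall i j, partial i (fun y => W y j 0) x = partial j (fun y => W y i 0) x.
Proof.
move=> oD Dx sp srho sW pa jac pW W0 rp div detE.
have anti y i j : D y -> p y i j = - p y j i.
  by move=> Dy; have := congr1 (fun M : 'M[R]_n => M j i) (pa y Dy); rewrite !mxE.
(* [B a] is the Jacobian of the Hamiltonian field X of the coordinate x_a, whose components are the
   row [a] of [p]; [flow] then says L_X W = 0. *)
pose B a := \matrix_(l, i) partial l (fun y => p y a i) x.
have flow a : \col_i (\sum_l p x a l * partial l (fun y => W y i 0) x) = - (B a *m W x).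
  pose dl (f : 'rV[R]_n -> R) := 'D_(row a (p x)) f x.
  have dlE f : smooth_on D f -> dl f = \sum_l p x a l * partial l f x.
    move=> sf; rewrite /dl (derive_partial _ (smooth_on_diff sf Dx)).
    by apply: eq_bigr => l _; rewrite mxE.
  have dlM f g : smooth_on D f -> smooth_on D g ->
      dl (fun y => f y * g y) = f x * dl g + g x * dl f.
    move=> sf sg; rewrite /dl; apply: deriveM.
      exact/diff_derivable/(smooth_on_diff sf Dx).
    exact/diff_derivable/(smooth_on_diff sg Dx).
  (* The Jacobi identity, read as L_X p = 0. *)
  have dp i j : dl (fun y => p y i j) = (p x *m B a + (B a)^T *m p x) i j.
    rewrite dlE; last exact: sp.
    have := jac a i j; rewrite !big_split /= -addrA => /eqP; rewrite addr_eq0 => /eqP ->.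
    rewrite !mxE -!big_split -sumrN /=; apply: eq_bigr => l _; rewrite !mxE.
    have -> : partial l (fun y => p y j a) x = - partial l (fun y => p y a j) x.
      rewrite -partialN; last exact: smooth_on_diff (sp a j) Dx.
      by apply: near_eq_partial; apply: (eq_on_near oD _ Dx) => y Dy; rewrite anti.
    by rewrite (anti x j l Dx); ring.
  (* X has divergence 0 with respect to [rho]. *)
  have drho : dl rho = - (rho x * \tr (B a)).
    rewrite dlE//; have := div a.
    under eq_bigr do rewrite (smooth_partialM _ srho (sp a _) Dx).
    rewrite big_split /= -mulr_sumr addrC => /eqP; rewrite addr_eq0 => /eqP ->.
    by congr (- (_ * _)); apply: eq_bigr => l _; rewrite mxE.
  pose q (Z : 'cV[R]_n) := (Z^T *m B a *m W x) 0 0.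
  (* The defining relation of [W] is differentiated along X, and the common factor 4 (W^T Z)^4 is
     cancelled; hence the restriction on [Z]. *)
  have main (Z : 'cV[R]_n) : ((W x)^T *m Z) 0 0 != 0 ->
      \sum_i Z i 0 * dl (fun y => W y i 0) = - q Z.
    move=> d0; pose f y := \det (p y + Z *m Z^T).
    pose d y := ((W y)^T *m Z) 0 0.
    have sd : smooth_on D d.
      rewrite (_ : d = fun y => \sum_i W y i 0 * Z i 0).
        by apply: smooth_on_sum => // i; apply: smooth_onM => //; exact: smooth_on_cst.
      by apply/funext => y; rewrite /d mxE; apply: eq_bigr => i _; rewrite mxE.
    have sf : smooth_on D f.
      apply: smooth_on_det => // i j.
      apply: (smooth_on_ext oD (f := fun y => p y i j + (Z *m Z^T) i j)).
        by move=> y _; rewrite [in RHS]mxE.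
      by apply: smooth_onD => //; exact: smooth_on_cst.
    have dlX g m : smooth_on D g -> dl (fun y => g y ^+ m) = m%:R * g x ^+ m.-1 * dl g.
      move=> sg; have dg : derivable g x (row a (p x)).
        exact/diff_derivable/(smooth_on_diff sg Dx).
      rewrite /dl; have -> : (fun y => g y ^+ m) = g ^+ m.
        by apply/funext => y; rewrite fctE.
      by rewrite deriveX.
    have E4 : dl (fun y => d y ^+ 4) = dl (fun y => rho y ^+ 4 * f y ^+ 2).
      by apply: near_eq_derive; apply: (eq_on_near oD _ Dx) => y Dy; exact: detE.
    rewrite dlX// dlM ?dlX// in E4; try exact: smooth_onX.
    have Ed : dl d = \sum_i Z i 0 * dl (fun y => W y i 0).
      have -> : d = fun y => \sum_i Z i 0 * W y i 0.
        by apply/funext => y; rewrite /d mxE; apply: eq_bigr => i _; rewrite mxE mulrC.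
      by apply: derive_lincomb => i; exact: smooth_on_diff (sW i 0) Dx.
    have Ef : d x * dl f = f x * (2 * d x * \tr (B a) - 2 * q Z).
      rewrite /q -(rank1_update_flow (B a) Z (pa x Dx) (pW x Dx)); congr (_ * _).
      rewrite /dl /f derive_det; last first.
        move=> i j; apply: near_eq_differentiable (smooth_on_diff
          (smooth_onD oD (sp i j) (smooth_on_cst ((Z *m Z^T) i j) oD)) Dx).
        by near=> y; rewrite [RHS]mxE.
      apply: eq_bigr => i _; apply: eq_bigr => j _; congr (_ * _).
      rewrite -dp /dl.
      have -> : (fun y => (p y + Z *m Z^T) i j) = (fun y => p y i j) + cst ((Z *m Z^T) i j).
        by apply/funext => y; rewrite mxE.
      rewrite deriveD ?derive_cst ?addr0//.
      exact/diff_derivable/(smooth_on_diff (sp i j) Dx).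
    rewrite -Ed; rewrite drho in E4.
    have E0 : d x ^+ 4 = rho x ^+ 4 * f x ^+ 2 by exact: detE.
    have d40 : 4 * d x ^+ 4 != 0 by rewrite mulf_neq0 ?pnatr_eq0// expf_neq0.
    apply: (mulfI d40).
    transitivity (d x * (4 * d x ^+ 3 * dl d)); first by ring.
    rewrite E4 mulrN E0.
    transitivity (rho x ^+ 4 * (2 * f x ^+ 1 * (d x * dl f)) +
       f x ^+ 2 * (4 * rho x ^+ 3 * - (rho x * \tr (B a))) * d x); first by ring.
    by rewrite Ef; ring.
  have [i0 Wi0] : exists i, W x i 0 != 0.
    apply/existsP; apply: contraNT W0; rewrite negb_exists => /forallP H.
    by apply/eqP/colP => i; rewrite mxE; have := H i; rewrite negbK => /eqP.
  pose u := \col_i dl (fun y => W y i 0) + B a *m W x.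
  have uZ (Z : 'cV[R]_n) : ((W x)^T *m Z) 0 0 != 0 -> (Z^T *m u) 0 0 = 0.
    move=> /main E; rewrite mulmxDr mulmxA mxE -/(q Z) mxE.
    under eq_bigr do rewrite !mxE.
    by rewrite E addNr.
  have Wd i : ((W x)^T *m (delta_mx i 0 : 'cV[R]_n)) 0 0 = W x i 0 by rewrite -colE !mxE.
  have ud i : ((delta_mx i 0 : 'cV[R]_n)^T *m u) 0 0 = u i 0.
    by rewrite trmx_delta -rowE mxE.
  (* The admissible [Z] span everything: when W_i = 0, both e_i0 and e_i + e_i0 pair nontrivially
     with [W]. *)
  have u0 i : u i 0 = 0.
    have [Wi|Wi] := eqVneq (W x i 0) 0; last by rewrite -ud uZ// Wd.
    have := uZ (delta_mx i 0 + delta_mx i0 0); rewrite mulmxDr mxE !Wd Wi add0r => /(_ Wi0).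
    rewrite [(_ + _)^T]linearD /= mulmxDl mxE !ud => H.
    by have := uZ (delta_mx i0 0); rewrite Wd ud => /(_ Wi0) H0; rewrite H0 addr0 in H.
  apply/eqP; rewrite -addr_eq0; apply/eqP/colP => i; rewrite [RHS]mxE; apply: etrans (u0 i).
  by rewrite !mxE dlE//; exact: (sW i 0).
(* Cartan's formula for i_X dW: differentiating p W = 0 is the vanishing of d(i_X W), and [flow] is
   the vanishing of L_X W. *)
have contr (a i : 'I_n) : \sum_l p x a l * (partial l (fun y => W y i 0) x - partial i (fun y => W y l 0) x) = 0.
  under eq_bigr do rewrite mulrBr.
  rewrite sumrB; apply/eqP; rewrite subr_eq0; apply/eqP.
  have := congr1 (fun M : 'cV[R]_n => M i 0) (flow a); rewrite !mxE => ->.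
  have := near_eq_partial i (eq_on_near oD (fun y Dy => congr1 (fun M : 'cV[R]_n => M a 0) (pW y Dy)) Dx).
  have -> : (fun y => (p y *m W y) a 0) = (fun y => \sum_l p y a l * W y l 0).
    by apply/funext => y; rewrite mxE.
  have -> : (fun y : 'rV[R]_n => (0 : 'cV[R]_n) a 0) = (fun=> 0).
    by apply/funext => y; rewrite mxE.
  rewrite partial_cst (partial_sum _ _ _ Dx); last by move=> l; apply: smooth_onM.
  under eq_bigr do rewrite (smooth_partialM _ (sp a _) (sW _ 0) Dx).
  rewrite big_split /= => /eqP; rewrite addr_eq0 => /eqP ->.
  by congr (- _); apply: eq_bigr => l _; rewrite mxE mulrC.
pose Om := \matrix_(l, i) (partial l (fun y => W y i 0) x - partial i (fun y => W y l 0) x).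
suff Om0 : Om = 0.
  move=> i j; have := congr1 (fun M : 'M[R]_n => M i j) Om0; rewrite !mxE => /eqP.
  by rewrite subr_eq0 => /eqP.
apply: (antisym_form_eq0 (pa x Dx) (pW x Dx) rp W0).
- by apply/matrixP => i j; rewrite !mxE opprB.
- by move=> i; rewrite mxE subrr.
apply/matrixP => a i; rewrite !mxE -[RHS](contr a i).
by apply: eq_bigr => l _; rewrite mxE.
Unshelve. all: by end_near. Qed.

End CoordinateComputations.

(** * Charts and the transverse density *)

(* [coord] would otherwise denote coordinates with respect to a basis, from vector.v *)
Local Notation coord := Defs.coord.

Section Charts.
Context {R : realType} {n : nat} {P : manifold R n}.
Implicit Types (c : chart P) (x : 'rV[R]_n).

Lemma near_param c x (Q : set P) : cimg c x -> nbhs (param c x) Q ->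
  \forall y \near x, Q (param c y).
Proof. by move=> cx nQ; exact: (param_continuous cx nQ). Qed.

Lemma near_cimg c x : cimg c x -> \forall y \near x, cimg c y.
Proof. by move=> cx; have := open_nbhs_nbhs (conj (@cimg_open _ _ P c) cx); apply: filterS. Qed.

Lemma near_cdom c (p : P) : cdom c p -> nbhs p (cdom c).
Proof. by move=> cp; have := open_nbhs_nbhs (conj (@cdom_open _ _ P c) cp). Qed.

Lemma overlap_open c c' : open (overlap c c').
Proof.
rewrite openE => x [cx dx]; rewrite /interior.
have H1 := near_cimg cx; have H2 := near_param cx (near_cdom dx).
by apply: filterS2 H1 H2 => y.
Qed.

Lemma transition_img c c' x : overlap c c' x -> cimg c' (transition c c' x).
Proof. by move=> [cx dx]; exact: coord_img. Qed.

Lemma param_transition c c' x : overlap c c' x ->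
  param c' (transition c c' x) = param c x.
Proof. by move=> [cx dx]; exact: coordK. Qed.

Lemma overlap_transition c c' c'' x : overlap c c' x -> overlap c c'' x ->
  overlap c' c'' (transition c c' x).
Proof.
move=> o1 [_ d2]; split; first exact: transition_img.
by rewrite param_transition.
Qed.

Lemma overlap_refl c x : cimg c x -> overlap c c x.
Proof. by move=> cx; split=> //; exact: param_dom. Qed.

Lemma overlap_coord (c c' : chart P) (p : P) : cdom c p -> cdom c' p ->
  overlap c c' (coord c p).
Proof. by move=> cp c'p; split; [exact: coord_img|rewrite coordK]. Qed.

Lemma transition_mx_smooth c c' : mx_smooth_on (overlap c c') (transition c c').
Proof. exact: transition_smooth. Qed.

Lemma transition_differentiable c c' x : overlap c c' x ->
  differentiable (transition c c') x.
Proof. by move=> o; exact: mx_smooth_on_diff (transition_mx_smooth c c') o. Qed.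

Lemma tjacE c c' x i j : overlap c c' x ->
  tjac c c' x i j = partial i (fun y => transition c c' y 0 j) x.
Proof. by move=> o; apply: jacobianE; exact: transition_differentiable. Qed.

#[local] Opaque tjac.

Lemma tjac_smooth c c' : mx_smooth_on (overlap c c') (tjac c c').
Proof.
move=> i j.
have H := smooth_on_partial i (transition_mx_smooth c c' 0 j).
apply: smooth_on_ext H; first exact: overlap_open.
by move=> x o; rewrite tjacE.
Qed.

Lemma tjac_id c x : cimg c x -> tjac c c x = 1%:M.
Proof.
move=> cx; apply/matrixP => i j; rewrite tjacE; last exact: overlap_refl.
rewrite !mxE -(partial_coord i j x); apply: near_eq_partial.
have H := near_cimg cx; apply: filterS H => y cy.
by rewrite /transition paramK.
Qed.

Lemma tjac_chain c c' c'' x : overlap c c' x -> overlap c c'' x ->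
  tjac c c'' x = tjac c c' x *m tjac c' c'' (transition c c' x).
Proof.
move=> o1 o2; have o3 := overlap_transition o1 o2.
apply/matrixP => i j; rewrite tjacE// mxE.
have H : \forall y \near x, overlap c c' y /\ overlap c c'' y.
  by have := open_nbhs_nbhs (conj (openI (@overlap_open c c') (@overlap_open c c'')) (conj o1 o2)); apply: filterS.
have N : {near x, (fun y => transition c c'' y 0 j) =1
    (fun z => transition c' c'' z 0 j) \o transition c c'}.
  apply: filterS H => y [oy1 oy2] /=.
  by rewrite /transition -/(transition c c' y) param_transition.
rewrite (near_eq_partial i N) partial_comp.
- by apply: eq_bigr => k _; congr (_ * _); rewrite (tjacE k j o3).
- exact: transition_differentiable.
- exact: smooth_on_diff (transition_mx_smooth c' c'' 0 j) o3.
Qed.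

Lemma det_tjac_neq0 c c' x : overlap c c' x -> \det (tjac c c' x) != 0.
Proof.
move=> o; have cx : cimg c x by case: o.
have E : \det (tjac c c' x) * \det (tjac c' c (transition c c' x)) = 1.
  by rewrite -det_mulmx -(tjac_chain o (overlap_refl cx)) (tjac_id cx) det1.
have aux (a b : R) : a * b = 1 -> a != 0.
  by move=> ab; apply/eqP => a0; move: ab => /eqP; rewrite a0 mul0r eq_sym oner_eq0.
exact: aux E.
Qed.

Lemma local_rep_transition (f : P -> R) c c' x : overlap c c' x ->
  local_rep f c x = local_rep f c' (transition c c' x).
Proof. by move=> o; rewrite /local_rep param_transition. Qed.

Lemma differentialE (f : P -> R) c x i :
  differential f c x i 0 = partial i (local_rep f c) x.
Proof. by rewrite mxE. Qed.

End Charts.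

(** * The density attached to a bivector and a transverse form *)

Section VolumeForm.
Context {R : realType} {n : nat} {P : manifold R n}.
Variables (pi : components P n n) (nu : components P n 1).
Hypothesis pi_bivector : is_bivector_field pi.
Hypothesis pi_codim1 : foliation_codim pi 1.
Hypothesis nu_form : is_one_form nu.
Hypothesis nu_neq0 : forall c x, cimg c x -> nu c x != 0.
Hypothesis nu_tangent : forall c x, cimg c x ->
  forall v : 'rV[R]_n, (v <= pi c x)%MS -> v *m nu c x = 0.

Lemma pi_nu c x : cimg c x -> pi c x *m nu c x = 0.
Proof.
by move=> cx; apply/row_matrixP => i; rewrite row_mul row0 nu_tangent// row_sub.
Qed.

Let antisym c x (cx : cimg c x) : (pi c x)^T = - pi c x.
Proof. by have [_ + _] := pi_bivector; apply. Qed.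

Let nu_sq c x : R := ((nu c x)^T *m nu c x) 0 0.

Lemma nu_sq_gt0 c x : cimg c x -> 0 < nu_sq c x.
Proof.
move=> cx; rewrite lt0r; apply/andP; split; last first.
  by rewrite /nu_sq mxE sumr_ge0// => i _; rewrite mxE -expr2 sqr_ge0.
apply: contra (nu_neq0 cx); rewrite /nu_sq mxE psumr_eq0; last first.
  by move=> i _; rewrite mxE -expr2 sqr_ge0.
move=> /allP H; apply/eqP/colP => i; rewrite mxE.
have := H i (mem_index_enum _); rewrite /= mxE -expr2 sqrf_eq0.
by move/eqP.
Qed.

(** The factor t in adj(pi) = t nu nu^T, obtained by testing det (pi + z z^T) = t (nu^T z)^2 at z =
    nu. *)
Definition transverse_scale c x : R :=
  \det (pi c x + nu c x *m (nu c x)^T) / nu_sq c x ^+ 2.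

Lemma transverse_scaleE c x (z : 'cV[R]_n) : cimg c x ->
  \det (pi c x + z *m z^T) = transverse_scale c x * ((nu c x)^T *m z) 0 0 ^+ 2.
Proof.
move=> cx; have s0 := nu_sq_gt0 cx; have s0' : nu_sq c x != 0 by rewrite gt_eqF.
have := det_rank1_update z (antisym cx) (pi_nu cx) s0'.
rewrite -/(nu_sq c x) /transverse_scale => E.
by rewrite mulrAC -E mulfK// expf_neq0.
Qed.

Lemma transverse_scale_neq0 c x : cimg c x -> transverse_scale c x != 0.
Proof.
move=> cx; have s0' : nu_sq c x != 0 by rewrite gt_eqF// nu_sq_gt0.
rewrite /transverse_scale mulf_neq0 ?invr_neq0 ?expf_neq0//.
rewrite -unitfE -unitmxE.
exact: unitmx_rank1_update (antisym cx) (pi_nu cx) (pi_codim1 cx) s0'.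
Qed.

(** In the chart [c'] the test vector z = J^T nu pairs with the new [nu] to the old nu^T nu, and
    turns the updated matrix into J^T (pi + nu nu^T) J. *)
Lemma transverse_scale_transition c c' x : overlap c c' x ->
  transverse_scale c' (transition c c' x) =
  \det (tjac c c' x) ^+ 2 * transverse_scale c x.
Proof.
move=> o; have cx : cimg c x by case: o.
have cx' := transition_img o; have s0 := nu_sq_gt0 cx.
set y := transition c c' x; set J := tjac c c' x.
have nuE : nu c x = J *m nu c' y by have [_] := nu_form; apply.
have piE : pi c' y = J^T *m pi c x *m J by have [_ _] := pi_bivector; apply.
have E := transverse_scaleE (J^T *m nu c x) cx'.
have M : pi c' y + (J^T *m nu c x) *m (J^T *m nu c x)^T =
    J^T *m (pi c x + nu c x *m (nu c x)^T) *m J.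
  by rewrite piE mulmxDr mulmxDl trmx_mul trmxK !mulmxA.
have N : (nu c' y)^T *m (J^T *m nu c x) = (nu c x)^T *m nu c x.
  by rewrite mulmxA -trmx_mul -nuE.
rewrite M N !det_mulmx det_tr (transverse_scaleE _ cx) -/(nu_sq c x) in E.
have s0' : nu_sq c x ^+ 2 != 0 by rewrite expf_neq0// gt_eqF.
apply: (mulIf s0'); rewrite -E; ring.
Qed.

Lemma smooth_mx_sumsq D (f : 'rV[R]_n -> 'cV[R]_n) : open D -> mx_smooth_on D f ->
  smooth_on D (fun x => ((f x)^T *m f x) 0 0).
Proof.
move=> oD sf; apply: (smooth_on_ext oD (f := fun x => \sum_i f x i 0 * f x i 0)).
  by move=> x _; rewrite mxE; apply: eq_bigr => i _; rewrite mxE.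
by apply: smooth_on_sum => // i; apply: smooth_onM.
Qed.

Lemma transverse_scale_smooth c : smooth_on (cimg c) (transverse_scale c).
Proof.
have oD := @cimg_open _ _ P c.
have [spi _ _] := pi_bivector; have [snu _] := nu_form.
apply: smooth_onM => //.
  apply: smooth_on_det => // i j.
  apply: (smooth_on_ext oD (f := fun x => pi c x i j + nu c x i 0 * nu c x j 0)).
    by move=> x _; rewrite !mxE big_ord1 mxE.
  by apply: smooth_onD => //; [exact: spi|apply: smooth_onM => //; exact: snu].
apply: smooth_on_inv => //.
  by move=> x cx; rewrite expf_neq0// gt_eqF// nu_sq_gt0.
by apply: smooth_onX => //; apply: smooth_mx_sumsq => //; exact: snu.
Qed.

Lemma smooth_on_norm D (f : 'rV[R]_n -> R) : open D -> (forall x, D x -> f x != 0) ->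
  smooth_on D f -> smooth_on D (fun x => `|f x|).
Proof.
move=> oD f0 sf; apply: (smooth_on_ext oD (f := fun x => Num.sqrt (f x ^+ 2))).
  by move=> x _; rewrite sqrtr_sqr.
apply: smooth_on_sqrt => //; last exact: smooth_onX.
by move=> x Dx; rewrite exprn_even_gt0//= f0.
Qed.

(** In invariant terms |nu /\ omega^k / k!|, where omega is the leafwise symplectic form and n =
    2k+1; in Darboux coordinates with nu = a dz it is |a|. *)
Definition density c x : R := Num.sqrt (`|transverse_scale c x|^-1).

Lemma density_gt0 c x : cimg c x -> 0 < density c x.
Proof. by move=> cx; rewrite sqrtr_gt0 invr_gt0 normr_gt0 transverse_scale_neq0. Qed.

Lemma density_smooth c : smooth_on (cimg c) (density c).
Proof.
have oD := @cimg_open _ _ P c; have t0 := @transverse_scale_neq0 c.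
apply: smooth_on_sqrt => // [x cx|]; first by rewrite invr_gt0 normr_gt0 t0.
apply: smooth_on_inv => // [x cx|]; first by rewrite normr_eq0 t0.
by apply: smooth_on_norm => //; exact: transverse_scale_smooth.
Qed.

Lemma density_transition c c' x : overlap c c' x ->
  density c x = `|\det (tjac c c' x)| * density c' (transition c c' x).
Proof.
move=> o; have J0 := det_tjac_neq0 o.
rewrite /density; set t := transverse_scale c x.
have -> : `|transverse_scale c' (transition c c' x)|^-1 =
    `|\det (tjac c c' x)|^-1 ^+ 2 * `|t|^-1.
  by rewrite (transverse_scale_transition o) normrM invfM normrX exprVn.
rewrite [in RHS]sqrtrM ?sqr_ge0// sqrtr_sqr normfV normr_id mulrA mulfV ?mul1r//.
by rewrite normr_eq0.
Qed.

End VolumeForm.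

(** * Orientability and existence of the modular class *)

Section Paths.
Context {R : realType} {n : nat} {P : manifold R n}.

Lemma manifold_near_path (V : set P) p : open V -> V p ->
  \forall q \near p, path_in (R := R) V p q.
Proof.
move=> oV Vp; have [c cp] := cdom_cover p; pose x := coord c p.
have cx : cimg c x by exact: coord_img.
have pxE : param c x = p by exact: coordK.
pose D := [set y | cimg c y /\ V (param c y)].
have oD : open D.
  rewrite openE => y [cy Vy]; rewrite /interior.
  have H1 := near_cimg cy; have H2 := near_param cy (open_nbhs_nbhs (conj oV Vy)).
  by apply: filterS2 H1 H2 => z.
have Dx : D x by split => //; rewrite pxE.
have [r r0 rD] := near_ball_sub oD Dx.
have N1 := near_cdom cp.
have N2 : \forall q \near p, `|coord c q - x| < r.
  have /cvgrPdist_lt/(_ r r0) := Defs.coord_continuous cp.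
  by apply: filterS => q; rewrite distrC.
apply: filterS2 N1 N2 => q cq qr.
pose d t := x + clamp t *: (coord c q - x).
have Dd t : D (d t).
  apply: rD; rewrite /d addrC addKr normrZ; apply: le_lt_trans qr.
  have /andP[t0 t1] := clamp_itv t.
  by rewrite ger0_norm// ler_piMl.
exists (param c \o d); split=> [t|||t _].
- apply: continuous_comp; last by apply: param_continuous; have [] := Dd t.
  apply: cvgD; first exact: cvg_cst.
  apply: (continuous_comp (f := clamp) (g := fun s : R => s *: (coord c q - x))).
    exact: clamp_cts.
  exact: scalel_continuous.
- by rewrite /d /= clampE ?lexx ?ler01// scale0r addr0.
- by rewrite /d /= clampE ?lexx ?ler01// scale1r addrC subrK coordK.
- by have [] := Dd t.
Qed.

End Paths.

Lemma sign_near (R : realType) (T : topologicalType) (f : T -> R) p :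
  {for p, continuous f} -> f p != 0 -> \forall q \near p, (f q < 0) = (f p < 0).
Proof.
move=> cf; rewrite neq_lt => /orP[fp|fp].
  have : \forall q \near p, f q < 0 := cf _ (lt_nbhsl fp).
  by apply: filterS => q ->; rewrite fp.
have : \forall q \near p, 0 < f q := cf _ (lt_nbhsr fp).
by apply: filterS => q fq; rewrite !ltNge !ltW.
Qed.

Section Orientation.
Context {R : realType} {n : nat} {P : manifold R n}.
Hypothesis P_simply_connected : simply_connected R P.

(** Signs are written additively in ['Z_2] so that they form a cocycle in a [zmodType]; [sgn]
    converts back. *)
Let flip (c c' : chart P) (p : P) : 'Z_2 := (\det (tjac c c' (coord c p)) < 0)%R%:R.

Let sgn (a : 'Z_2) : R := (-1) ^+ a.

Let sgnD a b : sgn (a + b) = sgn a * sgn b.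
Proof. by rewrite /sgn /= -signr_odd modn2 oddb signr_odd exprD. Qed.

Let sgn_flip c c' p : \det (tjac c c' (coord c p)) =
  sgn (flip c c' p) * `|\det (tjac c c' (coord c p))|.
Proof. 
rewrite /sgn /flip; case: ltP => d0.
  by rewrite ltr0_norm// mulN1r opprK.
by rewrite ger0_norm// mul1r.
Qed.

Let flipM (a b : R) : a != 0 -> b != 0 ->
  (a < 0)%R%:R + (b < 0)%R%:R = (a * b < 0)%R%:R :> 'Z_2.
Proof.
case: (ltgtP a 0) => // h1 _; case: (ltgtP b 0) => // h2 _.
- by rewrite ltNge ltW ?nmulr_rgt0//; apply/val_inj.
- by rewrite nmulr_rlt0// h2 addr0.
- by rewrite pmulr_rlt0// h2 add0r.
- by rewrite ltNge ltW ?mulr_gt0// addr0.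
Qed.

(** The sign of [s c p] tells whether the chart [c] is positively oriented at [p]. It is only
    locally constant, since the domain of a chart may be disconnected. *)
Lemma orientation : exists s : chart P -> P -> R,
  [/\ forall c p, cdom c p -> s c p != 0,
      forall c p, cdom c p -> \forall q \near p, s c q = s c p &
      forall c c' p, cdom c p -> cdom c' p ->
        s c p * `|\det (tjac c c' (coord c p))| = \det (tjac c c' (coord c p)) * s c' p].
Proof.
have cocycle i j k p : cdom i p -> cdom j p -> cdom k p ->
    flip i j p + flip j k p = flip i k p.
  move=> ip jp kp.
  have o1 := overlap_coord ip jp; have o2 := overlap_coord ip kp.
  have E : transition i j (coord i p) = coord j p by rewrite /transition coordK.
  have d1 := det_tjac_neq0 o1.
  have d2 := det_tjac_neq0 (overlap_coord jp kp).
  have E3 : \det (tjac i k (coord i p)) =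
      \det (tjac i j (coord i p)) * \det (tjac j k (coord j p)).
    by rewrite (tjac_chain o1 o2) E det_mulmx.
  exact: etrans (flipM d1 d2) (congr1 (fun a : R => (a < 0)%R%:R) (esym E3)).
have const i j p : cdom i p -> cdom j p -> \forall q \near p, flip i j q = flip i j p.
  move=> ip jp; have o := overlap_coord ip jp.
  have cf : {for p, continuous (fun q => \det (tjac i j (coord i q)))}.
    apply: (continuous_comp (f := coord i) (g := fun x => \det (tjac i j x))).
      exact: Defs.coord_continuous.
    apply: smooth_on_cts (smooth_on_det (@overlap_open _ _ _ i j) (@tjac_smooth _ _ _ i j)) _.
    exact: o.
  by have := sign_near cf (det_tjac_neq0 o); apply: filterS => q Eq; exact: (congr1 (fun b : bool => b%:R : 'Z_2) Eq).
have [a [aE aC]] := cocycle_trivial (@cdom_open _ _ P) (@cdom_cover _ _ P) cocycle const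
  (fun i p => manifold_near_path (@cdom_open _ _ P i)) P_simply_connected.
exists (fun c p => sgn (a c p)); split=> [c p cp|c p cp|c c' p cp c'p].
- by rewrite signr_eq0.
- by have := aC c p cp; apply: filterS => q ->.
have -> : a c p = flip c c' p + a c' p by rewrite -(aE c c' p cp c'p) subrK.
by rewrite sgnD [in RHS]sgn_flip; ring.
Qed.

Lemma volume_form_exists (pi : components P n n) (nu : components P n 1) :
  is_bivector_field pi -> foliation_codim pi 1 -> is_one_form nu ->
  (forall c x, cimg c x -> nu c x != 0) ->
  (forall c x, cimg c x -> forall v : 'rV[R]_n, (v <= pi c x)%MS -> v *m nu c x = 0) ->
  exists mu : chart P -> 'rV[R]_n -> R, is_volume_form mu.
Proof.
move=> bpi cpi fnu nu0 tnu; have [s [s0 sC sE]] := orientation.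
exists (fun c x => s c (param c x) * density pi nu c x); split.
- move=> c k; apply: Ck_on_local => x cx.
  have N := near_param cx (sC c _ (param_dom cx)).
  have N' := near_cimg cx.
  (* Smoothness is checked on an open set where the sign is frozen at its value at [x]. *)
  pose E := [set y | cimg c y /\ s c (param c y) = s c (param c x)]^°.
  have oE : open E by exact: open_interior.
  exists E; first by rewrite /E /interior; apply: filterS2 N' N.
  apply: (Ck_on_ext oE (f := fun y => s c (param c x) * density pi nu c y)).
    by move=> y /interior_subset[_ ->].
  apply: Ck_onM => //; first exact: Ck_on_cst.
  apply: Ck_on_sub (density_smooth bpi cpi fnu nu0 tnu c k).
  by move=> y /interior_subset[].
- move=> c x cx; rewrite mulf_neq0//; first exact/s0/param_dom.
  by rewrite gt_eqF// (density_gt0 bpi cpi nu0 tnu).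
- move=> c c' x o; have [cx dx] := o.
  rewrite (density_transition bpi fnu nu0 tnu o) param_transition// mulrA.
  have := sE c c' (param c x) (param_dom cx) dx.
  by rewrite paramK// => ->; rewrite mulrA.
Qed.

End Orientation.

(** * The modular vector field in coordinates *)

Section ModularField.
Context {R : realType} {n : nat} {P : manifold R n}.
Variables (pi : components P n n) (mu : chart P -> 'rV[R]_n -> R).
Hypothesis pi_bivector : is_bivector_field pi.
Hypothesis mu_volume : is_volume_form mu.

Let spi c : mx_smooth_on (cimg c) (pi c).
Proof. by have [+ _ _] := pi_bivector; apply. Qed.
Let smu c : smooth_on (cimg c) (mu c).
Proof. by have [+ _ _] := mu_volume; apply. Qed.
Let antisym c x (cx : cimg c x) : (pi c x)^T = - pi c x.
Proof. by have [_ + _] := pi_bivector; apply. Qed.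

Lemma lie_volume_hamiltonian (f : P -> R) c x : smooth_fun f -> cimg c x ->
  lie_volume (sharp pi (differential f)) mu c x =
  \sum_i partial i (local_rep f c) x *
    \sum_j partial j (fun y => mu c y * pi c y i j) x.
Proof.
move=> sf cx; rewrite /lie_volume.
have E y j : sharp pi (differential f) c y 0 j =
    \sum_i partial i (local_rep f c) y * pi c y i j.
  by rewrite /sharp mxE; apply: eq_bigr => i _; rewrite !mxE.
rewrite -(divergence_hamiltonian (@cimg_open _ _ P c) cx (sf c) (smu c) (spi c) (@antisym c)).
congr (_ + _ * _); apply: eq_bigr => j _; first by rewrite E.
by congr (partial j _ x); apply/funext => y; rewrite E.
Qed.

Definition modular_components : components P 1 n := fun c x =>
  \row_i ((mu c x)^-1 * \sum_j partial j (fun y => mu c y * pi c y i j) x).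

Lemma modular_components_field : is_modular_field pi mu modular_components.
Proof.
have mu0 c x : cimg c x -> mu c x != 0 by have [_ + _] := mu_volume; apply.
split; last first.
  move=> f sf c x cx; rewrite lie_volume_hamiltonian// /vf_apply mxE mulr_suml.
  apply: eq_bigr => i _.
  by rewrite !mxE mulrAC [X in _ = X * _]mulrAC mulVf ?mu0// mul1r mulrC.
split.
  move=> c i j; rewrite [i]ord1.
  apply: (smooth_on_ext (@cimg_open _ _ P c) (f := fun x => (mu c x)^-1 *
     \sum_k partial k (fun y => mu c y * pi c y j k) x)).
    by move=> x _; rewrite mxE.
  have oD := @cimg_open _ _ P c.
  apply: smooth_onM => //; first by apply: smooth_on_inv => //; exact: mu0.
  by apply: smooth_on_sum => // k; apply: smooth_on_partial; apply: smooth_onM => //; exact: spi.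
move=> c c' x o; apply/rowP => a.
have [_ _ muE] := mu_volume; have [_ _ piE] := pi_bivector.
have [cx _] := o; have J0 := det_tjac_neq0 o.
have T := modular_components_transform a (@overlap_open _ _ _ c c') (@cimg_open _ _ P c') o
  (transition_mx_smooth c c') (@transition_img _ _ _ c c') (fun y i j oy => tjacE i j oy) J0
  (smooth_on_sub (fun y (oy : overlap c c' y) => proj1 oy) (smu c)) (smu c')
  (fun i j => smooth_on_sub (fun y (oy : overlap c c' y) => proj1 oy) (spi c i j)) (spi c')
  (fun y oy => antisym (proj1 oy)) (fun y oy => muE c c' y oy) (fun y oy => piE c c' y oy).
rewrite !mxE.
transitivity ((mu c x)^-1 * (\det (tjac c c' x) *
    \sum_b partial b (fun y => mu c' y * pi c' y a b) (transition c c' x))).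
  by rewrite (muE c c' x o) invfM mulrACA mulVf// mul1r.
rewrite -T mulr_sumr; apply: eq_bigr => i _.
by rewrite [modular_components c x 0 i]mxE mulrA.
Qed.

End ModularField.

(** * Bump functions *)

Section BumpFunctions.
Context {R : realType} {n : nat} {P : manifold R n}.

(** The profile is composed with r^2 minus the squared Euclidean distance to a centre shifted from
    [x0] by r/2 along e_i. At a centred bump the differential would be 0; with the shift the
    gradient at [x0] is a nonzero multiple of e_i. *)
Lemma local_bump (D : set 'rV[R]_n) (x0 : 'rV[R]_n) (i : 'I_n) :
  open D -> D x0 -> exists (b : 'rV[R]_n -> R) (K : set 'rV[R]_n) (k : R),
    [/\ smooth_on setT b, compact K, K `<=` D, forall x, ~ K x -> b x = 0 &
        k != 0 /\ forall j, partial j b x0 = k * (j == i)%:R].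
Proof.
move=> oD Dx0; have [e e0 eD] := near_ball_sub oD Dx0.
pose r := e / 4; have r0 : 0 < r by rewrite divr_gt0.
pose a : 'rV[R]_n := x0 + (r / 2) *: delta_mx 0 i.
pose g (x : 'rV[R]_n) := r ^+ 2 - \sum_j (x 0 j - a 0 j) ^+ 2.
have oT : open [set: 'rV[R]_n] := openT.
have sxa j : smooth_on setT (fun x : 'rV[R]_n => x 0 j - a 0 j).
  by apply: smooth_onD => //; [exact: smooth_on_coord|exact: smooth_on_cst].
have sg : smooth_on setT g.
  apply: smooth_onD => //; first exact: smooth_on_cst.
  by apply: smooth_onN => //; apply: smooth_on_sum => // j; exact: smooth_onX.
have x0a j : x0 0 j - a 0 j = - (r / 2) * (j == i)%:R.
  by rewrite /a !mxE eqxx /= eq_sym opprD addrA subrr add0r mulNr.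
have gx0 : g x0 = r ^+ 2 * (3 / 4).
  rewrite /g (bigD1 i)//= x0a eqxx big1 => [|j ji]; last first.
    by rewrite x0a (negbTE ji) mulr0 expr0n.
  by rewrite mulr1 addr0 sqrrN; field.
have gx00 : 0 < g x0 by rewrite gx0 mulr_gt0 ?exprn_gt0.
exists (fun x => bump_profile 1 (g x)), [set x | `|x - x0| <= 2 * r],
  (bump_profile ('X^2 * (1 - 1^`())) (g x0) * r); split.
- exact: smooth_on_bump_profile.
- apply: bounded_closed_compact.
    exists (`|x0| + 2 * r); split; first exact: num_real.
    move=> M hM x /= xr; apply/ltW/(le_lt_trans _ hM).
    by rewrite -[x](subrK x0) addrC (le_trans (ler_normD _ _))// lerD2l.
  have cf : continuous (fun x : 'rV[R]_n => `|x - x0|).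
    move=> x; apply: (continuous_comp (f := fun x : 'rV[R]_n => x - x0)).
      exact: (differentiable_continuous (differentiableB (@ex_diff _ _ _ _ _ _ _ (is_diff_id x)) (differentiable_cst x0 x))).
    exact: norm_continuous.
  exact: (continuous_closedP _).1 cf _ (@closed_le R (2 * r)).
- move=> x /= xr; apply: eD; apply: le_lt_trans xr _.
  by rewrite /r mulrCA gtr_pMr//; lra.
- move=> x /negP; rewrite -ltNge => xr; rewrite /bump_profile ifF//.
  apply/negP => gx; have {xr} := xr; apply/negP; rewrite -leNgt.
  have xa : `|x - a| <= r.
    rewrite [leLHS]mx_normrE; apply: bigmax_le => [|[k j] _]; first exact: ltW.
    have xaE : (x - a) 0 j = x 0 j - a 0 j by rewrite mxE [X in _ + X]mxE.
    rewrite /= [k]ord1 xaE -(@ler_pXn2r _ 2) ?nnegrE ?(ltW r0)//.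
    rewrite real_normK ?num_real//.
    have := ltW gx; rewrite /g subr_ge0 => H; apply: le_trans H.
    by rewrite (bigD1 j)//= lerDl sumr_ge0// => l _; rewrite sqr_ge0.
  have ax : `|a - x0| <= r.
    rewrite /a addrC addKr [leLHS]mx_normrE; apply: bigmax_le => [|[k j] _]; first exact: ltW.
    rewrite /= !mxE normrM ger0_norm ?divr_ge0 ?ltW//.
    by case: (_ && _); rewrite ?normr1 ?normr0; lra.
  rewrite -(subrKA a) (le_trans (ler_normD _ _))// mulrDl mul1r.
  exact: lerD.
split.
  rewrite /bump_profile gx00 mulf_neq0 ?(gt_eqF r0)//.
  rewrite derivC subr0 mulr1 hornerXn mulf_neq0 ?expf_neq0 ?invr_neq0 ?gt_eqF// expR_gt0.
  by [].
move=> j; have dg : differentiable g x0 by exact: smooth_on_diff sg _.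
rewrite (partial_comp1 j dg (is_derive_bump_profile 1 (g x0))) -mulrA; congr (_ * _).
rewrite /g (partialD j (f := fun=> r ^+ 2) (g := fun x => - \sum_j (x 0 j - a 0 j) ^+ 2)); first last.
- have H : smooth_on setT (fun x : 'rV[R]_n => - \sum_j (x 0 j - a 0 j) ^+ 2).
    by apply: smooth_onN => //; apply: smooth_on_sum => // k; exact: smooth_onX.
  exact: smooth_on_diff H _.
- exact: differentiable_cst.
rewrite partial_cst add0r partialN; last first.
  have H : smooth_on setT (fun x : 'rV[R]_n => \sum_j (x 0 j - a 0 j) ^+ 2).
    by apply: smooth_on_sum => // k; exact: smooth_onX.
  exact: smooth_on_diff H _.
have sxa2 k : smooth_on setT (fun x : 'rV[R]_n => (x 0 k - a 0 k) ^+ 2) by exact: smooth_onX.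
rewrite (partial_sum _ _ sxa2)//.
have D1 k : partial j (fun x : 'rV[R]_n => x 0 k - a 0 k) x0 = (j == k)%:R.
  rewrite (partialD j (f := fun x : 'rV[R]_n => x 0 k) (g := fun=> - a 0 k)).
  - by rewrite partial_cst addr0 partial_coord.
  - exact: differentiable_coord.
  - exact: differentiable_cst.
under eq_bigr => k _ do rewrite (smooth_partialM j (sxa k) (sxa k))// D1 x0a.
rewrite (bigD1 j)//= big1 => [|k kj]; last by rewrite [j == k]eq_sym (negbTE kj) !mulr0 addr0.
rewrite eqxx !mulr1 addr0; lra.
Qed.

(** Extension by zero is smooth because the support lies in the image of a compact set, which is
    closed as the manifold is Hausdorff. The function serves as a global substitute for the
    coordinate x_i at one point. *)
Lemma bump_function (c : chart P) x0 (i : 'I_n) : cimg c x0 ->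
  exists (f : P -> R) (k : R), [/\ smooth_fun f, k != 0 &
    forall j, partial j (local_rep f c) x0 = k * (j == i)%:R].
Proof.
move=> cx0.
have [b [K [k [sb cK KD bK [k0 bE]]]]] := local_bump i (@cimg_open _ _ P c) cx0.
pose f p : R := if pselect (cdom c p) then b (coord c p) else 0.
have fE p : cdom c p -> f p = b (coord c p) by rewrite /f; case: pselect.
exists f, k; split => //; last first.
  move=> j; rewrite -bE; apply: near_eq_partial.
  have H := near_cimg cx0; apply: filterS H => y cy.
  by rewrite /local_rep fE ?paramK//; exact: param_dom.
move=> c' l; apply: Ck_on_local => y c'y.
have [cp|ncp] := pselect (cdom c (param c' y)).
  exists (overlap c' c) => //.
  apply: (Ck_on_ext (@overlap_open _ _ _ c' c) (f := b \o transition c' c)).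
    by move=> z [_ cz]; rewrite /local_rep fE.
  exact: (smooth_on_comp (@overlap_open _ _ _ c' c) (@transition_mx_smooth _ _ _ c' c)
    (fun x _ => I : setT (transition c' c x)) sb).
pose KP : set P := param c @` K.
have clKP : closed KP.
  apply: compact_closed; first exact: hausdorff_points.
  apply: continuous_compact => //.
  apply: continuous_in_subspaceT => z; rewrite inE => Kz.
  by apply: param_continuous; exact: KD.
have oKP : open (~` KP) by rewrite openC.
pose E := [set z | cimg c' z /\ (~` KP) (param c' z)].
have oE : open E.
  rewrite openE => z [cz Kz]; rewrite /interior.
  have H1 := near_cimg cz; have H2 := near_param cz (open_nbhs_nbhs (conj oKP Kz)).
  by apply: filterS2 H1 H2 => u.
exists E.
  split=> // -[z Kz zE]; apply: ncp; rewrite -zE; exact/param_dom/KD.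
apply: (Ck_on_ext oE _ (Ck_on_cst l 0 oE)) => z [cz Kz].
rewrite /local_rep /f; case: pselect => // cpz.
rewrite bK// => Kc; apply: Kz; exists (coord c (param c' z)) => //.
exact: coordK.
Qed.

End BumpFunctions.

(** * Closed one-forms on simply connected manifolds *)


Section ClosedForms.
Context {R : realType} {n : nat} {P : manifold R n}.
Variable W : components P n 1.
Hypothesis W_form : is_one_form W.
Hypothesis W_closed : forall c x i j, cimg c x ->
  partial i (fun y => W c y j 0) x = partial j (fun y => W c y i 0) x.

Definition primitive_at (h : P -> R) (p : P) : Prop := forall c, cdom c p ->
  differentiable (local_rep h c) (coord c p) /\
  forall i, partial i (local_rep h c) (coord c p) = W c (coord c p) i 0.

Lemma primitive_at_chart (h : P -> R) p c : cdom c p ->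
  differentiable (local_rep h c) (coord c p) ->
  (forall i, partial i (local_rep h c) (coord c p) = W c (coord c p) i 0) ->
  primitive_at h p.
Proof.
move=> cp dh ph c' c'p; have o := overlap_coord c'p cp.
have E : transition c' c (coord c' p) = coord c p by rewrite /transition coordK.
have N : {near coord c' p, local_rep h c \o transition c' c =1 local_rep h c'}.
  apply: (eq_on_near (@overlap_open _ _ _ c' c) _ o) => y oy /=.
  by rewrite -local_rep_transition.
have dT := transition_differentiable o.
have dh' : differentiable (local_rep h c) (transition c' c (coord c' p)) by rewrite E.
split.
  by apply: (near_eq_differentiable N); exact: differentiable_comp.
move=> i; rewrite -(near_eq_partial i N) partial_comp// E.
have [_ WE] := W_form; rewrite (WE c' c _ o) E mxE.
by apply: eq_bigr => j _; rewrite ph.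
Qed.

Lemma local_primitive p : exists U h,
  [/\ open U, U p & forall q, U q -> primitive_at h q].
Proof.
have [c cp] := cdom_cover p; pose x := coord c p.
have cx : cimg c x by exact: coord_img.
have [sW _] := W_form.
have [r r0 [h hP]] := @closed_form_locally_exact _ _ (cimg c) (fun i y => W c y i 0) x
  (@cimg_open _ _ P c) cx (fun i => sW c i 0) (fun y i j cy => W_closed i j cy).
pose U := [set q | cdom c q /\ `|coord c q - x| < r].
exists U, (fun q => h (coord c q)); split.
- rewrite openE => q [cq qr]; rewrite /interior.
  have N1 := near_cdom cq.
  have N2 : \forall u \near q, `|coord c u - x| < r.
    have cc : {for q, continuous (fun u => `|coord c u - x|)}.
      apply: (continuous_comp (f := coord c) (g := fun y => `|y - x|)).
        exact: Defs.coord_continuous.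
      apply: (continuous_comp (f := fun y : 'rV[R]_n => y - x)).
        exact: (differentiable_continuous (differentiableB (@ex_diff _ _ _ _ _ _ _
          (is_diff_id (coord c q))) (differentiable_cst x (coord c q)))).
      exact: norm_continuous.
    exact: (cc _ (lt_nbhsl qr)).
  by apply: filterS2 N1 N2 => u.
- by split=> //; rewrite subrr normr0.
move=> q [cq qr]; have [cy [dh vh]] := hP _ qr.
have N : {near coord c q, h =1 local_rep (fun q => h (coord c q)) c}.
  have H := near_cimg cy; apply: filterS H => y cy'.
  by rewrite /local_rep paramK.
apply: (primitive_at_chart cq); first exact: near_eq_differentiable N dh.
move=> i; rewrite -(near_eq_partial i N) /partial deriveE// vh.
rewrite (bigD1 i)//= mxE !eqxx mul1r big1 ?addr0// => j ji.
by rewrite mxE eqxx /= (negbTE ji) mul0r.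
Qed.

Lemma primitive_diff_const (h k : P -> R) p : primitive_at h p -> primitive_at k p ->
  (\forall q \near p, primitive_at h q) -> (\forall q \near p, primitive_at k q) ->
  \forall q \near p, h q - k q = h p - k p.
Proof.
move=> hp kp nh nk; have [c cp] := cdom_cover p; pose x := coord c p.
have cx : cimg c x by exact: coord_img.
have pxE : param c x = p by exact: coordK.
have N1 : \forall y \near x, cimg c y := near_cimg cx.
have N2 : \forall y \near x, primitive_at h (param c y) by apply: near_param; rewrite ?pxE.
have N3 : \forall y \near x, primitive_at k (param c y) by apply: near_param; rewrite ?pxE.
pose d y := local_rep h c y - local_rep k c y.
have : nbhs x [set y | differentiable d y /\ forall i, partial i d y = 0].
  apply: filterS3 N1 N2 N3 => y cy hy ky.
  have cpy := param_dom cy.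
  have [h1 h2] := hy c cpy; have [k1 k2] := ky c cpy.
  rewrite paramK// in h1 h2 k1 k2.
  split; first exact: differentiableB.
  move=> i; rewrite /d (partialD i (f := local_rep h c) (g := fun y => - local_rep k c y))//.
    by rewrite partialN// h2 k2 subrr.
  exact: differentiableN.
move/nbhs_ballP => [r r0 Hr].
have M1 := near_cdom cp.
have M2 : \forall q \near p, `|coord c q - x| < r.
  have /cvgrPdist_lt/(_ r r0) := Defs.coord_continuous cp.
  by apply: filterS => q; rewrite distrC.
apply: filterS2 M1 M2 => q cq qr.
have inB s : 0 <= s <= 1 -> ball x r (x + s *: (coord c q - x)).
  move=> /andP[s0 s1]; rewrite -ball_normE /= opprD addrA subrr add0r normrN normrZ.
  by rewrite ger0_norm//; apply: le_lt_trans qr; rewrite ler_piMl.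
have [s s01] := MVT_line ltr01 (fun s hs => proj1 (Hr _ (inB s hs))).
have [dd pd] := Hr _ (inB s s01).
rewrite (derive_partial _ dd) mul1r scale1r [x + (_ - _)]addrC subrK.
rewrite [X in _ = X]big1 => [|i _]; last by rewrite pd mulr0.
move=> /eqP; rewrite subr_eq0 => /eqP.
by rewrite /d /local_rep coordK// pxE.
Qed.

(** Differences of local primitives form a locally constant cocycle in the additive group [R].
    Trivialising it corrects the primitives until they agree; the cover is indexed by the points, so
    the global primitive at [p] uses the local one of index [p]. *)
Lemma closed_form_exact : simply_connected R P -> exists h : P -> R, forall p, primitive_at h p.
Proof.
move=> sc.
have [U UP] := choice local_primitive; have [h hP] := choice UP.
have oU p : open (U p) by have [] := hP p.
have Up p : U p p by have [] := hP p.
have prim p q : U p q -> primitive_at (h p) q by have [_ _] := hP p; apply.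
have nprim p q : U p q -> \forall u \near q, primitive_at (h p) u.
  move=> Uq; have := open_nbhs_nbhs (conj (oU p) Uq).
  by apply: filterS => u; exact: prim.
have cov p : exists i, U i p by exists p.
have coc i j k p : U i p -> U j p -> U k p ->
    (h i p - h j p) + (h j p - h k p) = h i p - h k p.
  by move=> _ _ _; rewrite addrA subrK.
have cst i j p : U i p -> U j p -> \forall q \near p, h i q - h j q = h i p - h j p.
  by move=> Ui Uj; apply: primitive_diff_const; [exact: prim|exact: prim|exact: nprim|exact: nprim].
have [a [aE aC]] := cocycle_trivial (G := R) oU cov (g := fun i j p => h i p - h j p) coc cst
  (fun i p => manifold_near_path (oU i)) sc.
exists (fun p => h p p - a p p) => p.
have N : \forall q \near p, h p q - a p p = h q q - a q q.
  have N1 : \forall q \near p, U p q by exact: (open_nbhs_nbhs (conj (oU p) (Up p))).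
  have N2 := aC p p (Up p).
  apply: filterS2 N1 N2 => q Uq <-.
  have := aE p q q Uq (Up q) => E.
  have -> : h p q = a p q - a q q + h q q by rewrite E subrK.
  by rewrite addrC addrA addrA addNr add0r addrC.
move=> c cp; have cx := coord_img cp.
have N' : {near coord c p, (fun y => local_rep (h p) c y - a p p) =1
    local_rep (fun p => h p p - a p p) c}.
  have pN : nbhs (param c (coord c p)) [set q | h p q - a p p = h q q - a q q].
    by rewrite coordK.
  by have := near_param cx pN; apply: filterS.
have [d1 d2] := prim p p (Up p) c cp.
have dc : differentiable (fun y => local_rep (h p) c y - a p p) (coord c p).
  by apply: differentiableB => //; exact: differentiable_cst.
split; first exact: near_eq_differentiable N' dc.
move=> i; rewrite -(near_eq_partial i N').
rewrite (partialD i (f := local_rep (h p) c) (g := fun=> - a p p))//.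
by rewrite partial_cst addr0 d2.
Qed.

Lemma primitive_critical_point (h : P -> R) : compact [set: P] -> (exists p : P, True) ->
  (forall p, primitive_at h p) -> exists c x, cimg c x /\ W c x = 0.
Proof.
move=> cP [p0 _] hP.
have ch : continuous h.
  move=> p; have [c cp] := cdom_cover p; have [dh _] := hP p c cp.
  have cc : {for p, continuous (local_rep h c \o coord c)}.
    by apply: continuous_comp; [exact: Defs.coord_continuous|exact: differentiable_continuous].
  have N : {near p, local_rep h c \o coord c =1 h}.
    by have := near_cdom cp; apply: filterS => q cq /=; rewrite /local_rep coordK.
  exact: near_eq_continuous N cc.
have [|p _ pmax] := compact_EVT_max _ cP (continuous_subspaceT ch); first by exists p0.
have [c cp] := cdom_cover p; pose x := coord c p.
have cx : cimg c x by exact: coord_img.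
exists c, x; split=> //; apply/colP => i; rewrite mxE.
have [dh <-] := hP p c cp.
have [r r0 rD] := near_ball_sub (@cimg_open _ _ P c) cx.
pose e : 'rV[R]_n := delta_mx 0 i.
pose d := r / (`|e| + 1).
have e1 : 0 < `|e| + 1 by rewrite ltr_wpDl.
have d0 : 0 < d by rewrite divr_gt0.
have inD t : t \in `](- d), d[%R -> cimg c (x + t *: e).
  rewrite in_itv /= => td; apply: rD; rewrite addrC addKr normrZ.
  have td' : `|t| < d by rewrite ltr_norml.
  apply: (@le_lt_trans _ _ (`|t| * (`|e| + 1))); first by rewrite ler_wpM2l// lerDl.
  by rewrite -ltr_pdivlMr.
have dl t : t \in `](- d), d[%R ->
    is_derive t 1 (fun s => local_rep h c (x + s *: e)) ('D_e (local_rep h c) (x + t *: e)).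
  move=> td; apply: derive_line; have cy := inD t td.
  by have [] := hP _ c (param_dom cy); rewrite paramK.
have z0 : 0 \in `](- d), d[%R by rewrite in_itv /= oppr_lt0 d0.
have dd : - d <= d by rewrite ge0_cp// ltW.
have dF t (td : t \in `](- d), d[%R) : derivable (fun s : R => local_rep h c (x + s *: e)) t 1.
  by have [] := dl t td.
have mF t : t \in `](- d), d[%R -> local_rep h c (x + t *: e) <= local_rep h c (x + 0 *: e).
  move=> _; rewrite scale0r addr0 /local_rep [param c x]coordK//; apply: pmax.
  by rewrite inE.
have [_ D0] := derive1_at_max dd dF z0 mF.
by have [_] := dl 0 z0; rewrite D0 scale0r addr0.
Qed.

End ClosedForms.

(** * Poisson manifolds with vanishing modular class *)

Section VanishingModularClass.
Context {R : realType} {n : nat} {P : manifold R n}.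
Variables (pi : components P n n) (nu : components P n 1).
Variables (mu : chart P -> 'rV[R]_n -> R) (phi : components P 1 n) (f : P -> R).
Hypothesis pi_poisson : is_poisson pi.
Hypothesis pi_codim1 : foliation_codim pi 1.
Hypothesis nu_form : is_one_form nu.
Hypothesis nu_neq0 : forall c x, cimg c x -> nu c x != 0.
Hypothesis nu_tangent : forall c x, cimg c x ->
  forall v : 'rV[R]_n, (v <= pi c x)%MS -> v *m nu c x = 0.
Hypothesis mu_volume : is_volume_form mu.
Hypothesis phi_modular : is_modular_field pi mu phi.
Hypothesis f_smooth : smooth_fun f.
Hypothesis phi_hamiltonian : forall c x, cimg c x ->
  - phi c x = sharp pi (differential f) c x.

Let pi_bivector : is_bivector_field pi. Proof. by case: pi_poisson. Qed.
Let spi c : mx_smooth_on (cimg c) (pi c).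
Proof. by have [+ _ _] := pi_bivector; apply. Qed.
Let smu c : smooth_on (cimg c) (mu c).
Proof. by have [+ _ _] := mu_volume; apply. Qed.
Let antisym c x (cx : cimg c x) : (pi c x)^T = - pi c x.
Proof. by have [_ + _] := pi_bivector; apply. Qed.
Let oimg c : open (cimg c : set 'rV[R]_n) := @cimg_open _ _ P c.

(** The characterisation of [phi] is tested on a global function whose differential at [x] is a
    nonzero multiple of dx_i. *)
Lemma modular_field_coordinates c x i : cimg c x ->
  \sum_j partial j (fun y => mu c y * pi c y i j) x = phi c x 0 i * mu c x.
Proof.
move=> cx; have [g [k [sg k0 gE]]] := bump_function i cx.
have [_ H] := phi_modular.
pose S l := \sum_j partial j (fun y => mu c y * pi c y l j) x.
have SE : \sum_l partial l (local_rep g c) x * S l = k * S i.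
  rewrite (bigD1 i)//= gE eqxx mulr1 big1 ?addr0// => l li.
  by rewrite gE (negbTE li) mulr0 mul0r.
have phiE : vf_apply phi g c x = phi c x 0 i * k.
  rewrite /vf_apply mxE (bigD1 i)//= differentialE gE eqxx mulr1 big1 ?addr0// => l li.
  by rewrite differentialE gE (negbTE li) !mulr0.
apply: (mulfI k0); rewrite -/(S i) -SE mulrA [k * _]mulrC -phiE -(H g sg c x cx).
by rewrite (lie_volume_hamiltonian pi_bivector mu_volume sg cx).
Qed.

(** Multiplying the volume form by g > 0 changes the modular field by - pi(d log g). With g = e^(-f)
    it becomes phi + pi(df) = 0. *)
Definition rescaled_volume c x : R := mu c x * expR (- local_rep f c x).

Lemma rescaled_volume_smooth c : smooth_on (cimg c) (rescaled_volume c).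
Proof.
by apply: smooth_onM => //; apply: smooth_on_expR => //; apply: smooth_onN => //; exact: f_smooth.
Qed.

Lemma rescaled_volume_neq0 c x : cimg c x -> rescaled_volume c x != 0.
Proof.
move=> cx; rewrite mulf_neq0 ?(gt_eqF (expR_gt0 _))//.
by have [_ + _] := mu_volume; apply.
Qed.

Lemma rescaled_volume_divergence c x i : cimg c x ->
  \sum_j partial j (fun y => rescaled_volume c y * pi c y i j) x = 0.
Proof.
move=> cx; have sf := f_smooth c.
have sN : smooth_on (cimg c) (fun y => - local_rep f c y) by exact: smooth_onN.
have sE : smooth_on (cimg c) (fun y => expR (- local_rep f c y)) by exact: smooth_on_expR.
have smp j : smooth_on (cimg c) (fun y => mu c y * pi c y i j).
  by apply: smooth_onM => //; exact: spi.
pose E := expR (- local_rep f c x).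
have dE j : partial j (fun y => expR (- local_rep f c y)) x = - E * partial j (local_rep f c) x.
  have dN := smooth_on_diff sN cx.
  rewrite (partial_comp1 j dN (is_derive_expR _)) partialN; last exact: smooth_on_diff sf cx.
  by rewrite mulrN mulNr.
transitivity (\sum_j (E * partial j (fun y => mu c y * pi c y i j) x -
    mu c x * E * (pi c x i j * partial j (local_rep f c) x))).
  apply: eq_bigr => j _.
  have -> : (fun y => rescaled_volume c y * pi c y i j) =
      (fun y => expR (- local_rep f c y) * (mu c y * pi c y i j)).
    by apply/funext => y; rewrite /rescaled_volume mulrAC mulrC.
  by rewrite (smooth_partialM j sE (smp j) cx) dE -/E; ring.
rewrite sumrB -!mulr_sumr modular_field_coordinates//.
have : - phi c x 0 i = - \sum_j pi c x i j * partial j (local_rep f c) x.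
  have := congr1 (fun M : 'rV[R]_n => M 0 i) (phi_hamiltonian cx).
  rewrite [LHS]mxE => ->; rewrite /sharp mxE -sumrN; apply: eq_bigr => j _.
  have := congr1 (fun M : 'M[R]_n => M i j) (antisym cx); rewrite !mxE => ->.
  by rewrite mulrN mulrC.
by move/oppr_inj => ->; ring.
Qed.

(** A quotient of two densities is a function, and scaling [nu] by a positive function scales its
    density by the same function. This factor makes the density attached to [pi] and the new form
    equal to |rho|, with rho the rescaled volume. *)
Definition transverse_form : components P n 1 := fun c x =>
  (`|rescaled_volume c x| / density pi nu c x) *: nu c x.

Let dens_gt0 c x (cx : cimg c x) : 0 < density pi nu c x.
Proof. exact: density_gt0 pi_bivector pi_codim1 nu_neq0 nu_tangent _ _ cx. Qed.

Lemma transverse_form_neq0 c x : cimg c x -> transverse_form c x != 0.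
Proof.
move=> cx; rewrite scaler_eq0 negb_or nu_neq0// andbT.
by rewrite mulf_neq0// ?normr_eq0 ?rescaled_volume_neq0// invr_neq0// gt_eqF// dens_gt0.
Qed.

Lemma transverse_form_smooth c : mx_smooth_on (cimg c) (transverse_form c).
Proof.
move=> i j; have [snu _] := nu_form.
apply: (smooth_on_ext (@oimg c) (f := fun x => `|rescaled_volume c x| / density pi nu c x * nu c x i j)).
  by move=> x _; rewrite mxE.
apply: smooth_onM => //; last exact: snu.
apply: smooth_onM => //.
  by apply: smooth_on_norm => //; [exact: rescaled_volume_neq0|exact: rescaled_volume_smooth].
apply: smooth_on_inv => //; first by move=> x cx; rewrite gt_eqF// dens_gt0.
exact: density_smooth.
Qed.

Lemma transverse_form_is_form : is_one_form transverse_form.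
Proof.
split=> [c|c c' x o]; first exact: transverse_form_smooth.
have [cx _] := o; have [_ nuE] := nu_form; have [_ _ muE] := mu_volume.
have J0 : `|\det (tjac c c' x)| != 0 by rewrite normr_eq0 det_tjac_neq0.
have E : `|rescaled_volume c x| / density pi nu c x =
    `|rescaled_volume c' (transition c c' x)| / density pi nu c' (transition c c' x).
  rewrite /rescaled_volume (density_transition pi_bivector nu_form nu_neq0 nu_tangent o).
  rewrite (muE c c' x o) (local_rep_transition f o) -mulrA [in LHS]normrM.
  by rewrite -mulf_div mulfV// mul1r.
by rewrite /transverse_form E (nuE c c' x o) scalemxAr.
Qed.

Lemma transverse_form_d0 c x i j : cimg c x ->
  partial i (fun y => transverse_form c y j 0) x = partial j (fun y => transverse_form c y i 0) x.
Proof.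
move=> cx; have [_ jac] := pi_poisson.
apply: (transverse_form_closed (@oimg c) cx (spi c) (@rescaled_volume_smooth c)
  (@transverse_form_smooth c) (@antisym c) (jac c x cx)).
- move=> y cy; rewrite -scalemxAr.
  by rewrite (pi_nu nu_tangent cy) scaler0.
- exact: transverse_form_neq0.
- exact: pi_codim1.
- by move=> a; exact: rescaled_volume_divergence.
move=> Z y cy; rewrite (transverse_scaleE pi_bivector nu_neq0 nu_tangent Z cy).
set t := transverse_scale pi nu c y.
have d4 : density pi nu c y ^+ 4 = (t ^+ 2)^-1.
  rewrite (exprM _ 2 2) sqr_sqrtr ?invr_ge0// exprVn real_normK ?num_real//.
rewrite /transverse_form linearZ /= -scalemxAl mxE exprMn exprMn exprVn d4 invrK.
rewrite [`|_| ^+ 4](exprM _ 2 2) real_normK ?num_real// -exprM.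
set s := ((nu c y)^T *m Z) 0 0.
ring.
Qed.

Lemma vanishing_modular_class_absurd : simply_connected R P -> compact [set: P] -> False.
Proof.
move=> sc cP; have [[ne _] _] := sc.
have [h hP] := closed_form_exact transverse_form_is_form transverse_form_d0 sc.
have [c [x [cx W0]]] := primitive_critical_point cP ne hP.
by have := transverse_form_neq0 cx; rewrite W0 eqxx.
Qed.

End VanishingModularClass.

(** The modular class enters as a relation, so the existence clause keeps the statement on all [m]
    from being vacuous. *)
Theorem corollary1p3 (R : realType) (n : nat) (P : manifold R n)
    (pi : components P n n)
    (P_simply_connected : simply_connected R P)
    (P_compact : compact [set: P])
    (pi_poisson : is_poisson pi)
    (pi_regular : is_regular pi)
    (pi_codim1 : foliation_codim pi 1)
    (pi_oriented : transversally_oriented1 pi) :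
  (exists m : set (components P 1 n), is_modular_class pi m) /\
  (forall m : set (components P 1 n),
     is_modular_class pi m -> m <> H1_zero pi).
Proof.
have [nu [nu_form nu_neq0 nu_tangent]] := pi_oriented.
have pi_bivector : is_bivector_field pi by case: pi_poisson.
split.
  have [mu mu_volume] := volume_form_exists P_simply_connected pi_bivector pi_codim1
    nu_form nu_neq0 nu_tangent.
  exists (H1_class pi (modular_components pi mu)); exists mu, (modular_components pi mu).
  by split=> //; exact: modular_components_field.
move=> m [mu [phi [mu_volume phi_modular ->]]] E.
have oimg (c : chart P) : open (cimg c : set 'rV[R]_n) := @cimg_open _ _ P c.
(* The cosets are compared at the zero field. It lies in [H1_zero], hence by the supposed equality
   in the class of [phi], which says that 0 - phi is Hamiltonian. *)
have zero_in : H1_zero pi (fun _ _ => 0).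
  have smooth0 a b (c : chart P) : mx_smooth_on (cimg c : set 'rV[R]_n) (fun _ => (0 : 'M[R]_(a, b))).
    move=> i j; have H := smooth_on_cst (0 : R) (oimg c).
    by apply: smooth_on_ext H => [|x _]; [exact: oimg|rewrite mxE].
  split.
    split; first by split=> [c|c c' x _]; [exact: smooth0|rewrite mul0mx].
    move=> c x cx; apply/matrixP => i j; rewrite !mxE big1// => k _.
    by rewrite !partial_cst mxE mul0r !mulr0 !subr0.
  exists (fun=> 0); first by move=> c; exact: smooth_on_cst.
  move=> c x cx; rewrite subr0 /sharp.
  have -> : differential (P := P) (fun=> 0) c x = 0.
    by apply/colP => i; rewrite differentialE mxE partial_cst.
  by rewrite trmx0 mul0mx.
rewrite -E in zero_in; case: zero_in => _ [f f_smooth f_ham].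
apply: (vanishing_modular_class_absurd pi_poisson pi_codim1 nu_form nu_neq0 nu_tangent
  mu_volume phi_modular f_smooth _ P_simply_connected P_compact).
by move=> c x cx; rewrite -f_ham// sub0r.
Qed.
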